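(* Let $\mathbb K$ be $\mathbb R$, $\mathbb C$ or the quaternions $\mathbb H$, let $\theta=\tfrac12\dim_{\mathbb R}\mathbb K$, let $1\le n\le m$, and let $\sigma_1,\dots,\sigma_n,\tau_1,\dots,\tau_n$ be complex numbers with $\operatorname{Re}\sigma_j>0$ and $\operatorname{Re}\tau_j>\operatorname{Re}\sigma_j+(j-1)\theta$ for $j=1,\dots,n$. Then $$\int_{\mathrm{Mat}_{\mathbb K}(n,m)}\ \prod_{j=1}^{n-1}\frac{\det(\{T\}_j\{T\}_j^* )^{\sigma_j-\sigma_{j+1}-\theta}}{\det(1+\{T\}_j\{T\}_j^* )^{\tau_j-\tau_{j+1}+\theta}}\cdot\frac{\det(TT^* )^{\sigma_n-(m-n+1)\theta}}{\det(1+TT^* )^{\tau_n}}\,dT=\pi^{mn\theta}\prod_{j=1}^{n}\frac{\Gamma(\sigma_j)\,\Gamma(\tau_j-\sigma_j-(j-1)\theta)}{\Gamma(\tau_j)\,\Gamma((m-j+1)\theta)}.$$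
   Context: $\mathrm{Mat}_{\mathbb K}(n,m)$ is the space of matrices over $\mathbb K$ with $n$ rows and $m$ columns, with Lebesgue measure $dT$ the product over all entries of the standard Lebesgue measure on $\mathbb K$ ($dx$ on $\mathbb R$; $du\,dv$ for $x=u+iv\in\mathbb C$; $du\,dv\,dw\,dz$ for $x=u+iv+jw+kz\in\mathbb H$). $\{T\}_j$ is the matrix formed by the first $j$ rows of $T$; $*$ is conjugate transpose. The determinant of a positive semidefinite Hermitian $j\times j$ matrix over $\mathbb K$ is the product of its $j$ eigenvalues (for $\mathbb K=\mathbb H$, the $j$ entries of the real diagonal matrix to which it is conjugate by the quaternionic unitary group). Complex powers of positive numbers are $x^s=e^{s\ln x}$. *)

(* Defs.v *)
From HB Require Import structures.
From mathcomp Require Import all_boot all_order all_algebra.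
From mathcomp Require Import all_classical all_reals all_analysis.
From mathcomp Require Import complex ring.

Set Implicit Arguments.
Unset Strict Implicit.
Unset Printing Implicit Defensive.

Import Order.TTheory GRing.Theory Num.Theory.
Import numFieldNormedType.Exports.

Local Open Scope classical_set_scope.
Local Open Scope ring_scope.
Local Open Scope complex_scope.

(* q1 + qi i + qj j + qk k *)
Record quaternion (R : Type) := Quaternion { q1 : R; qi : R; qj : R; qk : R }.

Section QuaternionRing.
Variable R : comNzRingType.
Local Notation H := (quaternion R).
Implicit Types x y z : H.

Definition quat_to_prod x := (q1 x, qi x, qj x, qk x).
Definition quat_of_prod (u : R * R * R * R) :=
  let: (a, b, c, d) := u in Quaternion a b c d.

Fact quat_to_prodK : cancel quat_to_prod quat_of_prod.
Proof. by case. Qed.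

HB.instance Definition _ := Choice.copy H (can_type quat_to_prodK).

Definition realq (a : R) : H := Quaternion a 0 0 0.
Definition addq x y :=
  Quaternion (q1 x + q1 y) (qi x + qi y) (qj x + qj y) (qk x + qk y).
Definition oppq x := Quaternion (- q1 x) (- qi x) (- qj x) (- qk x).
Definition conjq x := Quaternion (q1 x) (- qi x) (- qj x) (- qk x).

(* i^2 = j^2 = k^2 = ijk = -1 *)
Definition mulq x y :=
  Quaternion
    (q1 x * q1 y - qi x * qi y - qj x * qj y - qk x * qk y)
    (q1 x * qi y + qi x * q1 y + qj x * qk y - qk x * qj y)
    (q1 x * qj y - qi x * qk y + qj x * q1 y + qk x * qi y)
    (q1 x * qk y + qi x * qj y - qj x * qi y + qk x * q1 y).

Fact addqA : associative addq.
Proof. by move=> [? ? ? ?] [? ? ? ?] [? ? ? ?]; rewrite /addq/= !addrA. Qed.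
Fact addqC : commutative addq.
Proof. by move=> [? ? ? ?] [? ? ? ?]; congr Quaternion; rewrite /= addrC. Qed.
Fact add0q : left_id (realq 0) addq.
Proof. by move=> [? ? ? ?]; rewrite /addq/= !add0r. Qed.
Fact addNq : left_inverse (realq 0) oppq addq.
Proof. by move=> [? ? ? ?]; rewrite /addq/= !addNr. Qed.

HB.instance Definition _ := GRing.isZmodule.Build H addqA addqC add0q addNq.

Fact mulqA : associative mulq.
Proof. by move=> [? ? ? ?] [? ? ? ?] [? ? ? ?]; congr Quaternion => /=; ring. Qed.
Fact mul1q : left_id (realq 1) mulq.
Proof. by move=> [? ? ? ?]; congr Quaternion => /=; ring. Qed.
Fact mulq1 : right_id (realq 1) mulq.
Proof. by move=> [? ? ? ?]; congr Quaternion => /=; ring. Qed.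
Fact mulqDl : left_distributive mulq addq.
Proof. by move=> [? ? ? ?] [? ? ? ?] [? ? ? ?]; congr Quaternion => /=; ring. Qed.
Fact mulqDr : right_distributive mulq addq.
Proof. by move=> [? ? ? ?] [? ? ? ?] [? ? ? ?]; congr Quaternion => /=; ring. Qed.
Fact oneq_neq0 : realq 1 != 0.
Proof. by apply/eqP => -[/eqP]; rewrite oner_eq0. Qed.

HB.instance Definition _ := GRing.Zmodule_isNzRing.Build H
  mulqA mul1q mulq1 mulqDl mulqDr oneq_neq0.

End QuaternionRing.

Inductive scalars := Reals | Complexes | Quaternions.

Definition scalar (R : realType) (K : scalars) : nzRingType :=
  match K with
  | Reals => R
  | Complexes => R[i]
  | Quaternions => quaternion R
  end.

Definition real_dim (K : scalars) : nat :=
  match K with Reals => 1 | Complexes => 2 | Quaternions => 4 end.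

Definition theta (R : realType) (K : scalars) : R := (real_dim K)%:R / 2.

Definition sconj (R : realType) (K : scalars) : scalar R K -> scalar R K :=
  match K return scalar R K -> scalar R K with
  | Reals => id
  | Complexes => @conjc R
  | Quaternions => @conjq R
  end.

Definition sreal (R : realType) (K : scalars) : R -> scalar R K :=
  match K return R -> scalar R K with
  | Reals => id
  | Complexes => fun a => a%:C
  | Quaternions => @realq R
  end.

Definition scalar_of_coords (R : realType) (K : scalars) :
    (real_dim K).-tuple R -> scalar R K :=
  match K return (real_dim K).-tuple R -> scalar R K with
  | Reals => fun x => x`_0
  | Complexes => fun x => Complex x`_0 x`_1
  | Quaternions => fun x => Quaternion x`_0 x`_1 x`_2 x`_3
  end.

Section Determinant.
Variables (R : realType) (K : scalars).

Definition ctrmx (p q : nat) (A : 'M[scalar R K]_(p, q)) :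
    'M[scalar R K]_(q, p) :=
  (map_mx (@sconj R K) A)^T.

Definition is_unitary (p : nat) (U : 'M[scalar R K]_p) : Prop :=
  U *m ctrmx U = 1%:M /\ ctrmx U *m U = 1%:M.

Definition hermitian_eigenvalues (p : nat) (A : 'M[scalar R K]_p)
    (lambda : 'rV[R]_p) : Prop :=
  exists2 U : 'M[scalar R K]_p, is_unitary U &
    A = U *m diag_mx (map_mx (@sreal R K) lambda) *m ctrmx U.

(* Meant for Hermitian A, where the diagonalization exists and the product
   does not depend on it; the default value 0 is never used there. *)
Definition hdet (p : nat) (A : 'M[scalar R K]_p) : R :=
  xget 0 [set d | exists2 lambda : 'rV[R]_p, hermitian_eigenvalues A lambda &
                    d = \prod_(i < p) lambda ord0 i].

(* The first i + 1 rows of T (i is numbered from 0). *)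
Definition first_rows (n m : nat) (i : 'I_n) (T : 'M[scalar R K]_(n, m)) :
    'M[scalar R K]_(i.+1, m) :=
  rowsub (widen_ord (ltn_ord i)) T.

End Determinant.

Section ComplexAnalysis.
Variable R : realType.

Definition cexp (z : R[i]) : R[i] :=
  (expR (complex.Re z))%:C * Complex (cos (complex.Im z)) (sin (complex.Im z)).

(* Meant for 0 < x; since ln 0 = 0, cpow 0 s = 1. *)
Definition cpow (x : R) (s : R[i]) : R[i] := cexp (s * (ln x)%:C).

Section Integral.
Context d (T : measurableType d).
Variables (mu : {measure set T -> \bar R}) (D : set T) (f : T -> R[i]).

Definition cintegrable : Prop :=
  mu.-integrable D (fun x => (complex.Re (f x))%:E) /\
  mu.-integrable D (fun x => (complex.Im (f x))%:E).

Definition cintegral : R[i] :=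
  Complex (Rintegral mu D (fun x => complex.Re (f x)))
          (Rintegral mu D (fun x => complex.Im (f x))).

(* f is absolutely integrable on D, with integral v. *)
Definition has_cintegral (v : R[i]) : Prop := cintegrable /\ cintegral = v.

End Integral.

(* Euler's integral, which converges (absolutely) for 0 < Re s. *)
Definition cGamma (s : R[i]) : R[i] :=
  cintegral (@lebesgue_measure R) `]0, +oo[
    (fun t => cpow t (s - 1) * (expR (- t))%:C).

End ComplexAnalysis.

Section PowerMeasure.
Local Open Scope ereal_scope.
Context d (T : measurableType d) (R : realType).

Definition tuple_cons n (x : T * n.-tuple T) : n.+1.-tuple T :=
  [tuple of x.1 :: x.2].

Fact measurable_tuple_cons n : measurable_fun setT (@tuple_cons n).
Proof. exact: measurable_cons. Qed.

Definition tuple_uncons n (x : n.+1.-tuple T) : T * n.-tuple T :=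
  (thead x, [tuple of behead x]).

Fact measurable_tuple_uncons n : measurable_fun setT (@tuple_uncons n).
Proof.
apply/measurable_fun_pairP; split.
  exact: (@measurable_tnth _ T n.+1 ord0).
exact: measurable_behead.
Qed.

Fact tuple_consK n : cancel (@tuple_cons n) (@tuple_uncons n).
Proof. by move=> [x t]; congr pair; apply: val_inj. Qed.

Section Cons.
Variables (mu : {sigma_finite_measure set T -> \bar R}) (n : nat).
Variable nu : {sigma_finite_measure set (n.-tuple T) -> \bar R}.

Definition cons_measure : set (n.+1.-tuple T) -> \bar R :=
  pushforward (mu \x nu) (@tuple_cons n).

HB.instance Definition _ := Measure.copy cons_measure
  (measure_function_pushforward__canonical__measure_function_Measure (mu \x nu)
     (@measurable_tuple_cons n)).

Let cons_measure_sigma_finite : sigma_finite setT cons_measure.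
Proof.
have /sigma_finiteP[F [TF ndF Foo]] := sigma_finiteT mu.
have /sigma_finiteP[G [TG ndG Goo]] := sigma_finiteT nu.
exists (fun k => @tuple_uncons n @^-1` (F k `*` G k)).
  rewrite predeqE => x; split=> // _.
  have [i _ Fi] : (\bigcup_i F i) (tuple_uncons x).1 by rewrite -TF.
  have [j _ Gj] : (\bigcup_j G j) (tuple_uncons x).2 by rewrite -TG.
  exists (maxn i j) => //; split.
  - by move: Fi; exact/subsetPset/ndF/leq_maxl.
  - by move: Gj; exact/subsetPset/ndG/leq_maxr.
move=> k; have [mF Fk] := Foo k; have [mG Gk] := Goo k.
have mFG : measurable (F k `*` G k) by exact: measurableX.
split.
  by rewrite -[X in measurable X]setTI; exact: measurable_tuple_uncons.
rewrite /cons_measure /pushforward -comp_preimage.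
rewrite (_ : _ \o _ = idfun); last by apply/funext; exact: tuple_consK.
by rewrite preimage_id product_measure1E// lte_mul_pinfty// ge0_fin_numE.
Qed.

HB.instance Definition _ := Measure_isSigmaFinite.Build _ _ _ cons_measure
  cons_measure_sigma_finite.

End Cons.

(* The n-fold product measure of mu with itself. *)
Fixpoint power_measure (mu : {sigma_finite_measure set T -> \bar R}) (n : nat) :
    {sigma_finite_measure set (n.-tuple T) -> \bar R} :=
  match n with
  | 0 => \d_([tuple] : 0.-tuple T)
  | n'.+1 => cons_measure mu (power_measure mu n')
  end.

End PowerMeasure.

Section MatrixMeasure.
Variables (R : realType) (K : scalars) (n m : nat).

(* The real coordinates of an n x m matrix over K, entry by entry. *)
Definition mat_coords : Type :=
  n.-tuple (m.-tuple ((real_dim K).-tuple (measurableTypeR R))).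

Definition mat_of_coords (t : mat_coords) : 'M[scalar R K]_(n, m) :=
  \matrix_(i, j) @scalar_of_coords R K (tnth (tnth t i) j).

Definition mat_measure :=
  power_measure
    (power_measure (power_measure (@lebesgue_measure R) (real_dim K)) m) n.

End MatrixMeasure.

(* Main.v *)
(* The last row [t] of the matrix is integrated out first. For fixed first n rows
   X of full rank, det(T T^* ) = det(X X^* ) delta(t) and
   det(1 + T T^* ) = det(1 + X X^* ) eta(t), where by Schur complements delta is the
   squared distance of [t] to the row space of X and eta is 1 plus a positive
   definite form. Diagonalizing X^* X, a linear change of variables
   t = x sqrt(1 + la) V, of Jacobian det(1 + X X^* )^theta, turns delta into the sum
   of |x_i|^2 over the m - n null eigenvalues and eta into 1 + |x|^2. The row
   integral is then a product of Gamma functions: write (1 + |x|^2)^(-tau)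
   as a Gamma integral of Gaussians, and compute Gaussian moments of delta from the
   scaling behaviour of Lebesgue measure. The factors det(X X^* ) and
   det(1 + X X^* ) that come out are exactly those that turn the integrand for n + 1
   rows into the integrand for n rows.

   Over the quaternions determinants are read off the real matrix [rho A] of
   A acting on row vectors, whose determinant is the power [real_dim K] of
   [hdet A]. *)
Require Import Defs.
From HB Require Import structures.
From mathcomp Require Import all_boot all_order all_algebra.
From mathcomp Require Import all_classical all_reals all_analysis.
From mathcomp Require Import measurable_realfun complex ring lra.

Set Implicit Arguments.
Unset Strict Implicit.
Unset Printing Implicit Defensive.

Import Order.TTheory GRing.Theory Num.Theory.
Import numFieldNormedType.Exports.

Import Defs.

Local Open Scope classical_set_scope.
Local Open Scope ring_scope.
Local Open Scope complex_scope.

Local Notation Re := complex.Re.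
Local Notation Im := complex.Im.
Local Notation normc := Normc.normc.

(** * Complex-valued integrals *)

Section ComplexFacts.
Variable R : realType.
Implicit Types z w : R[i].

(** Absolute convergence is part of the claim, so every computation carries integrability along with
    the value. It comes from Tonelli: the modulus of each integrand is the same integrand with the
    parameters replaced by their real parts, so one computation yields both the bound and the value.

    Gamma(tau) enters as a factor of the row integral, and dividing by it requires that Gamma have
    no zero in the right half-plane; a hypothetical zero is pushed far to the right, where Euler's
    integral excludes it.

    Linear substitutions are reduced to two kinds of maps: dilations act on each real coordinate
    separately, and unitary invariance follows from the uniqueness of translation invariant
    measures, normalised by a Gaussian. In the same spirit, the law of a partial squared norm under
    the Gaussian is a uniqueness statement for the measure dt / t on the half-line.

    A row integral has its closed form only for X of full rank. The identities between iterated
    integrals therefore hold almost everywhere, and the change of variables for a row is also what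
    shows that rank-deficient matrices form a null set. *)

Lemma normc_ge0 z : 0 <= normc z.
Proof. by case: z => a b; exact: sqrtr_ge0. Qed.

Lemma Re_le_normc z : `|Re z| <= normc z.
Proof.
by case: z => a b /=; rewrite -sqrtr_sqr ler_wsqrtr// lerDl sqr_ge0.
Qed.

Lemma Im_le_normc z : `|Im z| <= normc z.
Proof.
by case: z => a b /=; rewrite -sqrtr_sqr ler_wsqrtr// lerDr sqr_ge0.
Qed.

Lemma normc_le z : normc z <= `|Re z| + `|Im z|.
Proof.
case: z => a b /=; rewrite -[leRHS]ger0_norm ?addr_ge0// -sqrtr_sqr.
rewrite ler_wsqrtr// sqrrD !real_normK ?num_real// -addrA lerD2l lerDr.
by rewrite mulrn_wge0// mulr_ge0.
Qed.

Lemma normcR (a : R) : normc a%:C = `|a|.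
Proof. by rewrite /= expr0n addr0 sqrtr_sqr. Qed.

Lemma ReMc z w : Re (z * w) = Re z * Re w - Im z * Im w.
Proof. by case: z w => [? ?] [? ?]. Qed.

Lemma ImMc z w : Im (z * w) = Re z * Im w + Im z * Re w.
Proof. by case: z w => [? ?] [? ?]. Qed.

Lemma normc_eq0 z : (normc z == 0) = (z == 0).
Proof.
apply/eqP/eqP => [/Normc.eq0_normc//|->].
by rewrite -(rmorph0 (@real_complex R)) normcR normr0.
Qed.

End ComplexFacts.

Section ComplexMeasurable.
Context d (T : measurableType d) (R : realType).
Implicit Types f g : T -> R[i].

Definition cmeasurable f :=
  measurable_fun setT (fun x => Re (f x)) /\
  measurable_fun setT (fun x => Im (f x)).

Lemma cmeasurable_cst z : cmeasurable (cst z).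
Proof. by split; exact: measurable_cst. Qed.

Lemma cmeasurable_real (h : T -> R) :
  measurable_fun setT h -> cmeasurable (fun x => (h x)%:C).
Proof. by move=> mh; split => //=; exact: measurable_cst. Qed.

Lemma cmeasurableM f g :
  cmeasurable f -> cmeasurable g -> cmeasurable (fun x => f x * g x).
Proof.
move=> [f1 f2] [g1 g2]; split.
- under eq_fun do rewrite ReMc.
  by apply: measurable_funB; exact: measurable_funM.
- under eq_fun do rewrite ImMc.
  by apply: measurable_funD; exact: measurable_funM.
Qed.

Lemma cmeasurable_prod (I : eqType) (s : seq I) (P : pred I) (F : I -> T -> R[i]) :
  (forall i, cmeasurable (F i)) ->
  cmeasurable (fun x => \prod_(i <- s | P i) F i x).
Proof.
move=> mF; elim: s => [|i s IH].
  rewrite (_ : (fun _ => _) = cst 1); first exact: cmeasurable_cst.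
  by apply/funext => x; rewrite big_nil.
case Pi : (P i); last first.
  by rewrite (_ : (fun _ => _) = (fun x => \prod_(j <- s | P j) F j x))//;
    apply/funext => x; rewrite big_cons Pi.
rewrite (_ : (fun _ => _) = (fun x => F i x * \prod_(j <- s | P j) F j x)).
  exact: cmeasurableM.
by apply/funext => x; rewrite big_cons Pi.
Qed.

Lemma cmeasurable_normc f :
  cmeasurable f -> measurable_fun setT (fun x => normc (f x)).
Proof.
move=> [f1 f2].
rewrite (_ : (fun _ => _) = (fun x => Num.sqrt (Re (f x) ^+ 2 + Im (f x) ^+ 2))).
  apply: measurableT_comp.
    by apply: continuous_measurable_fun; exact: sqrt_continuous.
  by apply: measurable_funD; exact: measurable_funX.
by apply/funext => x; case: (f x).
Qed.

Lemma cmeasurable_cexp f :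
  cmeasurable f -> cmeasurable (fun x => cexp (f x)).
Proof.
move=> [f1 f2]; apply: cmeasurableM.
  by apply: cmeasurable_real; exact: measurableT_comp.
split => /=.
- apply: measurableT_comp f2; apply: continuous_measurable_fun.
  exact: continuous_cos.
- apply: measurableT_comp f2; apply: continuous_measurable_fun.
  exact: continuous_sin.
Qed.

Lemma cmeasurable_cpow (h : T -> R) s :
  measurable_fun setT h -> cmeasurable (fun x => cpow (h x) s).
Proof.
move=> mh; apply: cmeasurable_cexp; apply: cmeasurableM.
  exact: cmeasurable_cst.
by apply: cmeasurable_real; apply: measurableT_comp.
Qed.

End ComplexMeasurable.

Lemma cmeasurable_comp d d' (T : measurableType d) (T' : measurableType d')
    (R : realType) (phi : T -> T') (f : T' -> R[i]) :
  measurable_fun setT phi -> cmeasurable f -> cmeasurable (f \o phi).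
Proof.
move=> mphi [f1 f2]; split.
- exact: (measurableT_comp f1).
- exact: (measurableT_comp f2).
Qed.

Lemma ae_eq_integrable d (T : measurableType d) (R : realType)
    (mu : {measure set T -> \bar R}) (h k : T -> \bar R) :
  measurable_fun setT k -> ae_eq mu setT h k ->
  mu.-integrable setT h -> mu.-integrable setT k.
Proof.
move=> mk hk /integrableP[mh hoo]; apply/integrableP; split=> //.
rewrite (ae_eq_integral (abse \o h))//; try exact: measurableT_comp.
by apply: filterS hk => x hkx Dx /=; rewrite hkx.
Qed.

(** Swapping the coordinates reduces this to [integrable_fubini_F]; the swapped function is
    integrable because both iterated integrals of its absolute value are finite together. *)
Lemma integrable_fubini_G d d' (X : measurableType d) (Y : measurableType d')
    (R : realType) (mu : {sigma_finite_measure set X -> \bar R})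
    (nu : {sigma_finite_measure set Y -> \bar R}) (f : X * Y -> \bar R) :
  (mu \x nu)%E.-integrable setT f -> nu.-integrable setT (fubini_G mu f).
Proof.
move=> fi; have mf := measurable_int _ fi.
apply: (@integrable_fubini_F _ _ _ _ _ nu mu (fun z => f (z.2, z.1))).
apply/integrable12ltyP; first by apply: (measurableT_comp mf); exact: measurable_fun_pair.
exact/(integrable21ltyP mu nu mf).
Qed.

Section ComplexIntegral.
Context d (T : measurableType d) (R : realType).
Variable mu : {measure set T -> \bar R}.
Implicit Types f g : T -> R[i].

(** The modulus dominates both parts and is dominated by the sum of their absolute values, so
    integrability of a complex function becomes finiteness of one nonnegative integral, to which
    Tonelli applies. *)
Lemma cintegrableP f : cintegrable mu setT f <->
  cmeasurable f /\ (\int[mu]_x (normc (f x))%:E < +oo)%E.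
Proof.
split=> [[fR fI]|[[mR mI] foo]].
  have mf : cmeasurable f.
    by split; apply/measurable_EFinP; exact: (measurable_int mu).
  split=> //.
  have fRI := integrableD measurableT (integrable_abse fR) (integrable_abse fI).
  have /integrableP[_] := fRI; apply: le_lt_trans; apply: ge0_le_integral => //.
  - by move=> x _; rewrite lee_fin normc_ge0.
  - by apply/measurable_EFinP; exact: cmeasurable_normc.
  - apply: measurableT_comp => //; apply: emeasurable_funD;
      apply: measurableT_comp => //; exact: (measurable_int mu).
  - move=> x _; rewrite /= lee_fin.
    by rewrite (le_trans (normc_le _))// ler_norm.
split; apply/integrableP; split; try exact/measurable_EFinP.
- apply: le_lt_trans foo; apply: ge0_le_integral => //.
  + by apply: measurableT_comp => //; exact/measurable_EFinP.
  + by apply/measurable_EFinP; exact: cmeasurable_normc.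
  + by move=> x _; rewrite lee_fin Re_le_normc.
- apply: le_lt_trans foo; apply: ge0_le_integral => //.
  + by apply: measurableT_comp => //; exact/measurable_EFinP.
  + by apply/measurable_EFinP; exact: cmeasurable_normc.
  + by move=> x _; rewrite lee_fin Im_le_normc.
Qed.

Lemma has_cintegral_eq f g v : f =1 g ->
  has_cintegral mu setT f v -> has_cintegral mu setT g v.
Proof. by move=> /funext ->. Qed.

Lemma has_cintegral_fun f v w :
  has_cintegral mu setT f v -> has_cintegral mu setT f w -> v = w.
Proof. by move=> [_ <-] [_ <-]. Qed.

(** [Rintegral] sends an infinite integral to 0; integrability rules this out and turns the
    equalities of reals into equalities of extended reals. *)
Lemma has_cintegralE f v : has_cintegral mu setT f v <->
  [/\ cintegrable mu setT f,
      (\int[mu]_x (Re (f x))%:E = (Re v)%:E)%E &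
      (\int[mu]_x (Im (f x))%:E = (Im v)%:E)%E].
Proof.
split=> [[fi <-]|[fi fR fI]].
  by case: (fi) => fR fI; split=> //=; rewrite /Rintegral fineK//; exact: integrable_fin_num.
by split=> //; rewrite /cintegral /Rintegral fR fI /=; case: (v).
Qed.

Lemma has_cintegral_real (h : T -> R) (w : R) :
  mu.-integrable setT (EFin \o h) -> (\int[mu]_x (h x)%:E = w%:E)%E ->
  has_cintegral mu setT (fun x => (h x)%:C) w%:C.
Proof.
move=> hi hw; apply/has_cintegralE; split => //=.
- by split => //=; exact: integrable0.
- by rewrite integral0.
Qed.

Lemma has_cintegralZ f v (c : R[i]) : has_cintegral mu setT f v ->
  has_cintegral mu setT (fun x => c * f x) (c * v).
Proof.
move=> /has_cintegralE[[fR fI] vR vI]; apply/has_cintegralE.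
have iR a := integrableZl measurableT a fR.
have iI a := integrableZl measurableT a fI.
have ER : (fun x => (Re (c * f x))%:E) =
  (fun x => (Re c)%:E * (Re (f x))%:E - (Im c)%:E * (Im (f x))%:E)%E.
  by apply/funext => x; rewrite ReMc EFinB !EFinM.
have EI : (fun x => (Im (c * f x))%:E) =
  (fun x => (Re c)%:E * (Im (f x))%:E + (Im c)%:E * (Re (f x))%:E)%E.
  by apply/funext => x; rewrite ImMc EFinD !EFinM.
split.
- by split; rewrite ?ER ?EI; [exact: integrableB|exact: integrableD].
- by rewrite ER integralB//= !integralZl//= vR vI -!EFinM -EFinB ReMc.
- by rewrite EI integralD//= !integralZl//= vR vI -!EFinM -EFinD ImMc.
Qed.

Lemma has_cintegralB f g v w : has_cintegral mu setT f v ->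
  has_cintegral mu setT g w ->
  has_cintegral mu setT (fun x => f x - g x) (v - w).
Proof.
move=> /has_cintegralE[[fR fI] vR vI] /has_cintegralE[[gR gI] wR wI].
apply/has_cintegralE.
have ER : (fun x => (Re (f x - g x))%:E) =
  (fun x => (Re (f x))%:E - (Re (g x))%:E)%E.
  by apply/funext => x; case: (f x) (g x) => [? ?] [? ?].
have EI : (fun x => (Im (f x - g x))%:E) =
  (fun x => (Im (f x))%:E - (Im (g x))%:E)%E.
  by apply/funext => x; case: (f x) (g x) => [? ?] [? ?].
split.
- by split; rewrite ?ER ?EI; exact: integrableB.
- by rewrite ER integralB//= vR wR; case: (v) (w) => [? ?] [? ?].
- by rewrite EI integralB//= vI wI; case: (v) (w) => [? ?] [? ?].
Qed.

(** Measurability of [g] is a hypothesis because the measures need not be complete. *)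
Lemma has_cintegral_ae f g v : cmeasurable g ->
  {ae mu, forall x, f x = g x} ->
  has_cintegral mu setT f v -> has_cintegral mu setT g v.
Proof.
move=> [gR gI] fg /has_cintegralE[[fR fI] vR vI]; apply/has_cintegralE.
have aR : ae_eq mu setT (fun x => (Re (f x))%:E) (fun x => (Re (g x))%:E).
  by apply: filterS fg => x fgx _ /=; rewrite fgx.
have aI : ae_eq mu setT (fun x => (Im (f x))%:E) (fun x => (Im (g x))%:E).
  by apply: filterS fg => x fgx _ /=; rewrite fgx.
have mfR := measurable_int _ fR; have mfI := measurable_int _ fI.
have mgR : measurable_fun setT (fun x => (Re (g x))%:E) by exact/measurable_EFinP.
have mgI : measurable_fun setT (fun x => (Im (g x))%:E) by exact/measurable_EFinP.
split.
- by split; [exact: ae_eq_integrable aR fR|exact: ae_eq_integrable aI fI].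
- by rewrite -vR; apply: ae_eq_integral => //; exact: ae_eq_sym.
- by rewrite -vI; apply: ae_eq_integral => //; exact: ae_eq_sym.
Qed.

(** Integrals over an interval are traded for integrals over the whole line with an indicator in the
    integrand, the form in which transfer and Fubini are stated. *)
Lemma has_cintegral_indic (D : set T) f v : measurable D ->
  has_cintegral mu D f v <->
  has_cintegral mu setT (fun x => f x * (\1_D x)%:C) v.
Proof.
move=> mD.
have ER : (fun x => (Re (f x * (\1_D x)%:C))%:E) =
          ((fun x => (Re (f x))%:E) \_ D).
  apply/funext => x; rewrite ReMc /= mulr0 subr0 /patch indicE.
  by case: ifPn => _; rewrite ?mulr1 ?mulr0.
have EI : (fun x => (Im (f x * (\1_D x)%:C))%:E) =
          ((fun x => (Im (f x))%:E) \_ D).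
  apply/funext => x; rewrite ImMc /= mulr0 add0r /patch indicE.
  by case: ifPn => _; rewrite ?mulr1 ?mulr0.
rewrite /has_cintegral /cintegrable /cintegral /Rintegral.
rewrite !ER !EI -!integral_mkcond.
by split=> -[[iR iI] e]; split=> //; split; apply/(integrable_mkcond _ mD).
Qed.

End ComplexIntegral.

(** * Transfer of complex integrals along a change of variables *)

Section Transfer.
Context d d' (X : measurableType d) (Y : measurableType d') (R : realType).
Variables (mu : {measure set X -> \bar R}) (nu : {measure set Y -> \bar R}).
Variables (phi : X -> Y) (w1 : X -> R) (w2 : Y -> R).
Hypotheses (mphi : measurable_fun setT phi) (mw1 : measurable_fun setT w1)
  (mw2 : measurable_fun setT w2).
Hypotheses (w1_ge0 : forall x, 0 <= w1 x) (w2_ge0 : forall y, 0 <= w2 y).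
(** A change of variables known for nonnegative functions. Both sides carry a density, which covers
    a linear substitution with constant Jacobian as well as the law of a function under a weighted
    measure. *)
Hypothesis transfer : forall g : Y -> \bar R, measurable_fun setT g ->
  (forall y, (0 <= g y)%E) ->
  (\int[mu]_x (g (phi x) * (w1 x)%:E) = \int[nu]_y (g y * (w2 y)%:E))%E.

Lemma integral_transfer (h : Y -> R) : measurable_fun setT h ->
  (\int[mu]_x (h (phi x) * w1 x)%:E = \int[nu]_y (h y * w2 y)%:E)%E.
Proof.
move=> mh; have mEh : measurable_fun setT (EFin \o h) by exact/measurable_EFinP.
(* Nonnegative weights commute with positive and negative parts, so the hypothesis applies to each
   part separately. *)
have pE (Z : Type) (k w : Z -> R) (z : Z) : 0 <= w z ->
    ((fun z => (k z * w z)%:E)^\+ z = (EFin \o k)^\+ z * (w z)%:E)%E.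
  by move=> w0; rewrite !funeposE /= -!EFin_max -EFinM maxr_pMl// mul0r.
have nE (Z : Type) (k w : Z -> R) (z : Z) : 0 <= w z ->
    ((fun z => (k z * w z)%:E)^\- z = (EFin \o k)^\- z * (w z)%:E)%E.
  by move=> w0; rewrite !funenegE /= -!EFin_max -EFinM maxr_pMl// mul0r mulNr.
rewrite integralE [RHS]integralE; congr (_ - _)%E.
- rewrite (eq_integral (fun x => (EFin \o h)^\+ (phi x) * (w1 x)%:E)%E); last first.
    move=> x _; rewrite (pE _ (h \o phi))//.
    by rewrite !funeposE.
  rewrite transfer//; last exact: measurable_funepos.
  by apply: eq_integral => y _; rewrite pE.
- rewrite (eq_integral (fun x => (EFin \o h)^\- (phi x) * (w1 x)%:E)%E); last first.
    move=> x _; rewrite (nE _ (h \o phi))//.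
    by rewrite !funenegE.
  rewrite transfer//; last exact: measurable_funeneg.
  by apply: eq_integral => y _; rewrite nE.
Qed.

Lemma integrable_transfer (h : Y -> R) : measurable_fun setT h ->
  mu.-integrable setT (fun x => (h (phi x) * w1 x)%:E) <->
  nu.-integrable setT (fun y => (h y * w2 y)%:E).
Proof.
move=> mh.
have m1 : measurable_fun setT (fun x => (h (phi x) * w1 x)%:E).
  by apply/measurable_EFinP/measurable_funM => //; exact: measurableT_comp.
have m2 : measurable_fun setT (fun y => (h y * w2 y)%:E).
  by apply/measurable_EFinP/measurable_funM.
have e : (\int[mu]_x `|(h (phi x) * w1 x)%:E| =
          \int[nu]_y `|(h y * w2 y)%:E|)%E.
  have := integral_transfer (measurableT_comp (@normr_measurable R setT) mh).
  move=> /= e; under eq_integral do rewrite /= normrM (ger0_norm (w1_ge0 _)).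
  by under [RHS]eq_integral do rewrite /= normrM (ger0_norm (w2_ge0 _)).
by split=> /integrableP[_]; [rewrite e|rewrite -e] => ?; apply/integrableP.
Qed.

Lemma has_cintegral_transfer (f : Y -> R[i]) v : cmeasurable f ->
  has_cintegral mu setT (fun x => f (phi x) * (w1 x)%:C) v <->
  has_cintegral nu setT (fun y => f y * (w2 y)%:C) v.
Proof.
move=> [fR fI]; rewrite !has_cintegralE /cintegrable.
have rE (Z : Type) (k : Z -> R[i]) (w : Z -> R) :
    (fun z => (Re (k z * (w z)%:C))%:E) = (fun z => (Re (k z) * w z)%:E).
  by apply/funext => z; rewrite ReMc/= mulr0 subr0.
have iE (Z : Type) (k : Z -> R[i]) (w : Z -> R) :
    (fun z => (Im (k z * (w z)%:C))%:E) = (fun z => (Im (k z) * w z)%:E).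
  by apply/funext => z; rewrite ImMc/= mulr0 add0r.
rewrite !rE !iE (integral_transfer fR) (integral_transfer fI).
by split=> -[[/(integrable_transfer fR) ? /(integrable_transfer fI) ?]].
Qed.

End Transfer.

(** * Fubini's theorem for complex functions *)

Section ComplexFubini.
Context d d' (X : measurableType d) (Y : measurableType d') (R : realType).
Variables (mu : {sigma_finite_measure set X -> \bar R})
  (nu : {sigma_finite_measure set Y -> \bar R}).
Variable F : X * Y -> R[i].

(** Tonelli for the modulus. The inner integral [w] has to be known almost everywhere, which is what
    matrices of full rank provide. *)
Lemma cintegrable_prod (w : X -> R) : cmeasurable F ->
  {ae mu, forall x, (\int[nu]_y (normc (F (x, y)))%:E = (w x)%:E)%E} ->
  mu.-integrable setT (EFin \o w) -> cintegrable (mu \x nu)%E setT F.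
Proof.
move=> mF Fw /integrableP[mw woo]; apply/cintegrableP; split => //.
have mn : measurable_fun setT (fun z => (normc (F z))%:E).
  by apply/measurable_EFinP; exact: cmeasurable_normc.
rewrite fubini_tonelli1//; last by move=> z; rewrite lee_fin normc_ge0.
rewrite (ae_eq_integral (EFin \o w))//.
- apply: le_lt_trans woo; apply: le_trans (le_abse_integral _ _ _) => //.
  exact: lee_abs.
- apply: measurable_fun_fubini_tonelli_F => // z.
  by rewrite lee_fin normc_ge0.
- by apply: filterS Fw => x Fx _; rewrite /fubini_F Fx.
Qed.

(** [G] is the inner integral almost everywhere, which leaves room for rank-deficient matrices. The
    equivalence serves in both directions: to evaluate the double integral, and to read off an
    iterated one. *)
Lemma has_cintegral_fubini1 (G : X -> R[i]) v : cmeasurable G ->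
  cintegrable (mu \x nu)%E setT F ->
  {ae mu, forall x, has_cintegral nu setT (fun y => F (x, y)) (G x)} ->
  has_cintegral mu setT G v <-> has_cintegral (mu \x nu)%E setT F v.
Proof.
move=> [GR GI] [FR FI] FG.
have mR := measurable_fubini_F FR; have mI := measurable_fubini_F FI.
have aR : ae_eq mu setT (fubini_F nu (fun z => (Re (F z))%:E)) (fun x => (Re (G x))%:E).
  by apply: filterS FG => x /has_cintegralE[_ + _] _.
have aI : ae_eq mu setT (fubini_F nu (fun z => (Im (F z))%:E)) (fun x => (Im (G x))%:E).
  by apply: filterS FG => x /has_cintegralE[_ _ +] _.
have mGR : measurable_fun setT (fun x => (Re (G x))%:E) by exact/measurable_EFinP.
have mGI : measurable_fun setT (fun x => (Im (G x))%:E) by exact/measurable_EFinP.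
have eR : (\int[mu]_x (Re (G x))%:E = \int[mu \x nu]_z (Re (F z))%:E)%E.
  by rewrite -integral12_prod_meas1//; apply: ae_eq_integral => //; exact: ae_eq_sym.
have eI : (\int[mu]_x (Im (G x))%:E = \int[mu \x nu]_z (Im (F z))%:E)%E.
  by rewrite -integral12_prod_meas1//; apply: ae_eq_integral => //; exact: ae_eq_sym.
rewrite !has_cintegralE eR eI; split=> -[iG vR vI]; split=> //.
split; [apply: ae_eq_integrable (integrable_fubini_F FR)|
        apply: ae_eq_integrable (integrable_fubini_F FI)] => //.
Qed.

Lemma has_cintegral_fubini2 (G : Y -> R[i]) v : cmeasurable G ->
  cintegrable (mu \x nu)%E setT F ->
  {ae nu, forall y, has_cintegral mu setT (fun x => F (x, y)) (G y)} ->
  has_cintegral nu setT G v <-> has_cintegral (mu \x nu)%E setT F v.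
Proof.
move=> [GR GI] [FR FI] FG.
have mR := measurable_fubini_G FR; have mI := measurable_fubini_G FI.
have aR : ae_eq nu setT (fubini_G mu (fun z => (Re (F z))%:E)) (fun x => (Re (G x))%:E).
  by apply: filterS FG => x /has_cintegralE[_ + _] _.
have aI : ae_eq nu setT (fubini_G mu (fun z => (Im (F z))%:E)) (fun x => (Im (G x))%:E).
  by apply: filterS FG => x /has_cintegralE[_ _ +] _.
have mGR : measurable_fun setT (fun x => (Re (G x))%:E) by exact/measurable_EFinP.
have mGI : measurable_fun setT (fun x => (Im (G x))%:E) by exact/measurable_EFinP.
have eR : (\int[nu]_x (Re (G x))%:E = \int[mu \x nu]_z (Re (F z))%:E)%E.
  by rewrite -integral21_prod_meas1//; apply: ae_eq_integral => //; exact: ae_eq_sym.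
have eI : (\int[nu]_x (Im (G x))%:E = \int[mu \x nu]_z (Im (F z))%:E)%E.
  by rewrite -integral21_prod_meas1//; apply: ae_eq_integral => //; exact: ae_eq_sym.
rewrite !has_cintegralE eR eI; split=> -[iG vR vI]; split=> //.
split; [apply: ae_eq_integrable (integrable_fubini_G FR)|
        apply: ae_eq_integrable (integrable_fubini_G FI)] => //.
Qed.

End ComplexFubini.

(** * Power measures *)

Section PowerMeasureIntegral.
Context d (T : measurableType d) (R : realType).
Variable mu : {sigma_finite_measure set T -> \bar R}.
Local Open Scope ereal_scope.

Lemma integral_power_cons n (f : n.+1.-tuple T -> \bar R) :
  measurable_fun setT f -> (forall t, 0 <= f t) ->
  \int[power_measure mu n.+1]_t f t =
  \int[mu]_x \int[power_measure mu n]_t f (tuple_cons (x, t)).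
Proof.
move=> mf f0.
have mc := @measurable_tuple_cons _ T n.
rewrite -(@fubini_tonelli1 _ _ _ _ _ mu (power_measure mu n) (f \o @tuple_cons _ T n))//.
  have := @ge0_integral_pushforward _ _ _ _ R _ mc (mu \x power_measure mu n)
    setT f measurableT mf (fun t _ => f0 t).
  by rewrite preimage_setT.
  exact: measurableT_comp.
by move=> z; exact: f0.
Qed.

Lemma integral_power0 (f : 0.-tuple T -> \bar R) : measurable_fun setT f ->
  \int[power_measure mu 0]_t f t = f [tuple].
Proof. by move=> mf /=; rewrite integral_dirac//= diracT mul1e. Qed.

Lemma measurable_tuple_map n (phi : 'I_n -> T -> T) :
  (forall i, measurable_fun setT (phi i)) ->
  measurable_fun setT (fun t : n.-tuple T => [tuple phi i (tnth t i) | i < n]).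
Proof.
move=> mphi; apply/measurable_fun_tnthP => i.
rewrite (_ : _ \o _ = phi i \o (fun t => tnth t i)).
  by apply: measurableT_comp => //; exact: measurable_tnth.
by apply/funext => t /=; rewrite tnth_mktuple.
Qed.

Lemma measurable_tuple_consr n (x : T) :
  measurable_fun setT (fun t : n.-tuple T => tuple_cons (x, t)).
Proof.
exact: (measurableT_comp (@measurable_tuple_cons _ T n) (measurable_pair1 x)).
Qed.

Lemma measurable_integral_power_cons n (f : n.+1.-tuple T -> \bar R) :
  measurable_fun setT f -> (forall t, 0 <= f t) ->
  measurable_fun setT
    (fun x => \int[power_measure mu n]_t f (tuple_cons (x, t))).
Proof.
move=> mf f0.
apply: (@measurable_fun_fubini_tonelli_F _ _ _ _ _ (power_measure mu n)
  (f \o @tuple_cons _ T n)).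
  by apply: measurableT_comp => //; exact: measurable_tuple_cons.
by move=> z; exact: f0.
Qed.

Lemma tnth_tuple_cons0 n (x : T) (t : n.-tuple T) :
  tnth (tuple_cons (x, t)) ord0 = x.
Proof. by rewrite (tnth_nth x). Qed.

Lemma tnth_tuple_consS n (x : T) (t : n.-tuple T) i :
  tnth (tuple_cons (x, t)) (lift ord0 i) = tnth t i.
Proof. by rewrite !(tnth_nth x). Qed.

(** Tonelli lets the one-variable Jacobians [c i] multiply up. Hypothesis and conclusion have the
    same form, so the lemma can be applied to a power of a power, as rows of scalars require. *)
Lemma integral_power_map n (phi : 'I_n -> T -> T) (c : 'I_n -> R)
    (g : n.-tuple T -> \bar R) :
  (forall i, measurable_fun setT (phi i)) ->
  (forall i (h : T -> \bar R), measurable_fun setT h -> (forall x, 0 <= h x) ->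
     \int[mu]_x h (phi i x) = (c i)%:E * \int[mu]_x h x) ->
  (forall i, (0 <= c i)%R) ->
  measurable_fun setT g -> (forall t, 0 <= g t) ->
  \int[power_measure mu n]_t g [tuple phi i (tnth t i) | i < n] =
  (\prod_(i < n) c i)%:E * \int[power_measure mu n]_t g t.
Proof.
move=> + + + mg.
elim: n phi c g mg => [|n IH] phi c g mg mphi hphi c0 g0.
  rewrite big_ord0 mul1e; apply: eq_integral => t _.
  by congr (g _); apply: eq_from_tnth => -[].
have mmap := measurable_tuple_map mphi.
rewrite integral_power_cons//; last exact: measurableT_comp.
rewrite [in RHS]integral_power_cons//.
have E x t : [tuple phi i (tnth (tuple_cons (x, t)) i) | i < n.+1] =
    tuple_cons (phi ord0 x, [tuple phi (lift ord0 i) (tnth t i) | i < n]).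
  apply: eq_from_tnth => i; rewrite tnth_mktuple.
  have [j ->|->] := unliftP ord0 i.
    by rewrite !tnth_tuple_consS tnth_mktuple.
  by rewrite !tnth_tuple_cons0.
under eq_integral do under eq_integral do rewrite E.
have IH' x := IH _ (c \o lift ord0) (fun t => g (tuple_cons (phi ord0 x, t)))
  (measurableT_comp mg (measurable_tuple_consr _)) (fun i => mphi (lift ord0 i))
  (fun i => hphi (lift ord0 i)).
transitivity (\int[mu]_x ((\prod_(i < n) c (lift ord0 i))%:E *
    \int[power_measure mu n]_t g (tuple_cons (phi ord0 x, t)))).
  by apply: eq_integral => x _; apply: IH' => [i|t]; [exact: c0|exact: g0].
have mI := measurable_integral_power_cons mg g0.
rewrite (hphi ord0 (fun x => (\prod_(i < n) c (lift ord0 i))%:E *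
  \int[power_measure mu n]_t g (tuple_cons (x, t)))) //.
- rewrite ge0_integralZl//; last 2 first.
    by move=> x _; exact: integral_ge0.
    by rewrite lee_fin prodr_ge0.
  by rewrite muleA -EFinM big_ord_recl.
- exact: measurable_funeM.
- by move=> x; rewrite mule_ge0 ?integral_ge0// lee_fin prodr_ge0.
Qed.

Lemma integral_power_prod n (h : 'I_n -> T -> R) (I : 'I_n -> R) :
  (forall i, measurable_fun setT (h i)) -> (forall i x, (0 <= h i x)%R) ->
  (forall i, \int[mu]_x (h i x)%:E = (I i)%:E) ->
  \int[power_measure mu n]_t (\prod_(i < n) h i (tnth t i))%:E =
  (\prod_(i < n) I i)%:E.
Proof.
elim: n h I => [|n IH] h I mh h0 hI.
  rewrite (eq_integral (cst 1)).
    by rewrite integral_power0 ?big_ord0//; exact: measurable_cst.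
  by move=> t _; rewrite big_ord0.
rewrite integral_power_cons; last 2 first.
- apply/measurable_EFinP; apply: measurable_prod => i _.
  by apply: measurableT_comp => //; exact: measurable_tnth.
- by move=> t; rewrite lee_fin prodr_ge0.
under eq_integral => x _.
  under eq_integral => t _.
    rewrite big_ord_recl tnth_tuple_cons0.
    under eq_bigr do rewrite tnth_tuple_consS.
    rewrite EFinM.
    over.
  rewrite ge0_integralZl//; last 3 first.
  - apply/measurable_EFinP; apply: measurable_prod => i _.
    by apply: measurableT_comp => //; exact: measurable_tnth.
  - by move=> t _; rewrite lee_fin prodr_ge0.
  - by rewrite lee_fin.
  rewrite (IH (h \o lift ord0) (I \o lift ord0))//; last 3 first.
  - by move=> i; exact: mh.
  - by move=> i y; exact: h0.
  - by move=> i; exact: hI.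
  over.
rewrite ge0_integralZr//; last 3 first.
- exact/measurable_EFinP.
- by move=> x _; rewrite lee_fin.
- rewrite lee_fin prodr_ge0// => i _ /=.
  by rewrite -lee_fin -hI integral_ge0// => x _; rewrite lee_fin.
by rewrite hI -EFinM big_ord_recl.
Qed.

(** For the first coordinate the outer integral runs over the null set [A]; for any other one the
    inner integral vanishes by induction. *)
Lemma power_measure_null n (i : 'I_n) (A : set T) : measurable A -> mu A = 0 ->
  power_measure mu n [set t | A (tnth t i)] = 0.
Proof.
move=> mA A0; elim: n i => [[]//|n IH i].
have mAi k (j : 'I_k) : measurable [set t : k.-tuple T | A (tnth t j)].
  by rewrite -[X in measurable X]setTI; exact: (@measurable_tnth _ T k j).
transitivity (\int[power_measure mu n.+1]_t (\1_[set t | A (tnth t i)] t)%:E).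
  by rewrite integral_indic// ?setIT//; exact: mAi.
rewrite integral_power_cons//; last first.
  by apply/measurable_EFinP; apply: measurable_indic; exact: mAi.
have I0 x t : \1_[set t : n.+1.-tuple T | A (tnth t ord0)] (tuple_cons (x, t)) =
    \1_A x :> R.
  by rewrite /indic /mkset /= /in_mem /= /in_set /= tnth_tuple_cons0.
have [j ->|->] := unliftP ord0 i.
  rewrite integral0_eq// => x _.
  transitivity (\int[power_measure mu n]_t (\1_[set t | A (tnth t j)] t)%:E).
    apply: eq_integral => t _; rewrite !indicE; congr (_%:R%:E).
    by congr (nat_of_bool _); apply/idP/idP; rewrite !inE /= tnth_tuple_consS.
  by rewrite integral_indic; [rewrite setIT; exact: IH|by []|exact: mAi].
under eq_integral => x _.
  rewrite (eq_integral (fun=> (\1_A x)%:E)); last by move=> t _; rewrite I0.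
  rewrite integral_cst//.
  over.
rewrite (ae_eq_integral (cst 0)) ?integral0//.
- apply: emeasurable_funM; last exact: measurable_cst.
  by apply/measurable_EFinP; exact: measurable_indic.
- exists A; split=> // x; rewrite /= not_implyE => -[_].
  by rewrite indicE; case: (boolP (x \in A)) => [/set_mem//|]; rewrite mul0e.
Qed.

Definition tuple_rcons n (z : n.-tuple T * T) : n.+1.-tuple T :=
  [tuple of rcons z.1 z.2].

Lemma tuple_rcons_cons n x (t : n.-tuple T) y :
  tuple_rcons (tuple_cons (x, t), y) = tuple_cons (x, tuple_rcons (t, y)).
Proof. exact: val_inj. Qed.

Lemma measurable_tuple_rcons n : measurable_fun setT (@tuple_rcons n).
Proof.
apply/measurable_fun_tnthP => i.
have [ilt|ige] := ltnP i n.
  rewrite (_ : _ \o _ = (fun t => tnth t (Ordinal ilt)) \o fst).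
    by apply: measurableT_comp; [exact: measurable_tnth|exact: measurable_fst].
  apply/funext => -[t x] /=; rewrite !(tnth_nth x)/= nth_rcons size_tuple.
  by rewrite ilt.
rewrite (_ : _ \o _ = snd); first exact: measurable_snd.
apply/funext => -[t x] /=; rewrite !(tnth_nth x)/= nth_rcons size_tuple.
have -> : (i : nat) = n by apply/eqP; rewrite eqn_leq ige -ltnS ltn_ord.
by rewrite ltnn eqxx.
Qed.

(** [power_measure] splits off the first factor, whereas the induction on rows removes the last one;
    an induction through [tuple_rcons_cons] moves the splitting point to the other end. *)
Lemma integral_power_rcons n (f : n.+1.-tuple T -> \bar R) :
  measurable_fun setT f -> (forall t, 0 <= f t) ->
  \int[power_measure mu n.+1]_t f t =
  \int[power_measure mu n]_t \int[mu]_x f (tuple_rcons (t, x)).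
Proof.
elim: n f => [|n IH] f mf f0.
  rewrite integral_power_cons// integral_power0.
    apply: eq_integral => x _; rewrite integral_power0.
      by congr (f _); exact: val_inj.
    by apply: measurableT_comp => //; exact: measurable_tuple_consr.
  apply: (@measurable_fun_fubini_tonelli_F _ _ _ _ _ mu
    (fun z => f (tuple_rcons z))) => //.
  by apply: measurableT_comp => //; exact: measurable_tuple_rcons.
have mfr : measurable_fun setT (fun z : n.+1.-tuple T * T => f (tuple_rcons z)).
  by apply: measurableT_comp => //; exact: measurable_tuple_rcons.
rewrite integral_power_cons// [RHS]integral_power_cons; last 2 first.
- exact: (@measurable_fun_fubini_tonelli_F _ _ _ _ _ mu _ mfr).
- by move=> t; exact: integral_ge0.
apply: eq_integral => x _.
rewrite (IH (fun t => f (tuple_cons (x, t)))); [|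
  exact: (measurableT_comp mf (measurable_tuple_consr _))|by move=> t; exact: f0].
by apply: eq_integral => t _; apply: eq_integral => y _; rewrite tuple_rcons_cons.
Qed.

End PowerMeasureIntegral.

(** * Powers of positive numbers *)

Section Powers.
Variable R : realType.
Implicit Types (x y a b : R) (s w : R[i]).

(* As for [cpow], ln x = 0 makes epow x a = 1 if x <= 0. *)
Definition epow x a : R := expR (a * ln x).

Lemma epow_gt0 x a : 0 < epow x a. Proof. exact: expR_gt0. Qed.

Lemma epow_ge0 x a : 0 <= epow x a. Proof. exact: expR_ge0. Qed.

Lemma epowD x a b : epow x (a + b) = epow x a * epow x b.
Proof. by rewrite /epow mulrDl expRD. Qed.

Lemma epowN x a : epow x (- a) = (epow x a)^-1.
Proof. by rewrite /epow mulNr expRN. Qed.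

Lemma epowx0 x : epow x 0 = 1. Proof. by rewrite /epow mul0r expR0. Qed.

Lemma epow1x a : epow 1 a = 1. Proof. by rewrite /epow ln1 mulr0 expR0. Qed.

Lemma epowx1 x : 0 < x -> epow x 1 = x.
Proof. by move=> x0; rewrite /epow mul1r lnK ?posrE. Qed.

Lemma epowM x y a : 0 < x -> 0 < y -> epow (x * y) a = epow x a * epow y a.
Proof. by move=> x0 y0; rewrite /epow lnM ?posrE// mulrDr expRD. Qed.

Lemma epow_powR x a : 0 < x -> epow x a = x `^ a.
Proof. by move=> x0; rewrite /powR gt_eqF. Qed.

Lemma measurable_epow a : measurable_fun setT (fun x => epow x a).
Proof.
by apply: measurableT_comp => //; apply: measurable_funM => //; exact: measurable_ln.
Qed.

Lemma cexpD s w : cexp (s + w) = cexp s * cexp w.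
Proof.
case: s w => [a b] [c e]; apply/eqP; rewrite eq_complex.
rewrite /cexp /= expRD cosD sinD; apply/andP; split; apply/eqP; ring.
Qed.

Lemma normc_cexp s : normc (cexp s) = expR (Re s).
Proof.
by rewrite Normc.normcM normcR /= cos2Dsin2 sqrtr1 mulr1 ger0_norm// expR_ge0.
Qed.

Lemma cexpR a : cexp a%:C = (expR a)%:C.
Proof. by rewrite /cexp /= cos0 sin0 mulr1. Qed.

Lemma cexp_neq0 s : cexp s != 0.
Proof. by rewrite -normc_eq0 normc_cexp gt_eqF// expR_gt0. Qed.

Lemma cpowD x s w : cpow x (s + w) = cpow x s * cpow x w.
Proof. by rewrite /cpow mulrDl cexpD. Qed.

Lemma cpowx0 x : cpow x 0 = 1 :> R[i].
Proof. by rewrite /cpow mul0r (cexpR 0) expR0. Qed.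

Lemma cpow1x s : cpow 1 s = 1 :> R[i].
Proof. by rewrite /cpow ln1 mulr0 (cexpR 0) expR0. Qed.

Lemma cpow_neq0 x s : cpow x s != 0. Proof. exact: cexp_neq0. Qed.

Lemma cpowN x s : cpow x (- s) = (cpow x s)^-1.
Proof.
by apply: (mulfI (cpow_neq0 x s)); rewrite -cpowD subrr cpowx0 divff ?cpow_neq0.
Qed.

Lemma cpowM x y s : 0 < x -> 0 < y -> cpow (x * y) s = cpow x s * cpow y s.
Proof.
move=> x0 y0; rewrite /cpow lnM ?posrE//.
by rewrite (rmorphD (@real_complex R)) mulrDr cexpD.
Qed.

(** Valid for every real x, since [epow] and [cpow] share the convention for x <= 0. *)
Lemma normc_cpow x s : normc (cpow x s) = epow x (Re s).
Proof. by rewrite normc_cexp ReMc /= mulr0 subr0. Qed.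

Lemma cpow_real x a : cpow x a%:C = (epow x a)%:C.
Proof. by rewrite /cpow -(rmorphM (@real_complex R)) cexpR. Qed.

Lemma Re_cpow x s : Re (cpow x s) = epow x (Re s) * cos (Im s * ln x).
Proof.
by rewrite /cpow /cexp; case: s => a b; rewrite ReMc /= !mulr0 !mul0r !subr0 !add0r.
Qed.

Lemma Im_cpow x s : Im (cpow x s) = epow x (Re s) * sin (Im s * ln x).
Proof.
by rewrite /cpow /cexp; case: s => a b; rewrite ImMc /= !mulr0 !mul0r !subr0 !add0r !addr0.
Qed.

Lemma is_derive_epow a x : 0 < x ->
  is_derive x 1 (fun t => epow t a) (a * epow x (a - 1)).
Proof.
move=> x0; have dln := is_derive1_ln x0.
have -> : a * epow x (a - 1) = (a * x^-1) * expR (a * ln x).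
  by rewrite epowD epowN epowx1// -/(epow x a); ring.
have dal : is_derive x 1 (fun t => a * ln t) (a * x^-1).
  exact: (@is_deriveZ _ _ _ (@ln R) a x 1 x^-1 dln).
have := @is_derive1_comp R expR (fun t => a * ln t) x _ _ (is_derive_expR _) dal.
by rewrite mulrC.
Qed.

Lemma is_derive_cos_ln b x : 0 < x ->
  is_derive x 1 (fun t => cos (b * ln t)) (- (b * x^-1 * sin (b * ln x))).
Proof.
move=> x0; have dln := is_derive1_ln x0.
have dbl : is_derive x 1 (fun t => b * ln t) (b * x^-1).
  exact: (@is_deriveZ _ _ _ (@ln R) b x 1 x^-1 dln).
have := @is_derive1_comp R cos (fun t => b * ln t) x _ _ (is_derive_cos _) dbl.
by rewrite mulNr mulrC.
Qed.

Lemma is_derive_sin_ln b x : 0 < x ->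
  is_derive x 1 (fun t => sin (b * ln t)) (b * x^-1 * cos (b * ln x)).
Proof.
move=> x0; have dln := is_derive1_ln x0.
have dbl : is_derive x 1 (fun t => b * ln t) (b * x^-1).
  exact: (@is_deriveZ _ _ _ (@ln R) b x 1 x^-1 dln).
have := @is_derive1_comp R sin (fun t => b * ln t) x _ _ (is_derive_sin _) dbl.
by rewrite mulrC.
Qed.

Lemma is_derive_Re_cpow s x : 0 < x ->
  is_derive x 1 (fun t => Re (cpow t s)) (Re (s * cpow x (s - 1))).
Proof.
move=> x0; under eq_fun do rewrite Re_cpow.
have d1 := is_derive_epow (Re s) x0; have d2 := is_derive_cos_ln (Im s) x0.
refine (eq_ind _ (is_derive x 1 _) (is_deriveM d1 d2) _ _).
rewrite ReMc Re_cpow Im_cpow; case: s {d1 d2} => a b /=.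
rewrite subr0 /GRing.scale /= epowD epowN epowx1//; field.
by rewrite gt_eqF.
Qed.

Lemma is_derive_Im_cpow s x : 0 < x ->
  is_derive x 1 (fun t => Im (cpow t s)) (Im (s * cpow x (s - 1))).
Proof.
move=> x0; under eq_fun do rewrite Im_cpow.
have d1 := is_derive_epow (Re s) x0; have d2 := is_derive_sin_ln (Im s) x0.
refine (eq_ind _ (is_derive x 1 _) (is_deriveM d1 d2) _ _).
rewrite ImMc Re_cpow Im_cpow; case: s {d1 d2} => a b /=.
rewrite subr0 /GRing.scale /= epowD epowN epowx1//; field.
by rewrite gt_eqF.
Qed.

Lemma derive_continuous (f : R -> R) x l : is_derive x 1 f l ->
  {for x, continuous f}.
Proof.
by move=> [df _]; apply: differentiable_continuous; exact/derivable1_diffP.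
Qed.

End Powers.

(** * Translations and dilations of the line *)

Section LebesgueLine.
Variable R : realType.
Local Notation leb := (@lebesgue_measure R).
Local Open Scope ereal_scope.

(** The image measure agrees with Lebesgue measure on half-open intervals, and these determine
    it. *)
Lemma lebesgue_shift (c : R) (g : measurableTypeR R -> \bar R) :
  measurable_fun setT g -> (forall x, 0 <= g x) ->
  \int[leb]_x g (x + c)%R = \int[leb]_x g x.
Proof.
move=> mg g0.
have ma : measurable_fun setT (fun x : measurableTypeR R => (x + c)%R : measurableTypeR R).
  exact: measurable_funD.
have := @ge0_integral_pushforward _ _ _ _ R _ ma leb setT g measurableT mg (fun t _ => g0 t).
rewrite preimage_setT => <-; apply: eq_measure_integral => A mA _.
apply/esym.
pose nu := measure_function_pushforward__canonical__measure_function_Measure leb ma.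
apply: (@lebesgue_measure_unique R nu) => // _ [[a b]] _ <-.
rewrite /nu /= /pushforward.
rewrite (_ : _ @^-1` _ = `](a - c)%R, (b - c)%R]%classic).
  rewrite !lebesgue_measure_itv/= !lte_fin ltrD2r; case: ifP => // _.
  by rewrite -!EFinD; congr (_%:E); ring.
by apply/seteqP; split => x /=; rewrite !in_itv/= ltrBlDr lerBrDr.
Qed.

(** The image measure, multiplied by [c], agrees with Lebesgue measure on half-open intervals. *)
Lemma lebesgue_dilation (c : R) (g : measurableTypeR R -> \bar R) : (0 < c)%R ->
  measurable_fun setT g -> (forall x, 0 <= g x) ->
  \int[leb]_x g (c * x)%R = c^-1%:E * \int[leb]_x g x.
Proof.
move=> c0 mg g0.
have ma : measurable_fun setT (fun x : measurableTypeR R => (c * x)%R : measurableTypeR R).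
  exact: measurable_funM.
have := @ge0_integral_pushforward _ _ _ _ R _ ma leb setT g measurableT mg (fun t _ => g0 t).
rewrite preimage_setT /comp => <-.
pose nu := measure_function_pushforward__canonical__measure_function_Measure leb ma.
pose k := NngNum (ltW c0).
transitivity (c^-1%:E * \int[mscale k nu]_x g x); last first.
  congr (_ * _); apply: eq_measure_integral => A mA _.
  apply/esym; apply: (@lebesgue_measure_unique R (mscale k nu)) => // _ [[a b]] _ <-.
  rewrite /nu /= /mscale /= /pushforward.
  rewrite (_ : _ @^-1` _ = `](c^-1 * a)%R, (c^-1 * b)%R]%classic).
    rewrite !lebesgue_measure_itv/= !lte_fin ltr_pM2l ?invr_gt0//.
    case: ifP => _; last by rewrite mule0.
    by rewrite -!EFinD -EFinM; congr (_%:E); field; rewrite gt_eqF.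
  apply/seteqP; split => x /=;
    by rewrite !in_itv/= !(mulrC c^-1%R) ltr_pdivrMr// ler_pdivlMr// mulrC.
rewrite ge0_integral_mscale//= muleA -EFinM mulVf ?mul1e//.
by rewrite gt_eqF.
Qed.

End LebesgueLine.

(** * Elementary integrals on the half-line *)

Section Calculus.
Variable R : realType.
Local Notation leb := (@lebesgue_measure R).

Lemma FTC2_pos (f F : R -> R) (a b : R) : 0 < a -> a < b ->
  (forall x : R, 0 < x -> is_derive x 1 F (f x)) ->
  (forall x : R, 0 < x -> {for x, continuous f}) ->
  (\int[leb]_(x in `[a, b]) (f x)%:E = (F b - F a)%:E)%E.
Proof.
move=> a0 ab dF cf; have b0 := lt_trans a0 ab.
have cF (x : R) : 0 < x -> {for x, continuous F} by move=> /dF; exact: derive_continuous.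
rewrite EFinB; apply: continuous_FTC2 => //.
- apply: continuous_in_subspaceT => x /set_mem /=.
  by rewrite in_itv/= => /andP[ax _]; apply: cf; exact: lt_le_trans ax.
- split => /=.
  + by move=> x; rewrite in_itv/= => /andP[ax _]; case: (dF x (lt_trans a0 ax)).
  + by apply: cvg_at_right_filter; exact: cF.
  + by apply: cvg_at_left_filter; exact: cF.
- move=> x; rewrite in_itv/= => /andP[ax _].
  by rewrite derive1E; have := dF x (lt_trans a0 ax) => dFx; rewrite derive_val.
Qed.

Lemma FTC2_posy (f F : R -> R) (a l : R) : 0 < a ->
  (forall x : R, 0 < x -> is_derive x 1 F (f x)) ->
  (forall x : R, 0 < x -> {for x, continuous f}) -> (forall x, 0 <= f x) ->
  F x @[x --> +oo] --> l ->
  (\int[leb]_(x in `[a, +oo[) (f x)%:E = (l - F a)%:E)%E.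
Proof.
move=> a0 dF cf f0 Fl.
have cF (x : R) : 0 < x -> {for x, continuous F} by move=> /dF; exact: derive_continuous.
rewrite EFinB; apply: ge0_continuous_FTC2y => //.
- apply: continuous_in_subspaceT => x /set_mem /=.
  by rewrite in_itv/= andbT => ax; apply: cf; exact: lt_le_trans ax.
- by move=> x ax; case: (dF x (lt_trans a0 ax)).
- by apply: cvg_at_right_filter; exact: cF.
- move=> x; rewrite in_itv/= andbT => ax.
  by rewrite derive1E; have := dF x (lt_trans a0 ax) => dFx; rewrite derive_val.
Qed.

Lemma cvg_expRNM (a : R) : 0 < a -> expR (- (a * x)) @[x --> +oo] --> 0.
Proof.
move=> a0; apply: (@cvg_comp _ _ _ (fun x => a * x) (fun y => expR (- y)) +oo +oo).
  by apply: gt0_cvgMry => //; exact: cvg_id.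
exact: cvgr_expR.
Qed.

Lemma cvg_ln_pinfty : @ln R x @[x --> +oo] --> +oo.
Proof.
apply/cvgryPge => A; near=> x.
have x0 : 0 < x by near: x; exact: nbhs_pinfty_gt.
rewrite -ler_expR lnK ?posrE//; near: x.
Unshelve. all: by end_near. Qed.

Lemma integral_epow_1y (a : R) : 0 < a ->
  (\int[leb]_(c in `[1%R, +oo[) (epow c (- a - 1))%:E = (a^-1)%:E)%E.
Proof.
move=> a0; pose F c : R := - a^-1 * epow c (- a).
have dF (x : R) : 0 < x -> is_derive x 1 F (epow x (- a - 1)).
  move=> x0; have d := is_derive_epow (- a) x0.
  refine (eq_ind _ (is_derive x 1 _) (is_deriveZ _ d) _ _).
  by rewrite /GRing.scale/= mulrA mulrNN mulVf ?mul1r// gt_eqF.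
have cf (x : R) : 0 < x -> {for x, continuous (fun c => epow c (- a - 1))}.
  by move=> x0; exact: (derive_continuous (is_derive_epow _ x0)).
have Fl : F x @[x --> +oo] --> 0.
  rewrite -[X in _ --> X](mulr0 (- a^-1)); apply: cvgMr.
  rewrite /epow; under eq_fun do rewrite mulNr.
  apply: (@cvg_comp _ _ _ (@ln R) (fun y => expR (- (a * y))) +oo +oo).
    exact: cvg_ln_pinfty.
  exact: cvg_expRNM.
rewrite (FTC2_posy ltr01 dF cf (fun x => epow_ge0 x _) Fl).
by rewrite /F epow1x mulr1 sub0r opprK.
Qed.

Lemma is_derive_expRNM (t x : R) : t != 0 ->
  is_derive x 1 (fun c => - t^-1 * expR (- (c * t))) (expR (- (x * t))).
Proof.
move=> t0.
have d1 : is_derive x 1 (fun c => - (c * t)) (- t).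
  have -> : (fun c => - (c * t)) = (fun c : R => (- t) *: c).
    by apply/funext => c; rewrite /GRing.scale/= mulNr mulrC.
  refine (eq_ind _ (is_derive x 1 _) (is_deriveZ _ (is_derive_id _ _)) _ _).
  by rewrite /GRing.scale/= mulr1.
have d2 := @is_derive1_comp R expR (fun c => - (c * t)) x _ _ (is_derive_expR _) d1.
refine (eq_ind _ (is_derive x 1 _) (is_deriveZ _ d2) _ _).
by rewrite /GRing.scale/=; field.
Qed.

Lemma continuous_expRNM (t x : R) : {for x, continuous (fun c : R => expR (- (c * t)))}.
Proof.
apply: continuous_comp; last exact: continuous_expR.
by apply: continuousN; apply: continuousM => //; exact: cvg_cst.
Qed.

Lemma integral_expRNM_1y (t : R) : 0 < t ->
  (\int[leb]_(c in `[1%R, +oo[) (expR (- (c * t)))%:E = (t^-1 * expR (- t))%:E)%E.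
Proof.
move=> t0; have tn0 : t != 0 by rewrite gt_eqF.
rewrite (FTC2_posy ltr01 (fun x _ => is_derive_expRNM x tn0)
  (fun x _ => @continuous_expRNM t x) (fun x => expR_ge0 _) (l := 0)).
- by rewrite mul1r sub0r mulNr opprK.
- rewrite -[X in _ --> X](mulr0 (- t^-1)); apply: cvgMr.
  by under eq_fun do rewrite mulrC; exact: cvg_expRNM.
Qed.

Lemma integral_expRNM_12 (t : R) : 0 < t ->
  (\int[leb]_(c in `[1%R, 2%R]) (expR (- (c * t)))%:E =
   (t^-1 * (expR (- t) - expR (- (2 * t))))%:E)%E.
Proof.
move=> t0; have tn0 : t != 0 by rewrite gt_eqF.
have lt12 : 1 < 2 :> R by rewrite ltr1n.
rewrite (FTC2_pos ltr01 lt12 (fun x _ => is_derive_expRNM x tn0)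
  (fun x _ => @continuous_expRNM t x)).
by congr (_%:E); rewrite mul1r; ring.
Qed.

Lemma continuous_Re_cpow (s : R[i]) (x : R) : 0 < x ->
  {for x, continuous (fun c : R => Re (cpow c s))}.
Proof. by move=> x0; exact: derive_continuous (is_derive_Re_cpow s x0). Qed.

Lemma continuous_Im_cpow (s : R[i]) (x : R) : 0 < x ->
  {for x, continuous (fun c : R => Im (cpow c s))}.
Proof. by move=> x0; exact: derive_continuous (is_derive_Im_cpow s x0). Qed.

(** An antiderivative is -c^(-s). On the compact interval [1, 2] integrability is immediate for
    complex s; the price is the factor 1 - 2^(-s), to be cancelled later. *)
Lemma has_cintegral_cpow_12 (s : R[i]) :
  has_cintegral leb `[1%R, 2%R] (fun c => s * cpow c (- s - 1)) (1 - cpow 2 (- s)).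
Proof.
have Rc (x : R) : 0 < x -> {for x, continuous (fun c : R => Re (s * cpow c (- s - 1)))}.
  move=> x0; refine (eq_ind _ (fun f : R -> R => {for x, continuous f}) _ _
    (esym (funext (fun c : R => ReMc s (cpow c (- s - 1)))))).
  apply: continuousB; apply: continuousM; try exact: cvg_cst.
    exact: continuous_Re_cpow.
  exact: continuous_Im_cpow.
have Ic (x : R) : 0 < x -> {for x, continuous (fun c : R => Im (s * cpow c (- s - 1)))}.
  move=> x0; refine (eq_ind _ (fun f : R -> R => {for x, continuous f}) _ _
    (esym (funext (fun c : R => ImMc s (cpow c (- s - 1)))))).
  apply: continuousD; apply: continuousM; try exact: cvg_cst.
    exact: continuous_Im_cpow.
  exact: continuous_Re_cpow.
have dR (x : R) : 0 < x -> is_derive x 1 (fun c => - Re (cpow c (- s)))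
    (Re (s * cpow x (- s - 1))).
  move=> x0.
  refine (eq_ind _ (is_derive x 1 _) (is_deriveN (is_derive_Re_cpow (- s) x0)) _ _).
  by rewrite mulNr; case: (s * _) => ? ? /=; rewrite opprK.
have dI (x : R) : 0 < x -> is_derive x 1 (fun c => - Im (cpow c (- s)))
    (Im (s * cpow x (- s - 1))).
  move=> x0.
  refine (eq_ind _ (is_derive x 1 _) (is_deriveN (is_derive_Im_cpow (- s) x0)) _ _).
  by rewrite mulNr; case: (s * _) => ? ? /=; rewrite opprK.
have lt12 : 1 < 2 :> R by rewrite ltr1n.
have itvpos x : x \in `[1%R, 2%R]%classic -> 0 < x :> R.
  by rewrite inE /= in_itv/= => /andP[+ _]; exact: lt_le_trans.
split.
- split; apply: continuous_compact_integrable; try exact: segment_compact.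
  + by apply: continuous_in_subspaceT => x /itvpos; exact: Rc.
  + by apply: continuous_in_subspaceT => x /itvpos; exact: Ic.
- rewrite /cintegral /Rintegral (FTC2_pos ltr01 lt12 dR Rc) (FTC2_pos ltr01 lt12 dI Ic).
  rewrite !cpow1x; set z := cpow 2 (- s); case: z => u v /=.
  by apply/eqP; rewrite eq_complex/=; apply/andP; split; apply/eqP; ring.
Qed.

End Calculus.

(** * The Gamma function *)

Section GammaFunction.
Variable R : realType.
Local Notation leb := (@lebesgue_measure R).
Implicit Types (a c t : R) (s : R[i]).

(** The Heaviside function. As a factor it extends integrands on the half-line by zero, which
    matters since [epow] and [cpow] are 1, not 0, at nonpositive arguments. *)
Definition hv t : R := \1_(`]0, +oo[%classic) t.

Lemma hvE t : hv t = (0 < t)%R%:R.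
Proof. by rewrite /hv indicE mem_setE in_itv/= andbT. Qed.

Lemma hv_ge0 t : 0 <= hv t. Proof. by rewrite hvE ler0n. Qed.

Lemma measurable_hv : measurable_fun setT hv.
Proof. by apply: measurable_indic; exact: measurable_itv. Qed.

Lemma hvM c t : 0 < c -> hv (c * t) = hv t.
Proof. by move=> c0; rewrite !hvE pmulr_rgt0. Qed.

Lemma measurable_expRNM c : measurable_fun setT (fun t : R => expR (- (c * t))).
Proof.
apply: measurableT_comp => //; apply: measurable_funN.
exact: measurable_funM.
Qed.

Lemma integral_indicE (D : set (measurableTypeR R)) (f : measurableTypeR R -> R) :
  (\int[leb]_(x in D) (f x)%:E = \int[leb]_x (f x * \1_D x)%:E)%E.
Proof.
rewrite integral_mkcond; apply: eq_integral => x _; rewrite /patch indicE.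
by case: ifP => _; rewrite ?mulr1 ?mulr0.
Qed.

(** The unnormalised density of the Gamma distribution. Its mass [M a] is Gamma(a), taken in the
    extended reals so that identities can precede finiteness. *)
Definition gpos a t : R := epow t (a - 1) * expR (- t) * hv t.
Local Notation M a := (\int[leb]_t (gpos a t)%:E)%E.

Lemma gpos_ge0 a t : 0 <= gpos a t.
Proof. exact: mulr_ge0 (mulr_ge0 (epow_ge0 _ _) (expR_ge0 _)) (hv_ge0 _). Qed.

Lemma measurable_gpos a : measurable_fun setT (gpos a).
Proof.
apply: measurable_funM; last exact: measurable_hv.
apply: measurable_funM; first exact: measurable_epow.
by under eq_fun do rewrite -[X in - X]mul1r; exact: measurable_expRNM.
Qed.

Lemma gpos_dilation a c : 0 < c ->
  (\int[leb]_t (epow t (a - 1) * expR (- (c * t)) * hv t)%:E =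
   (epow c (- a))%:E * M a)%E.
Proof.
move=> c0.
have mg : measurable_fun setT (fun t : measurableTypeR R => (epow c (1 - a) * gpos a t)%:E).
  by apply/measurable_EFinP; apply: measurable_funM => //; exact: measurable_gpos.
have g0 t : (0 <= (epow c (1 - a) * gpos a t)%:E)%E.
  by rewrite lee_fin mulr_ge0 ?epow_ge0 ?gpos_ge0.
have := lebesgue_dilation c0 mg g0.
under [X in _ = (_ * X)%E -> _]eq_integral do rewrite EFinM.
rewrite ge0_integralZl//; last 3 first.
- by apply/measurable_EFinP; exact: measurable_gpos.
- by move=> t _; rewrite lee_fin gpos_ge0.
- by rewrite lee_fin epow_ge0.
rewrite muleA -EFinM.
have -> : c^-1 * epow c (1 - a) = epow c (- a).
  by rewrite epowD epowx1// mulrA mulVf ?mul1r// gt_eqF.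
move=> <-; apply: eq_integral => t _; congr (_%:E); rewrite /gpos hvM// mulrA.
rewrite hvE; case: ltP => [t0|_]; last by rewrite !mulr0.
rewrite epowM// !mulrA -epowD (_ : 1 - a + (a - 1) = 0) ?epowx0 ?mul1r//.
by ring.
Qed.

(** Integrate t^a e^(-ct) over t > 0 and c >= 1: the integral over t is c^(-a-1) M(a+1), the one
    over c is t^(a-1) e^(-t). Both sides may be infinite, so the recursion can serve to prove
    finiteness. *)
Lemma gpos_rec a : 0 < a -> (M a = (a^-1)%:E * M (a + 1)%R)%E.
Proof.
move=> a0.
pose f (z : measurableTypeR R * measurableTypeR R) : \bar R :=
  (epow z.2 a * expR (- (z.1 * z.2)) * hv z.2 * \1_(`[1%R, +oo[%classic) z.1)%:E.
have mf : measurable_fun setT f.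
  apply/measurable_EFinP; apply: measurable_funM; last first.
    by apply: measurableT_comp => //; apply: measurable_indic; exact: measurable_itv.
  apply: measurable_funM; last first.
    by apply: measurableT_comp => //; exact: measurable_hv.
  apply: measurable_funM.
    exact: (measurableT_comp (measurable_epow a)).
  apply: measurableT_comp => //; apply: measurable_funN.
  exact: measurable_funM.
have f0 z : (0 <= f z)%E.
  rewrite lee_fin; apply: mulr_ge0; last by rewrite indicE.
  exact: mulr_ge0 (mulr_ge0 (epow_ge0 _ _) (expR_ge0 _)) (hv_ge0 _).
have := fubini_tonelli (m1 := leb) (m2 := leb) f mf f0.
have L c : (\int[leb]_t f (c, t) =
    (epow c (- a - 1) * \1_(`[1%R, +oo[%classic) c)%:E * M (a + 1)%R)%E.
  rewrite /f /= indicE mem_setE in_itv/= andbT.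
  case: leP => [c1|_]; last first.
    by rewrite mulr0 mul0e integral0_eq// => t _; rewrite mulr0.
  rewrite !mulr1 -opprD -gpos_dilation; last exact: lt_le_trans c1.
  by rewrite addrK; apply: eq_integral => t _; rewrite mulr1.
have Rr t : (\int[leb]_c f (c, t) = (gpos a t)%:E)%E.
  rewrite /f /gpos hvE; case: ltP => [t0|_] /=; last first.
    by rewrite mulr0 integral0_eq// => c _; rewrite mulr0 mul0r.
  under eq_integral do rewrite mulr1 -mulrA EFinM.
  rewrite ge0_integralZl//; last 2 first.
  - apply/measurable_EFinP; apply: measurable_funM.
      by under eq_fun do rewrite mulrC; exact: measurable_expRNM.
    by apply: measurable_indic; exact: measurable_itv.
  - by rewrite lee_fin epow_ge0.
  rewrite -integral_indicE integral_expRNM_1y// -EFinM mulr1 mulrA.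
  by rewrite epowD epowN epowx1.
under eq_integral do rewrite L.
under [X in _ = X -> _]eq_integral do rewrite Rr.
rewrite ge0_integralZr//; last 3 first.
- apply/measurable_EFinP; apply: measurable_funM; first exact: measurable_epow.
  by apply: measurable_indic; exact: measurable_itv.
- by move=> c _; rewrite lee_fin mulr_ge0 ?epow_ge0.
- by apply: integral_ge0 => t _; rewrite lee_fin gpos_ge0.
by rewrite -integral_indicE integral_epow_1y// => <-.
Qed.

Lemma gpos1_fin : (M 1 < +oo)%E.
Proof.
rewrite (_ : M 1 = 1%:E) ?ltry//.
transitivity (\int[leb]_(x in `[0%R, +oo[) (expR (- x))%:E)%E.
  rewrite -integral_itv_obnd_cbnd; last first.
    apply/measurable_EFinP/measurable_funTS.
    by under eq_fun do rewrite -[X in - X]mul1r; exact: measurable_expRNM.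
  rewrite [RHS]integral_indicE; apply: eq_integral => t _.
  by rewrite /gpos subrr epowx0 mul1r.
have cF (x : R) : {for x, continuous (fun c : R => expR (- c))}.
  by apply: continuous_comp; [exact: continuousN|exact: continuous_expR].
have dF (x : R) : is_derive x 1 (fun c : R => - expR (- c)) (expR (- x)).
  have E : (fun c : R => - 1^-1 * expR (- (c * 1))) = (fun c => - expR (- c)).
    by apply/funext => c; rewrite mulr1 invr1 mulN1r.
  by have := @is_derive_expRNM R 1 x (oner_neq0 _); rewrite E mulr1.
rewrite (@ge0_continuous_FTC2y _ _ (fun c => - expR (- c)) 0 0).
- by rewrite oppr0 expR0 -EFinB sub0r opprK.
- by move=> x _; exact: expR_ge0.
- by apply: continuous_in_subspaceT => x _; exact: cF.
- by rewrite -oppr0; apply: cvgN; exact: cvgr_expR.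
- by move=> x _; case: (dF x).
- by apply: cvg_at_right_filter; apply: cvgN; exact: cF.
- by move=> x _; rewrite derive1E; have d := dF x; rewrite derive_val.
Qed.

Lemma gpos_fin a : 0 < a -> (M a < +oo)%E.
Proof.
have M2 : (M 2 < +oo)%E.
  have := gpos_rec (@ltr01 R); rewrite invr1 mul1e (_ : 1 + 1 = 2)// => <-.
  exact: gpos1_fin.
(* For 0 < b <= 1 the recursion leads to the exponent b, where t^b <= 1 + t bounds [M (b + 1)] by
   [M 1 + M 2]. *)
have small b : 0 < b -> b <= 1 -> (M b < +oo)%E.
  move=> b0 b1; rewrite gpos_rec//.
  apply: lte_mul_pinfty; [by rewrite lee_fin invr_ge0 ltW|by []|].
  apply: (@le_lt_trans _ _ (M 1 + M 2)%E); last exact: lte_add_pinfty gpos1_fin M2.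
  rewrite -ge0_integralD//; try by
    [move=> t _; rewrite lee_fin gpos_ge0|apply/measurable_EFinP; exact: measurable_gpos].
  apply: ge0_le_integral => //.
  - by move=> t _; rewrite lee_fin gpos_ge0.
  - by apply/measurable_EFinP; exact: measurable_gpos.
  - by apply/measurable_EFinP; apply: measurable_funD; exact: measurable_gpos.
  move=> t _; rewrite -EFinD lee_fin /gpos -!mulrDl.
  rewrite hvE; case: ltP => [t0|_]; last by rewrite !mulr0.
  rewrite !mulr1 ler_wpM2r ?expR_ge0// addrK subrr epowx0.
  rewrite (_ : 2 - 1 = 1) ?epowx1//; last by ring.
  have [t1|t1] := leP t 1.
    rewrite (@le_trans _ _ 1)// ?lerDl ?(ltW t0)//.
    rewrite -(expR0 R) ler_expR mulr_ge0_le0// ?(ltW b0)//.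
    exact: ln_le0.
  rewrite (@le_trans _ _ t)// ?lerDr//.
  rewrite -{2}(epowx1 t0) ler_expR ler_wpM2r//.
  by rewrite ln_ge0// ltW.
(* For larger parameters the recursion is read downwards, one unit at a time. *)
have H n : forall b, 0 < b -> b <= n.+1%:R -> (M b < +oo)%E.
  elim: n => [|n IH] b b0 bn; first exact: small.
  have [b1|b1] := leP b 1; first exact: small.
  have b10 : 0 < b - 1 by rewrite subr_gt0.
  have := gpos_rec b10; rewrite subrK => e.
  have -> : (M b = (b - 1)%:E * M (b - 1)%R)%E.
    by rewrite e muleA -EFinM divff ?mul1e// gt_eqF.
  apply: lte_mul_pinfty; [by rewrite lee_fin ltW|by []|].
  by apply: IH => //; rewrite lerBlDr natr1.
move=> a0; apply: (H (Num.truncn a)) => //.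
by rewrite ltW// truncnS_gt.
Qed.

Lemma integrable_gpos a : 0 < a -> leb.-integrable setT (EFin \o gpos a).
Proof.
move=> a0; apply/integrableP; split.
  by apply/measurable_EFinP; exact: measurable_gpos.
under eq_integral => t _ do rewrite /= ger0_norm ?gpos_ge0//.
exact: gpos_fin.
Qed.

Definition gam s t : R[i] := cpow t (s - 1) * (expR (- t))%:C * (hv t)%:C.

Lemma cmeasurable_gam s : cmeasurable (gam s : measurableTypeR R -> R[i]).
Proof.
apply: cmeasurableM; last by apply: cmeasurable_real; exact: measurable_hv.
apply: cmeasurableM; first exact: cmeasurable_cpow.
apply: cmeasurable_real.
by under eq_fun do rewrite -[X in - X]mul1r; exact: measurable_expRNM.
Qed.

Lemma normc_gam s t : normc (gam s t) = gpos (Re s) t.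
Proof.
rewrite /gam Normc.normcM Normc.normcM normc_cpow !normcR (ger0_norm (expR_ge0 _)).
rewrite ger0_norm ?hv_ge0// /gpos; congr (epow _ _ * _ * _).
by case: (s) => ? ? /=.
Qed.

Lemma has_cintegral_gam s : 0 < Re s ->
  has_cintegral leb setT (gam s) (cGamma s).
Proof.
move=> s0.
have gi : cintegrable leb setT (gam s).
  apply/cintegrableP; split; first exact: cmeasurable_gam.
  by under eq_integral do rewrite normc_gam; exact: gpos_fin.
apply/(@has_cintegral_indic _ _ _ leb `]0, +oo[ (fun t => cpow t (s - 1) * (expR (- t))%:C)) => //.
split => //.
have : has_cintegral leb setT (gam s) (cintegral leb setT (gam s)) by [].
by case/(@has_cintegral_indic _ _ _ leb `]0, +oo[ (fun t => cpow t (s - 1) * (expR (- t))%:C)).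
Qed.

Lemma integral_gpos a : 0 < a -> (M a = (Re (cGamma a%:C))%:E)%E.
Proof.
move=> a0; have /has_cintegralE[_ <- _] : has_cintegral leb setT (gam a%:C) (cGamma a%:C).
  exact: has_cintegral_gam.
apply: eq_integral => t _; rewrite /gam -(rmorphB (@real_complex R)) cpow_real.
by rewrite -!(rmorphM (@real_complex R)).
Qed.

Lemma cGammaR a : 0 < a -> cGamma a%:C = (Re (cGamma a%:C))%:C.
Proof.
move=> a0; apply: (@has_cintegral_fun _ _ _ leb (gam a%:C)).
  exact: has_cintegral_gam.
apply: (@has_cintegral_eq _ (measurableTypeR R) R leb (fun t => (gpos a t)%:C)).
  move=> t; rewrite /gam -(rmorphB (@real_complex R)) cpow_real.
  by rewrite -!(rmorphM (@real_complex R)).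
by apply: has_cintegral_real; [exact: integrable_gpos|exact: integral_gpos].
Qed.

(** A nonnegative function with zero integral vanishes almost everywhere, but this integrand is
    positive on a half-line of infinite measure. *)
Lemma cGammaR_gt0 a : 0 < a -> 0 < Re (cGamma a%:C).
Proof.
move=> a0; rewrite lt_def -lee_fin -integral_gpos// integral_ge0 ?andbT; last first.
  by move=> t _; rewrite lee_fin gpos_ge0.
apply/eqP => G0.
have mg : measurable_fun setT (EFin \o gpos a).
  by apply/measurable_EFinP; exact: measurable_gpos.
have := iffLR (ae_eq_integral_abs leb measurableT mg).
under eq_integral => t _ do rewrite /= ger0_norm ?gpos_ge0//.
rewrite integral_gpos// G0 => /(_ erefl)[N [mN N0 sub]].
have : (leb `]0%R, +oo[ <= leb N)%E.
  apply: le_measure; rewrite ?inE// => t /=.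
  rewrite in_itv/= andbT => t0; apply: sub => /= /(_ I)[].
  apply/eqP; rewrite gt_eqF// /gpos hvE t0 mulr1.
  exact: mulr_gt0 (epow_gt0 _ _) (expR_gt0 _).
by rewrite N0 lebesgue_measure_itv/= ltry sube0 leNgt ltry.
Qed.

Lemma gam_dilation s c t : 0 < c -> cpow c (1 - s) * gam s (c * t) =
  cpow t (s - 1) * (expR (- (c * t)))%:C * (hv t)%:C.
Proof.
move=> c0; rewrite /gam hvM// hvE; case: ltP => [t0|_]; last by rewrite !mulr0.
have : cpow c (1 - s) * cpow c (s - 1) = 1.
  by rewrite -cpowD (_ : 1 - s + (s - 1) = 0) ?cpowx0//; ring.
rewrite (cpowM _ c0 t0).
move: (cpow c (1 - s)) (cpow c (s - 1)) (cpow t (s - 1)) => x y z xy.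
by rewrite !mulrA xy mul1r.
Qed.

Lemma cGamma_dilation s c : 0 < c -> 0 < Re s ->
  has_cintegral leb setT
    (fun t => cpow t (s - 1) * (expR (- (c * t)))%:C * (hv t)%:C)
    (cpow c (- s) * cGamma s).
Proof.
move=> c0 s0.
have w0 (t : measurableTypeR R) : 0 <= 1 :> R by [].
have w0' (t : measurableTypeR R) : 0 <= c^-1 :> R by rewrite invr_ge0 ltW.
have mc : measurable_fun setT (fun t : measurableTypeR R => (c * t) : measurableTypeR R).
  exact: measurable_funM.
have tr (g : measurableTypeR R -> \bar R) : measurable_fun setT g ->
    (forall t, (0 <= g t)%E) ->
    (\int[leb]_t (g (c * t)%R * (1%R : R)%:E) = \int[leb]_t (g t * (c^-1)%:E))%E.
  move=> mg g0; under eq_integral do rewrite mule1.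
  by rewrite lebesgue_dilation// ge0_integralZr// ?lee_fin ?invr_ge0 ?ltW// muleC.
have H := has_cintegral_transfer mc (measurable_cst (1 : R)) (measurable_cst (c^-1 : R)) w0 w0' tr
  _ (cmeasurable_gam s).
have h1 : has_cintegral leb setT (fun t => gam s t * (c^-1)%:C) ((c^-1)%:C * cGamma s).
  apply: (@has_cintegral_eq _ (measurableTypeR R) R leb (fun t => (c^-1)%:C * gam s t)).
    by move=> t; rewrite mulrC.
  exact: has_cintegralZ (has_cintegral_gam s0).
move/H: h1 => /(has_cintegralZ (cpow c (1 - s))).
have -> : cpow c (1 - s) * ((c^-1)%:C * cGamma s) = cpow c (- s) * cGamma s.
  rewrite mulrA cpowD; congr (_ * _).
  rewrite (_ : 1 = 1%:C)// cpow_real epowx1// mulrAC -(rmorphM (@real_complex R)).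
  by rewrite divff ?mul1r// gt_eqF.
apply: has_cintegral_eq => t; rewrite (_ : (cst 1 t)%:C = 1)// mulr1.
exact: gam_dilation.
Qed.

Lemma normc_gpos_dilation s c : 0 < c -> 0 < Re s ->
  (\int[leb]_t
     (normc (cpow t (s - 1) * (expR (- (c * t)))%:C * (hv t)%:C))%:E =
   (epow c (- Re s) * Re (cGamma (Re s)%:C))%:E)%E.
Proof.
move=> c0 s0; rewrite EFinM -integral_gpos// -gpos_dilation//.
apply: eq_integral => t _.
rewrite Normc.normcM Normc.normcM normc_cpow !normcR (ger0_norm (expR_ge0 _)).
rewrite (ger0_norm (hv_ge0 _)).
by rewrite (_ : Re (s - 1) = Re s - 1)//; case: (s).
Qed.

(* Fubini for t^s e^(-ct) with c in [1, 2], both inner integrals being explicit. *)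
Lemma cGammaS s : 0 < Re s -> cGamma (s + 1) = s * cGamma s.
Proof.
move=> s0.
have Re1 : Re (s + 1) = Re s + 1 by case: (s).
have s10 : 0 < Re (s + 1) by rewrite Re1 addr_gt0.
pose b c : R := \1_(`[1%R, 2%R]%classic) c.
have mb : measurable_fun setT (b : measurableTypeR R -> R).
  by apply: measurable_indic; exact: measurable_itv.
have bE c : b c = (1 <= c <= 2)%R%:R by rewrite /b indicE mem_setE in_itv.
pose F (z : measurableTypeR R * measurableTypeR R) : R[i] :=
  cpow z.2 (s + 1 - 1) * (expR (- (z.1 * z.2)))%:C * (hv z.2)%:C * (b z.1)%:C.
have mF : cmeasurable F.
  apply: cmeasurableM; last by apply: cmeasurable_real; exact: measurableT_comp.
  apply: cmeasurableM; last first.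
    by apply: cmeasurable_real; apply: measurableT_comp => //; exact: measurable_hv.
  apply: cmeasurableM; first exact: cmeasurable_cpow.
  apply: cmeasurable_real; apply: measurableT_comp => //; apply: measurable_funN.
  exact: measurable_funM.
pose G c := cpow c (- (s + 1)) * cGamma (s + 1) * (b c)%:C.
have FG c : has_cintegral leb setT (fun t => F (c, t)) (G c).
  rewrite /F /G /= bE; case: (boolP (1 <= c <= 2)) => [/andP[c1 _]|_] /=; last first.
    rewrite mulr0; apply: (@has_cintegral_eq _ (measurableTypeR R) _ _ (fun=> 0%:C)).
      by move=> t; rewrite mulr0.
    by apply: has_cintegral_real; [exact: integrable0|rewrite integral0].
  rewrite mulr1; have c0 := lt_le_trans ltr01 c1.
  apply: (@has_cintegral_eq _ (measurableTypeR R) _ _ _ _ _ _ (cGamma_dilation c0 s10)).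
  by move=> t; rewrite mulr1.
have iF : cintegrable (leb \x leb)%E setT F.
  apply: (@cintegrable_prod _ _ (measurableTypeR R) (measurableTypeR R) R leb leb F
    (fun c => epow c (- Re (s + 1)) * Re (cGamma (Re (s + 1))%:C) * b c) mF).
    apply: aeW => c.
    have FE t : F (c, t) = cpow t (s + 1 - 1) * (expR (- (c * t)))%:C *
      (hv t)%:C * (b c)%:C by [].
    case: (boolP (1 <= c <= 2)) => hc; have bc := bE c; rewrite ?hc ?(negbTE hc) in bc.
      rewrite bc mulr1 -normc_gpos_dilation//; last first.
        by case/andP: hc => c1 _; exact: lt_le_trans c1.
      by apply: eq_integral => t _; rewrite FE bc mulr1.
    rewrite bc mulr0 integral0_eq// => t _.
    by rewrite FE bc mulr0 (normcR 0) normr0.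
  have cK K (c : R) : 0 < c ->
      {for c, continuous (fun x : R => epow x (- Re (s + 1)) * K)}.
    move=> c0; apply: continuousM; last exact: cvg_cst.
    exact: (derive_continuous (is_derive_epow _ c0)).
  have ci K : leb.-integrable `[1%R, 2%R] (fun c => (epow c (- Re (s + 1)) * K)%:E).
    apply: continuous_compact_integrable; first exact: segment_compact.
    apply: continuous_in_subspaceT => c /set_mem/=; rewrite in_itv/= => /andP[c1 _].
    by apply: cK; exact: lt_le_trans c1.
  have := iffLR (@integrable_mkcond _ (measurableTypeR R) R leb `[1%R, 2%R] _
    (measurable_itv _)) (ci (Re (cGamma (Re (s + 1))%:C))).
  apply: eq_integrable => // c _; rewrite /patch /= /b indicE.
  by case: (_ \in _); rewrite ?mulr1 ?mulr0.
have mG : cmeasurable (G : measurableTypeR R -> R[i]).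
  apply: cmeasurableM; last exact: cmeasurable_real.
  by apply: cmeasurableM; [exact: cmeasurable_cpow|exact: cmeasurable_cst].
(* The integral of [F] over c in [1, 2]: t^s times (e^(-t) - e^(-2t)) / t. *)
pose H t := gam s t - cpow t (s - 1) * (expR (- (2 * t)))%:C * (hv t)%:C.
have hH : has_cintegral leb setT H (cGamma s - cpow 2 (- s) * cGamma s).
  by apply: has_cintegralB; [exact: has_cintegral_gam|exact: cGamma_dilation].
have mH : cmeasurable (H : measurableTypeR R -> R[i]).
  by case: hH => /cintegrableP[].
have FH t : has_cintegral leb setT (fun c => F (c, t)) (H t).
  rewrite /F /H /gam /= hvE; case: ltP => [t0|_] /=; last first.
    rewrite !mulr0 subr0; apply: (@has_cintegral_eq _ (measurableTypeR R) _ _ (fun=> 0%:C)).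
      by move=> c; rewrite mulr0 mul0r.
    by apply: has_cintegral_real; [exact: integrable0|rewrite integral0].
  have e12 : (\int[leb]_c (expR (- (c * t)) * b c)%:E =
              (t^-1 * (expR (- t) - expR (- (2 * t))))%:E)%E.
    by rewrite -integral_indicE integral_expRNM_12.
  have i12 : leb.-integrable setT (EFin \o (fun c => expR (- (c * t)) * b c)).
    apply/integrableP; split.
      apply/measurable_EFinP; apply: measurable_funM => //.
      by under eq_fun do rewrite mulrC; exact: measurable_expRNM.
    under eq_integral => c _.
      rewrite /= ger0_norm; last by rewrite mulr_ge0 ?expR_ge0// bE ler0n.
      over.
    by rewrite e12 ltry.
  have := has_cintegralZ (cpow t s) (has_cintegral_real i12 e12).
  have -> : cpow t s * (t^-1 * (expR (- t) - expR (- (2 * t))))%:C =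
    cpow t (s - 1) * (expR (- t))%:C * 1%:C -
    cpow t (s - 1) * (expR (- (2 * t)))%:C * 1%:C.
    rewrite cpowD cpowN (_ : 1 = 1%:C)// cpow_real epowx1//.
    rewrite !(rmorphM (@real_complex R)) (rmorphB (@real_complex R)) fmorphV/=.
    by ring.
  apply: has_cintegral_eq => c; rewrite (_ : 1%:C = 1)// mulr1 addrK.
  by rewrite (rmorphM (@real_complex R)) mulrA.
have v1 : has_cintegral (leb \x leb)%E setT F (cGamma s - cpow 2 (- s) * cGamma s).
  by apply/(has_cintegral_fubini2 _ mH iF) => //; apply: aeW.
have v2 : has_cintegral leb setT G (cGamma s - cpow 2 (- s) * cGamma s).
  by apply/(has_cintegral_fubini1 _ mG iF) => //; apply: aeW.
(* The integral over t leaves Gamma(s + 1) c^(-s-1) on [1, 2], and s c^(-s-1) integrates to 1 -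
   2^(-s). *)
have v3 : has_cintegral leb setT (fun c => s * G c)
    (cGamma (s + 1) * (1 - cpow 2 (- s))).
  have /(@has_cintegral_indic _ _ _ leb _ _ _ (measurable_itv _)) := has_cintegral_cpow_12 s.
  move=> /(has_cintegralZ (cGamma (s + 1))); apply: has_cintegral_eq => c.
  by rewrite /G opprD -/(b c); ring.
have := has_cintegral_fun v3 (has_cintegralZ s v2).
have -> : s * (cGamma s - cpow 2 (- s) * cGamma s) =
  (1 - cpow 2 (- s)) * (s * cGamma s) by ring.
rewrite mulrC.
(* |2^(-s)| = 2^(-Re s) < 1, so the factor 1 - 2^(-s) can be cancelled. *)
have nz : 1 - cpow 2 (- s) != 0.
  apply/eqP => /(congr1 (fun z => z + cpow 2 (- s))); rewrite subrK add0r.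
  move=> /(congr1 (@normc R)); rewrite (_ : 1 = 1%:C)// normcR normr1 normc_cpow.
  apply/eqP; rewrite gt_eqF// -[X in _ < X](expR0 R) ltr_expR.
  rewrite (_ : Re (- s) = - Re s); last by case: (s).
  have l2 : 0 < ln 2 :> R by rewrite ln_gt0// ltr1n.
  by rewrite mulNr oppr_lt0 mulr_gt0.
by move=> /(mulfI nz).
Qed.

(** A zero propagates along the functional equation, which reduces nonvanishing to large real
    part. *)
Lemma cGammaDn s n : 0 < Re s -> cGamma s = 0 -> cGamma (s + n%:R) = 0.
Proof.
move=> s0 G0; elim: n => [|n IH]; first by rewrite addr0.
rewrite -natr1 addrA cGammaS ?IH ?mulr0//.
by rewrite -(rmorph_nat (@real_complex R)); case: (s) s0 => a b /= a0; rewrite ltr_wpDr.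
Qed.

Lemma derive_ge0_le (f f' : R -> R) (x : R) :
  (forall y : R, is_derive y 1 f (f' y)) -> (forall y, 0 <= y -> 0 <= f' y) ->
  0 <= x -> f 0 <= f x.
Proof.
move=> df f'0 x0; apply: (@ger0_derive1_le_cc _ f 0 x) => //.
- move=> y; rewrite in_itv/= => /andP[y0 _].
  by rewrite derive1E; have d := df y; rewrite derive_val f'0// ltW.
- by apply: continuous_subspaceT => y; exact: derive_continuous (df y).
- by rewrite in_itv/= lexx.
- by rewrite in_itv/= x0 lexx.
Qed.

Lemma sin_le_id (x : R) : 0 <= x -> sin x <= x.
Proof.
move=> x0; rewrite -subr_ge0 -[leLHS](_ : 0 - sin 0 = 0); last by rewrite sin0 subr0.
apply: (@derive_ge0_le (fun z : R => z - sin z) (fun y => 1 - cos y)) => //.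
Qed.

Lemma cos_ge (x : R) : 1 - x ^+ 2 / 2 <= cos x.
Proof.
wlog x0 : x / 0 <= x.
  move=> H; have [/H//|x0] := leP 0 x.
  by rewrite -cosN -sqrrN H// oppr_ge0 ltW.
rewrite -subr_ge0.
have -> : cos x - (1 - x ^+ 2 / 2) = cos x + 2^-1 * (x * x) - 1 by rewrite expr2; ring.
rewrite subr_ge0 -[leLHS](_ : cos 0 + 2^-1 * (0 * 0) = 1); last first.
  by rewrite cos0; ring.
apply: (@derive_ge0_le (fun z : R => cos z + 2^-1 * (z * z)) (fun y => y - sin y)) => //.
  move=> y.
  have d2 : is_derive y 1 (fun z : R => z * z) (y + y).
    refine (eq_ind _ (is_derive y 1 _) (is_deriveM (is_derive_id _ _) (is_derive_id _ _)) _ _).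
    by rewrite /GRing.scale/= !mulr1.
  have d3 := is_deriveZ 2^-1 d2.
  refine (eq_ind _ (is_derive y 1 _) (is_deriveD (is_derive_cos y) d3) _ _).
  by rewrite /GRing.scale/=; field.
by move=> y y0; rewrite subr_ge0 sin_le_id.
Qed.

(** With u = v / 2 the right-hand side is 4 (e^u - e^(-u))^2, and for u >= 0 the bounds e^u >= 1 + u
    and e^(-u) <= 1 give e^u - e^(-u) >= u. For v = ln t - ln x this trades the square of a
    logarithm for t / x and x / t. *)
Lemma sqr_le_cosh (v : R) : v ^+ 2 <= 4 * (expR v - 2 + expR (- v)).
Proof.
wlog v0 : v / 0 <= v.
  move=> H; have [/H//|v0] := leP 0 v.
  have := H (- v); rewrite oppr_ge0 ltW// sqrrN opprK => /(_ isT) h.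
  by rewrite (le_trans h)// ler_pM2l//; lra.
have -> : expR v - 2 + expR (- v) = (expR (v / 2) - expR (- (v / 2))) ^+ 2.
  rewrite sqrrB -!expRM_natl -mulr_natr -expRD addrN expR0 mul1r.
  by congr (expR _ - _ + expR _); field.
have h1 : v / 2 <= expR (v / 2) - expR (- (v / 2)).
  have a := expR_ge1Dx (v / 2).
  have b : expR (- (v / 2)) <= 1 by rewrite -(expR0 R) ler_expR oppr_le0 divr_ge0.
  by lra.
have v20 : 0 <= v / 2 by rewrite divr_ge0.
by have := lerXn2r 2 v20 (le_trans v20 h1) h1; nra.
Qed.

Lemma RcGammaS a : 0 < a -> Re (cGamma (a + 1)%:C) = a * Re (cGamma a%:C).
Proof.
move=> a0; have : cGamma (a%:C + 1) = a%:C * cGamma a%:C by exact: cGammaS.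
rewrite -(rmorph1 (@real_complex R)) -(rmorphD (@real_complex R)) => /(congr1 (@complex.Re R)) ->.
by rewrite ReMc /= mul0r subr0.
Qed.

(* If Gamma(x + iy) = 0, multiplying Euler's integral by x^(-iy) gives a vanishing
   integral of cos(y (ln t - ln x)) t^(x-1) e^(-t); but cos v >= 1 - v^2 / 2 and
   (ln u)^2 <= 4 (u - 2 + 1/u) bound it below by a positive multiple of
   Gamma(x - 1). *)
Lemma cGamma_large_neq0 s : 1 + 2 * Im s ^+ 2 < Re s -> cGamma s != 0.
Proof.
set x := Re s; set y := Im s => hx.
have x1 : 1 < x by rewrite (le_lt_trans _ hx)// lerDl mulr_ge0 ?sqr_ge0.
have x0 : 0 < x by exact: lt_trans x1.
have x10 : 0 < x - 1 by rewrite subr_gt0.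
pose w : R[i] := Complex 0 (- y).
apply/eqP => G0.
have := has_cintegralZ (cpow x w) (has_cintegral_gam x0).
rewrite G0 mulr0 => /has_cintegralE[[iR _] + _].
have -> : Re (0 : R[i]) = 0 by [].
pose gR t := gpos x t * cos (y * (ln t - ln x)).
have gRE t : Re (cpow x w * gam s t) = gR t.
  have -> : cpow x w * gam s t = (cpow x w * cpow t (s - 1)) * (expR (- t) * hv t)%:C.
    rewrite /gam; move: (cpow x w) (cpow t (s - 1)) => p q.
    by rewrite (rmorphM (@real_complex R)); ring.
  rewrite ReMc [Im _%:C]/= mulr0 subr0 ReMc !Re_cpow !Im_cpow.
  have -> : Im (s - 1) = y by rewrite /y; case: (s) => ? ? /=; rewrite subr0.
  have -> : Re (s - 1) = x - 1 by rewrite /x; case: (s).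
  have -> : Re w = 0 by [].
  have -> : Im w = - y by [].
  have -> : Re (expR (- t) * hv t)%:C = expR (- t) * hv t by [].
  by rewrite epowx0 /gR /gpos mulrBr cosB !mulNr cosN sinN; ring.
under eq_integral do rewrite gRE.
move=> iG.
have igR : leb.-integrable setT (EFin \o gR).
  by move: iR; apply: eq_integrable => // t _; rewrite gRE.
have ig a : 0 < a -> leb.-integrable setT (EFin \o gpos a) by exact: integrable_gpos.
(* Coefficients of 1, -t and -1/t in the lower bound 1 - 2 y^2 (t / x - 2 + x / t) for the cosine.
   The term 1/t lowers the Gamma parameter to x - 1, which has to be positive. *)
pose k1 := 1 + 4 * y ^+ 2; pose k2 := 2 * y ^+ 2 / x; pose k3 := 2 * y ^+ 2 * x.
have x10' : 0 < x + 1 by rewrite addr_gt0.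
have i1 := integrableZl measurableT k1 (ig _ x0).
have i2 := integrableZl measurableT k2 (ig _ x10').
have i3 := integrableZl measurableT k3 (ig _ x10).
have i12 := integrableB measurableT i1 i2.
have : (\int[leb]_t (k1%:E * (gpos x t)%:E - k2%:E * (gpos (x + 1) t)%:E -
    k3%:E * (gpos (x - 1) t)%:E) <= \int[leb]_t (gR t)%:E)%E.
  apply: le_integral => //; first exact: integrableB.
  move=> t _ /=; rewrite lee_fin /gR /gpos hvE; case: ltP => [t0|_]; last first.
    by rewrite !mulr0 !subr0 mul0r.
  have -> : epow t (x + 1 - 1) = epow t (x - 1) * t.
    by rewrite -{3}(epowx1 t0) -epowD; congr epow; ring.
  have -> : epow t (x - 1 - 1) = epow t (x - 1) * t^-1 by rewrite epowD epowN epowx1.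
  have P0 : 0 <= epow t (x - 1) * expR (- t) by exact: mulr_ge0 (epow_ge0 _ _) (expR_ge0 _).
  have c1 := cos_ge (y * (ln t - ln x)).
  have c2 := sqr_le_cosh (ln t - ln x).
  rewrite opprB !expRD !expRN !lnK ?posrE// in c2.
  have c3 : 1 - 2 * y ^+ 2 * (t * x^-1 - 2 + x * t^-1) <= cos (y * (ln t - ln x)).
    apply: le_trans c1; rewrite lerD2l lerN2 exprMn.
    have := ler_wpM2l (sqr_ge0 y) c2; lra.
  rewrite (_ : (true%:R : R) = 1)// !mulr1.
  have := ler_wpM2l P0 c3; rewrite /k1 /k2 /k3; apply: le_trans.
  by rewrite le_eqVlt; apply/orP; left; apply/eqP; ring.
rewrite iG integralB// integralB// !integralZl; try exact: ig; try by [].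
rewrite !integral_gpos// -!EFinM -!EFinB lee_fin RcGammaS//.
(* In terms of Gamma(x - 1) the three moments add up to (x - 1 - 2 y^2) Gamma(x - 1), positive by
   hypothesis: this is the origin of the region 1 + 2 y^2 < x. *)
have e : Re (cGamma x%:C) = (x - 1) * Re (cGamma (x - 1)%:C).
  by rewrite -RcGammaS// subrK.
rewrite e; have g0 := cGammaR_gt0 x10.
set g := Re _ in g0 *.
have -> : k1 * ((x - 1) * g) - k2 * (x * ((x - 1) * g)) - k3 * g =
    g * (x - 1 - 2 * y ^+ 2).
  by rewrite /k1 /k2 /k3; field; rewrite gt_eqF.
rewrite leNgt mulr_gt0// subr_gt0; lra.
Qed.

Lemma cGamma_neq0 s : 0 < Re s -> cGamma s != 0.
Proof.
move=> s0; apply/eqP => G0.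
(* Adding an integer leaves the imaginary part unchanged, so this many steps reach the region where
   zeros are excluded. *)
pose n := (Num.truncn (1 + 2 * Im s ^+ 2)).+1.
suff : cGamma (s + n%:R) != 0 by rewrite cGammaDn ?eqxx.
apply: cGamma_large_neq0; rewrite -(rmorph_nat (@real_complex R)).
case: (s) s0 @n => a b /= a0; rewrite addr0.
by rewrite (lt_trans (truncnS_gt _))// ltrDr.
Qed.

End GammaFunction.

(** * Linear algebra over the scalars *)

Definition rpart (R : realType) (K : scalars) : scalar R K -> R :=
  match K return scalar R K -> R with
  | Reals => id
  | Complexes => @complex.Re R
  | Quaternions => @q1 R
  end.

(** The real basis 1, i, j, k (or its beginning), orthonormal for the form [rpart (x * conj y)]. *)
Definition ebasis (R : realType) (K : scalars) (i : 'I_(real_dim K)) : scalar R K :=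
  scalar_of_coords [tuple ((j == i)%:R : R) | j < real_dim K].

Section Scalars.
Variables (R : realType) (K : scalars).
Local Notation S := (scalar R K).
Local Notation beta := (real_dim K).
Local Notation conj := (@sconj R K).
Local Notation re := (@sreal R K).
Local Notation rpart := (@rpart R K).
Local Notation ebasis := (@ebasis R K).
Implicit Types (x y z : S) (a b : R).

Lemma sconjK x : conj (conj x) = x.
Proof.
by case: K x => [|[? ?]|[? ? ? ?]] //=; rewrite /conjq/= ?opprK.
Qed.

Lemma sconjD x y : conj (x + y) = conj x + conj y.
Proof.
case: K x y => [|[? ?] [? ?]|[? ? ? ?] [? ? ? ?]] //=.
  by apply/eqP; rewrite eq_complex/= opprD !eqxx.
by congr Quaternion; rewrite /= opprD.
Qed.

Lemma sconjM x y : conj (x * y) = conj y * conj x.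
Proof.
case: K x y => [x y|[? ?] [? ?]|[? ? ? ?] [? ? ? ?]] /=.
- exact: mulrC.
- by apply/eqP; rewrite eq_complex/=; apply/andP; split; apply/eqP; ring.
- by congr Quaternion => /=; ring.
Qed.

Lemma sconjR a : conj (re a) = re a.
Proof. by case: K => //=; rewrite /conjq/= ?oppr0. Qed.

Lemma srealD a b : re (a + b) = re a + re b.
Proof.
case: K => //=.
  by rewrite (rmorphD (@real_complex R)).
by congr Quaternion; rewrite /= addr0.
Qed.

Lemma srealM a b : re (a * b) = re a * re b.
Proof.
case: K => //=.
  by rewrite (rmorphM (@real_complex R)).
by congr Quaternion => /=; ring.
Qed.

Lemma sreal1 : re 1 = 1. Proof. by case: K. Qed.

Lemma sreal0 : re 0 = 0. Proof. by case: K. Qed.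

Lemma srealC a x : re a * x = x * re a.
Proof.
case: K x => [x|[? ?]|[? ? ? ?]] /=.
- exact: mulrC.
- by apply/eqP; rewrite eq_complex/=; apply/andP; split; apply/eqP; ring.
- by congr Quaternion => /=; ring.
Qed.

Lemma rpartD x y : rpart (x + y) = rpart x + rpart y.
Proof. by case: K x y => [|[? ?] [? ?]|[? ? ? ?] [? ? ? ?]]. Qed.

Lemma rpart0 : rpart 0 = 0. Proof. by case: K. Qed.

Lemma rpart_sum (I : Type) (s : seq I) (P : pred I) (F : I -> S) :
  rpart (\sum_(i <- s | P i) F i) = \sum_(i <- s | P i) rpart (F i).
Proof. exact: (big_morph rpart rpartD rpart0). Qed.

Lemma rpartR a : rpart (re a) = a. Proof. by case: K. Qed.

Lemma rpartZ a x : rpart (re a * x) = a * rpart x.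
Proof. by case: K x => [|[? ?]|[? ? ? ?]] //=; ring. Qed.

(** The real part is a trace; over the quaternions this replaces commutativity. *)
Lemma rpartC x y : rpart (x * y) = rpart (y * x).
Proof. by case: K x y => [x y|[? ?] [? ?]|[? ? ? ?] [? ? ? ?]] /=; ring. Qed.

Lemma rpart_conj x : rpart (conj x) = rpart x.
Proof. by case: K x => [|[? ?]|[? ? ? ?]]. Qed.

(** The squared modulus. *)
Definition nrm x : R := rpart (x * conj x).

Lemma mul_conj x : x * conj x = re (nrm x).
Proof.
rewrite /nrm ; case: K x => [x|[? ?]|[? ? ? ?]] //=.
- by apply/eqP; rewrite eq_complex/=; apply/andP; split; apply/eqP; ring.
- by congr Quaternion => /=; ring.
Qed.

Lemma conj_mul x : conj x * x = re (nrm x).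
Proof.
rewrite /nrm ; case: K x => [x|[? ?]|[? ? ? ?]] //=.
- by apply/eqP; rewrite eq_complex/=; apply/andP; split; apply/eqP; ring.
- by congr Quaternion => /=; ring.
Qed.

Lemma nrmE (t : beta.-tuple R) :
  nrm (scalar_of_coords t) = \sum_(i < beta) tnth t i ^+ 2.
Proof.
rewrite /nrm; by case: K t => t /=; rewrite !big_ord_recl big_ord0 !(tnth_nth 0) /=; ring.
Qed.

Lemma rpart_basis (i j : 'I_beta) : rpart (ebasis i * conj (ebasis j)) = (i == j)%:R.
Proof.
pose f (i k : 'I_beta) : R := (k == i)%:R.
have fE (k : 'I_beta) : nth 0 [tuple ((j == i)%:R : R) | j < beta] k = f i k.
  by rewrite -tnth_nth tnth_mktuple.
have gE (k : 'I_beta) : nth 0 [tuple ((l == j)%:R : R) | l < beta] k = f j k.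
  by rewrite -tnth_nth tnth_mktuple.
have -> : (i == j)%:R = \sum_(k < beta) f i k * f j k.
  rewrite (bigD1 i)//= big1 ?addr0 /f ?eqxx ?mul1r// => k /negbTE ->.
  by rewrite mul0r.
rewrite /ebasis; move: fE gE; case: K i j @f => i j f fE gE /=;
  rewrite !big_ord_recl big_ord0.
- by rewrite (fE ord0) (gE ord0) addr0.
- by rewrite (fE ord0) (gE ord0) (fE (lift ord0 ord0)) (gE (lift ord0 ord0)); ring.
- rewrite (fE ord0) (gE ord0) (fE (lift ord0 ord0)) (gE (lift ord0 ord0)).
  rewrite (fE (lift ord0 (lift ord0 ord0))) (gE (lift ord0 (lift ord0 ord0))).
  rewrite (fE (lift ord0 (lift ord0 (lift ord0 ord0)))).
  rewrite (gE (lift ord0 (lift ord0 (lift ord0 ord0)))).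
  by ring.
Qed.

(** Expansion in the orthonormal basis. The order of the factors is kept, so that the basis can be
    inserted between two noncommuting entries. *)
Lemma parseval x y :
  \sum_(i < beta) rpart (x * conj (ebasis i)) * rpart (ebasis i * y) = rpart (x * y).
Proof.
have E (i k : 'I_beta) :
    nth 0 [tuple ((j == i)%:R : R) | j < beta] k = (k == i)%:R.
  by rewrite -tnth_nth tnth_mktuple.
rewrite /ebasis; case: K x y E => [x y|[? ?] [? ?]|[? ? ? ?] [? ? ? ?]] E /=.
- under eq_bigr => i _ do rewrite (E i ord0).
  by rewrite !big_ord_recl big_ord0 /=; ring.
- under eq_bigr => i _ do rewrite (E i ord0) (E i (lift ord0 ord0)).
  by rewrite !big_ord_recl big_ord0 /=; ring.
- under eq_bigr => i _ do rewrite (E i ord0) (E i (lift ord0 ord0))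
    (E i (lift ord0 (lift ord0 ord0))) (E i (lift ord0 (lift ord0 (lift ord0 ord0)))).
  by rewrite !big_ord_recl big_ord0 /=; ring.
Qed.

(* Right multiplication by A on row vectors, in real coordinates. *)
Definition rho p q (A : 'M[S]_(p, q)) :
    'M[R]_(#|{: 'I_p * 'I_beta}|, #|{: 'I_q * 'I_beta}|) :=
  \matrix_(k, l) rpart (ebasis (enum_val k).2 * A (enum_val k).1 (enum_val l).1 *
                        conj (ebasis (enum_val l).2)).

(** [parseval] contracts the basis index between the entries of [A] and those of [B]. *)
Lemma rhoM p q r (A : 'M[S]_(p, q)) (B : 'M[S]_(q, r)) :
  rho (A *m B) = rho A *m rho B.
Proof.
apply/matrixP => k l; rewrite !mxE.
rewrite mulr_sumr mulr_suml rpart_sum.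
under [RHS]eq_bigr do rewrite !mxE.
rewrite -(big_enum_val (fun z : 'I_q * 'I_beta =>
  rpart (ebasis (enum_val k).2 * A (enum_val k).1 z.1 * conj (ebasis z.2)) *
  rpart (ebasis z.2 * B z.1 (enum_val l).1 * conj (ebasis (enum_val l).2)))) /=.
rewrite -(pair_bigA _ (fun i j =>
  rpart (ebasis (enum_val k).2 * A (enum_val k).1 i * conj (ebasis j)) *
  rpart (ebasis j * B i (enum_val l).1 * conj (ebasis (enum_val l).2)))) /=.
apply: eq_bigr => i _.
under eq_bigr do rewrite -[X in _ * rpart X]mulrA.
by rewrite parseval !mulrA.
Qed.

Lemma rho_ctr p q (A : 'M[S]_(p, q)) : rho (ctrmx A) = (rho A)^T.
Proof.
apply/matrixP => k l; rewrite !mxE -rpart_conj !sconjM !sconjK.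
by rewrite mulrA.
Qed.

Lemma rho_diag p (d : 'rV[R]_p) :
  rho (diag_mx (map_mx re d)) = diag_mx (\row_k d ord0 (enum_val k).1).
Proof.
apply/matrixP => k l; rewrite !mxE.
case: (eqVneq (enum_val k).1 (enum_val l).1) => [e|e]; last first.
  rewrite mulr0n mulr0 mul0r rpart0; case: (eqVneq k l) => [kl|//].
  by rewrite kl eqxx in e.
rewrite mulr1n -srealC -mulrA rpartZ rpart_basis.
rewrite mulr_natr; congr (_ *+ nat_of_bool _).
apply/eqP/eqP => [e2|->//]; apply: enum_val_inj.
by case: (enum_val k) (enum_val l) e e2 => ? ? [? ?] /= -> ->.
Qed.

Lemma rho1 p : rho (1%:M : 'M[S]_p) = 1%:M.
Proof.
have -> : 1%:M = diag_mx (map_mx re (const_mx 1 : 'rV[R]_p)).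
  by apply/matrixP => i j; rewrite !mxE sreal1.
by rewrite rho_diag; apply/matrixP => k l; rewrite !mxE.
Qed.

Lemma rhoD p q (A B : 'M[S]_(p, q)) : rho (A + B) = rho A + rho B.
Proof. by apply/matrixP => k l; rewrite !mxE mulrDr mulrDl rpartD. Qed.

Lemma det_rho_diag p (d : 'rV[R]_p) :
  \det (rho (diag_mx (map_mx re d))) = (\prod_(i < p) d ord0 i) ^+ beta.
Proof.
rewrite rho_diag det_diag.
under eq_bigr do rewrite mxE.
rewrite -(big_enum_val (fun z : 'I_p * 'I_beta => d ord0 z.1)) /=.
rewrite -(pair_bigA _ (fun i _ => d ord0 i)) /= -prodrXl; apply: eq_bigr => i _.
by rewrite prodr_const card_ord.
Qed.

Lemma ctrmxK p q (A : 'M[S]_(p, q)) : ctrmx (ctrmx A) = A.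
Proof. by apply/matrixP => i j; rewrite !mxE sconjK. Qed.

Lemma ctrmxM p q r (A : 'M[S]_(p, q)) (B : 'M[S]_(q, r)) :
  ctrmx (A *m B) = ctrmx B *m ctrmx A.
Proof.
apply/matrixP => i j; rewrite !mxE.
have conj0 : conj 0 = 0 by rewrite -sreal0 sconjR.
rewrite (big_morph conj sconjD conj0); apply: eq_bigr => k _.
by rewrite !mxE sconjM.
Qed.

Lemma ctrmxD p q (A B : 'M[S]_(p, q)) : ctrmx (A + B) = ctrmx A + ctrmx B.
Proof. by apply/matrixP => i j; rewrite !mxE sconjD. Qed.

Lemma sconj0 : conj 0 = 0. Proof. by rewrite -sreal0 sconjR. Qed.

Lemma sconj1 : conj 1 = 1. Proof. by rewrite -sreal1 sconjR. Qed.

Lemma ctrmx1 p : ctrmx (1%:M : 'M[S]_p) = 1%:M.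
Proof.
apply/matrixP => i j; rewrite !mxE eq_sym.
by case: eqP => _; rewrite ?sconj1 ?sconj0.
Qed.

Lemma ctrmx_diag p (d : 'rV[R]_p) :
  ctrmx (diag_mx (map_mx re d)) = diag_mx (map_mx re d).
Proof.
apply/matrixP => i j; rewrite !mxE eq_sym.
by case: eqP => [->|_]; rewrite ?mulr1n ?mulr0n ?sconjR ?sconj0.
Qed.

End Scalars.

(** * The spectral theorem *)

(** A complex eigenvector x + iy with eigenvalue z exists by algebraic closedness. Evaluating x M
    y^T in the two ways allowed by symmetry gives Im z (|x|^2 + |y|^2) = 0, so z is real and
    whichever of x, y is nonzero is a real eigenvector. *)
Lemma symmetric_eigenvector (R : realType) N (M : 'M[R]_N) : (0 < N)%N ->
  M^T = M -> exists (a : R) (v : 'rV[R]_N), v != 0 /\ v *m M = a *: v.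
Proof.
move=> N0 MT; pose MC := map_mx (@real_complex R) M.
have /closed_rootP[z] : size (char_poly MC) != 1%N.
  by rewrite size_char_poly eqSS -lt0n.
rewrite -eigenvalue_root_char => /eigenvalueP[v vM v0].
pose x := map_mx (@complex.Re R) v; pose y := map_mx (@complex.Im R) v.
have Rsum (I : Type) (s : seq I) (F : I -> R[i]) :
    Re (\sum_(i <- s) F i) = \sum_(i <- s) Re (F i).
  by apply: (big_morph _ _ (erefl : Re 0 = 0)) => -[? ?] [].
have Isum (I : Type) (s : seq I) (F : I -> R[i]) :
    Im (\sum_(i <- s) F i) = \sum_(i <- s) Im (F i).
  by apply: (big_morph _ _ (erefl : Im 0 = 0)) => -[? ?] [].
have RM (u w : R[i]) : Re (u * w) = Re u * Re w - Im u * Im w by case: u w => ? ? [].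
have IM (u w : R[i]) : Im (u * w) = Re u * Im w + Im u * Re w by case: u w => ? ? [].
have xM : x *m M = Re z *: x - Im z *: y.
  apply/rowP => j; have := congr1 (fun w : 'rV[R[i]]_N => Re (w ord0 j)) vM.
  rewrite !mxE Rsum RM => <-; apply: eq_bigr => i _.
  by rewrite !mxE RM /= mulr0 subr0.
have yM : y *m M = Im z *: x + Re z *: y.
  apply/rowP => j; have := congr1 (fun w : 'rV[R[i]]_N => Im (w ord0 j)) vM.
  rewrite !mxE Isum IM addrC => <-; apply: eq_bigr => i _.
  by rewrite !mxE IM /= mulr0 add0r.
have sym : x *m M *m y^T = y *m M *m x^T.
  rewrite -[LHS]trmxK; have -> : (x *m M *m y^T)^T = y *m M *m x^T.
    by rewrite !trmx_mul trmxK MT mulmxA.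
  by apply/matrixP => i j; rewrite mxE !ord1.
have yx : x *m y^T = y *m x^T.
  rewrite -[LHS]trmxK trmx_mul trmxK.
  by apply/matrixP => i j; rewrite mxE !ord1.
have ss (w : 'rV[R]_N) : (w *m w^T) ord0 ord0 = \sum_i w ord0 i ^+ 2.
  by rewrite mxE; apply: eq_bigr => i _; rewrite mxE expr2.
have ss0 (w : 'rV[R]_N) : \sum_i w ord0 i ^+ 2 = 0 -> w = 0.
  move=> /eqP; rewrite psumr_eq0; last by move=> i _; exact: sqr_ge0.
  move=> /allP h; apply/rowP => i; rewrite mxE; apply/eqP.
  by have := h i (mem_index_enum _); rewrite sqrf_eq0.
have b0 : Im z = 0.
  have entD (B C : 'M[R]_1) : (B + C) ord0 ord0 = B ord0 ord0 + C ord0 ord0.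
    by rewrite mxE.
  have entN (B : 'M[R]_1) : (- B) ord0 ord0 = - B ord0 ord0 by rewrite mxE.
  have entZ c (B : 'M[R]_1) : (c *: B) ord0 ord0 = c * B ord0 ord0 by rewrite mxE.
  have := congr1 (fun w : 'M[R]_1 => w ord0 ord0) sym.
  rewrite /= xM yM mulmxBl mulmxDl -!scalemxAl -yx.
  rewrite entD entN !entZ entD !entZ !ss.
  set sx := \sum_i x _ _ ^+ 2; set sy := \sum_i y _ _ ^+ 2 => e.
  have sx0 : 0 <= sx by rewrite sumr_ge0// => i _; rewrite sqr_ge0.
  have sy0 : 0 <= sy by rewrite sumr_ge0// => i _; rewrite sqr_ge0.
  have : Im z * (sx + sy) = 0 by rewrite mulrDr; lra.
  move=> /eqP; rewrite mulf_eq0 => /orP[/eqP//|].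
  rewrite paddr_eq0// => /andP[/eqP/ss0 x0 /eqP/ss0 y0].
  case/eqP: v0; apply/rowP => i; rewrite mxE.
  have := congr1 (fun w : 'rV[R]_N => w ord0 i) x0.
  have := congr1 (fun w : 'rV[R]_N => w ord0 i) y0.
  by rewrite !mxE; case: (v ord0 i) => ? ? /= -> ->.
have [x0|x0] := eqVneq x 0; last first.
  by exists (Re z), x; rewrite x0 xM b0 scale0r subr0.
exists (Re z), y; rewrite yM b0 scale0r add0r; split=> //.
apply: contra v0 => /eqP y0; apply/eqP/rowP => i; rewrite mxE.
have := congr1 (fun w : 'rV[R]_N => w ord0 i) x0.
have := congr1 (fun w : 'rV[R]_N => w ord0 i) y0.
by rewrite !mxE; case: (v ord0 i) => ? ? /= -> ->.
Qed.

Section Spectral.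
Variables (R : realType) (K : scalars).
Local Notation S := (scalar R K).
Local Notation beta := (real_dim K).
Local Notation conj := (@sconj R K).
Local Notation re := (@sreal R K).
Local Notation rpart := (@rpart R K).
Local Notation ebasis := (@ebasis R K).
Implicit Types (x y z : S) (a : R).

Lemma nrm_ge0 x : 0 <= nrm x.
Proof.
rewrite /nrm -parseval sumr_ge0// => i _.
by rewrite -[rpart (_ i * _)]rpart_conj sconjM sconjK -expr2 sqr_ge0.
Qed.

Lemma nrm_eq0 x : nrm x = 0 -> x = 0.
Proof.
rewrite /nrm; case: K x => [x|[? ?]|[? ? ? ?]] /=.
- by move=> /eqP; rewrite mulf_eq0 orbb => /eqP.
- by move=> h; apply/eqP; rewrite eq_complex/=; apply/andP; split; apply/eqP; nra.
- by move=> h; congr Quaternion; nra.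
Qed.

Lemma nrmR a : nrm (re a) = a ^+ 2.
Proof. by rewrite /nrm sconjR rpartZ rpartR expr2. Qed.

Lemma nrmM x y : nrm (x * y) = nrm x * nrm y.
Proof.
rewrite /nrm sconjM mulrA -[x * y * _]mulrA mul_conj -mulrA [re _ * _]srealC.
by rewrite mulrA mul_conj -srealM !rpartR.
Qed.

Lemma rpart_ebasis_inj x y :
  (forall b, rpart (x * conj (ebasis b)) = rpart (y * conj (ebasis b))) -> x = y.
Proof.
move=> xy; apply/eqP; rewrite -subr_eq0; apply/eqP/nrm_eq0.
rewrite /nrm -parseval big1// => b _.
have rN z : rpart (- z) = - rpart z.
  by apply/eqP; rewrite -subr_eq0 opprK -rpartD addNr rpart0.
by rewrite mulrBl rpartD rN xy subrr mul0r.
Qed.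

Lemma row_gramE p (x : 'rV[S]_p) : x *m ctrmx x = (re (\sum_i nrm (x ord0 i)))%:M.
Proof.
apply/matrixP => i j; rewrite !ord1 !mxE eqxx mulr1n.
rewrite (big_morph re (@srealD R K) (sreal0 R K)); apply: eq_bigr => k _.
by rewrite !mxE mul_conj.
Qed.

(** [rho A] is symmetric and has a real eigenvector; its coordinates, regrouped into scalars, form a
    left eigenvector of [A]. The eigenvalue is real, hence central, so the vector can be
    normalised. *)
Lemma hermitian_eigenvector p (A : 'M[S]_p.+1) : ctrmx A = A ->
  exists (a : R) (x : 'rV[S]_p.+1),
    x *m ctrmx x = 1%:M /\ x *m A = re a *: x.
Proof.
move=> Ah.
have N0 : (0 < #|{: 'I_p.+1 * 'I_beta}|)%N.
  by rewrite card_prod !card_ord; case: K.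
have [|a [v [v0 vA]]] := symmetric_eigenvector N0 (M := rho A).
  by rewrite -rho_ctr Ah.
pose x : 'rV[S]_p.+1 := \row_j \sum_b re (v ord0 (enum_rank (j, b))) * ebasis b.
have xE j b : rpart (x ord0 j * conj (ebasis b)) = v ord0 (enum_rank (j, b)).
  rewrite mxE mulr_suml rpart_sum (bigD1 b)//= big1 ?addr0.
    by rewrite -mulrA rpartZ rpart_basis eqxx mulr1.
  by move=> c cb; rewrite -mulrA rpartZ rpart_basis (negbTE cb) mulr0.
have x0 : x != 0.
  apply: contra v0 => /eqP x0; apply/eqP/rowP => k; rewrite mxE.
  rewrite -[k]enum_valK; case: (enum_val k) => j b.
  by rewrite -xE x0 mxE mul0r rpart0.
have xA : x *m A = re a *: x.
  apply/rowP => j; apply: rpart_ebasis_inj => b.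
  rewrite [X in _ = rpart (X * _)]mxE -mulrA rpartZ xE.
  have := congr1 (fun w : 'rV[R]_(_) => w ord0 (enum_rank (j, b))) vA.
  rewrite [X in _ = X -> _]mxE => <-.
  rewrite mxE mulr_suml rpart_sum mxE.
  under [RHS]eq_bigr => k _ do rewrite !mxE enum_rankK /= -{1}[k]enum_valK.
  rewrite -(big_enum_val (fun z : 'I_p.+1 * 'I_beta => v ord0 (enum_rank z) *
    rpart (ebasis z.2 * A z.1 j * conj (ebasis b)))) /=.
  rewrite (eq_bigr (fun z : 'I_p.+1 * 'I_beta => v ord0 (enum_rank (z.1, z.2)) *
    rpart (ebasis z.2 * A z.1 j * conj (ebasis b)))); last by case.
  rewrite -(pair_bigA _ (fun i c => v ord0 (enum_rank (i, c)) *
    rpart (ebasis c * A i j * conj (ebasis b)))) /=.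
  apply: eq_bigr => i _; rewrite mxE !mulr_suml rpart_sum.
  by apply: eq_bigr => c _; rewrite -!mulrA rpartZ !mulrA.
pose s := \sum_i nrm (x ord0 i).
have s0 : 0 < s.
  rewrite lt_def sumr_ge0 ?andbT; last by move=> i _; exact: nrm_ge0.
  apply: contra x0; rewrite psumr_eq0; last by move=> i _; exact: nrm_ge0.
  move=> /allP h; apply/eqP/rowP => i; rewrite [RHS]mxE; apply: nrm_eq0; apply/eqP.
  exact: h (mem_index_enum _).
exists a, (re (Num.sqrt s)^-1 *: x); split.
  rewrite row_gramE; congr (_%:M); rewrite -(sreal1 R K); congr re.
  under eq_bigr do rewrite mxE nrmM nrmR.
  rewrite -mulr_sumr -/s exprVn sqr_sqrtr ?ltW// mulVf// gt_eqF//.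
by rewrite -scalemxAl xA !scalerA srealC.
Qed.

Lemma srealN a : re (- a) = - re a.
Proof. by apply/eqP; rewrite -subr_eq0 opprK -srealD addNr sreal0. Qed.

Lemma mulmxZR p q r a (A : 'M[S]_(p, q)) (B : 'M[S]_(q, r)) :
  A *m (re a *: B) = re a *: (A *m B).
Proof.
apply/matrixP => i j; rewrite !mxE mulr_sumr; apply: eq_bigr => k _.
by rewrite !mxE !mulrA srealC.
Qed.

Lemma ctrmxE p q (A : 'M[S]_(p, q)) i j : ctrmx A i j = conj (A j i).
Proof. by rewrite !mxE. Qed.

(** The reflection in w = x - q e0, where q is the phase of the first entry of x. The phase makes
    the inner product of x with q e0 real, as a reflection exchanging the two requires; e0 is then
    mapped to conj(q) x. *)
Lemma householder p (x : 'rV[S]_p.+1) : x *m ctrmx x = 1%:M ->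
  exists (H : 'M[S]_p.+1) (c : S),
    [/\ ctrmx H = H, H *m H = 1%:M & delta_mx ord0 ord0 *m H = c *: x :> 'rV_p.+1].
Proof.
move=> xx; pose x0 := x ord0 ord0; pose r := Num.sqrt (nrm x0).
have [q [qq x0q]] : exists q : S, nrm q = 1 /\ x0 = re r * q.
  have [z|nz] := eqVneq x0 0.
    exists 1; rewrite -(sreal1 R K) nrmR expr1n; split=> //.
    by rewrite /r z -(sreal0 R K) nrmR expr0n sqrtr0 sreal0 mul0r.
  have n0 : nrm x0 != 0 by apply: contra nz => /eqP/nrm_eq0 ->.
  have n1 : 0 < nrm x0 by rewrite lt_def n0 nrm_ge0.
  exists (re r^-1 * x0); rewrite nrmM nrmR exprVn sqr_sqrtr ?ltW// mulVf//.
  split=> //; rewrite mulrA -srealM divff ?sreal1 ?mul1r//.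
  by rewrite gt_eqF// sqrtr_gt0.
pose e0 : 'rV[S]_p.+1 := delta_mx ord0 ord0.
pose w := x - q *: e0.
pose W := \sum_i nrm (w ord0 i).
have r0 : 0 <= r by exact: sqrtr_ge0.
have sxx : \sum_i nrm (x ord0 i) = 1.
  have := congr1 (fun M : 'M[S]_1 => rpart (M ord0 ord0)) xx.
  by rewrite row_gramE !mxE eqxx !mulr1n rpartR -(sreal1 R K) rpartR.
have r2 : r ^+ 2 = nrm x0 by rewrite sqr_sqrtr// nrm_ge0.
have conj_w0 : conj (w ord0 ord0) = re (r - 1) * conj q.
  rewrite !mxE !eqxx /= mulr1 -/x0 x0q -[X in _ - X]mul1r -mulrBl.
  by rewrite -(sreal1 R K) -srealN -srealD sconjM sconjR srealC.
have w00 : w ord0 ord0 = re (r - 1) * q.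
  by rewrite -[LHS]sconjK conj_w0 sconjM sconjK sconjR srealC.
have wj j : j != ord0 -> w ord0 j = x ord0 j.
  by move=> /negbTE j0; rewrite !mxE j0 andbF mulr0 subr0.
have WE : W = 2 - 2 * r.
  rewrite /W (bigD1 ord0)//= w00 nrmM qq mulr1 nrmR.
  under eq_bigr => j j0 do rewrite wj//.
  have := sxx; rewrite (bigD1 ord0)//= -/x0 -r2 => e; nra.
(* If x = q e0 then W = 0, the quotient is 0 by convention and the reflection becomes the identity,
   as it should. *)
pose k := 2 / W.
pose H : 'M[S]_p.+1 := 1%:M - re k *: (ctrmx w *m w).
have kWk : k * W * k = 2 * k.
  rewrite /k; have [->|W0] := eqVneq W 0; first by rewrite invr0 !mulr0.
  by field.
have conjZ (a : R) p' q' (A : 'M[S]_(p', q')) : ctrmx (re a *: A) = re a *: ctrmx A.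
  by apply/matrixP => i j; rewrite !mxE sconjM sconjR srealC.
have conjN p' q' (A : 'M[S]_(p', q')) : ctrmx (- A) = - ctrmx A.
  apply/matrixP => i j; rewrite !mxE.
  by apply/eqP; rewrite -subr_eq0 opprK -sconjD addNr sconj0.
exists H, (conj q); split.
- by rewrite /H ctrmxD ctrmx1 conjN conjZ ctrmxM ctrmxK.
- have Hww : (ctrmx w *m w) *m (ctrmx w *m w) = re W *: (ctrmx w *m w).
    by rewrite -mulmxA (mulmxA w) row_gramE mul_scalar_mx mulmxZR.
  move: Hww; rewrite /H; move: (ctrmx w *m w) => P Hww.
  rewrite mulmxBl mul1mx mulmxBr mulmx1 -!scalemxAl mulmxZR Hww !scalerA.
  rewrite -!srealM mulrA mulrAC kWk mulr_natl mulr2n srealD scalerDl.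
  by rewrite opprB addrK subrK.
- apply/rowP => j; rewrite -rowE [LHS]mxE [RHS]mxE.
  have : (ctrmx w *m w) ord0 j = re (r - 1) * conj q * w ord0 j.
    by rewrite mxE big_ord1 ctrmxE conj_w0.
  rewrite /H; move: (ctrmx w *m w) => P Pj; rewrite !mxE Pj.
  have qcq : conj q * q = 1 by rewrite conj_mul qq sreal1.
  have xj : x ord0 j = w ord0 j + q * (j == ord0)%:R.
    by rewrite !mxE eqxx /= subrK.
  rewrite xj; have [r1|r1] := eqVneq r 1.
    have W0 : W = 0 by rewrite WE r1; lra.
    have -> : w ord0 j = 0.
      apply: nrm_eq0; apply/eqP; move: W0 => /eqP.
      rewrite /W psumr_eq0; last by move=> i _; exact: nrm_ge0.
      by move=> /allP /(_ j (mem_index_enum _)).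
    by rewrite !mulr0 subr0 add0r mulrA qcq mul1r eq_sym.
  have kr : k * (r - 1) = -1.
    have r1' : 1 - r != 0 by rewrite subr_eq0 eq_sym.
    by rewrite /k WE (_ : 2 - 2 * r = 2 * (1 - r)); [field|ring].
  rewrite !mulrA -srealM kr srealN sreal1 mulN1r mulNr opprK mulrDr mulrA qcq.
  by rewrite mul1r addrC eq_sym.
Qed.

Lemma ctrmx_block p1 p2 q1 q2 (A : 'M[S]_(p1, q1)) (B : 'M[S]_(p1, q2))
    (C : 'M[S]_(p2, q1)) (D : 'M[S]_(p2, q2)) :
  ctrmx (block_mx A B C D) = block_mx (ctrmx A) (ctrmx C) (ctrmx B) (ctrmx D).
Proof. by rewrite /ctrmx map_block_mx tr_block_mx. Qed.

Lemma ctrmx0 p q : ctrmx (0 : 'M[S]_(p, q)) = 0.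
Proof. by apply/matrixP => i j; rewrite !mxE sconj0. Qed.

Lemma unitary_block p q (U : 'M[S]_p) (V : 'M[S]_q) :
  is_unitary U -> is_unitary V -> is_unitary (block_mx U 0 0 V).
Proof.
move=> [U1 U2] [V1 V2]; split; rewrite ctrmx_block !ctrmx0 mulmx_block;
  by rewrite !(mul0mx, mulmx0, addr0, add0r) ?U1 ?U2 ?V1 ?V2 -scalar_mx_block.
Qed.

Lemma unitary_mul p (U V : 'M[S]_p) :
  is_unitary U -> is_unitary V -> is_unitary (U *m V).
Proof.
move=> [U1 U2] [V1 V2]; split; rewrite ctrmxM.
- by rewrite mulmxA -(mulmxA U) V1 mulmx1.
- by rewrite mulmxA -(mulmxA _ (ctrmx U)) U2 mulmx1.
Qed.

Lemma unitary1 p : is_unitary (1%:M : 'M[S]_p).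
Proof. by split; rewrite ctrmx1 mulmx1. Qed.

Lemma hermitian_eigenvalues_block p q (A : 'M[S]_p) (B : 'M[S]_q) la mu :
  hermitian_eigenvalues A la -> hermitian_eigenvalues B mu ->
  hermitian_eigenvalues (block_mx A 0 0 B) (row_mx la mu).
Proof.
move=> [U uU ->] [V uV ->]; exists (block_mx U 0 0 V); first exact: unitary_block.
rewrite map_row_mx diag_mx_row ctrmx_block !ctrmx0 !mulmx_block.
by rewrite !(mul0mx, mulmx0, addr0, add0r).
Qed.

Lemma hermitian_eigenvalues_conj p (U A : 'M[S]_p) la : is_unitary U ->
  hermitian_eigenvalues A la -> hermitian_eigenvalues (U *m A *m ctrmx U) la.
Proof.
move=> uU [V uV ->]; exists (U *m V); first exact: unitary_mul.
by rewrite ctrmxM !mulmxA.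
Qed.

(** Deflation: conjugation by the Householder matrix that sends the first basis vector to a multiple
    of an eigenvector splits off a 1 x 1 block. *)
Theorem spectral_theorem p (A : 'M[S]_p) : ctrmx A = A ->
  exists la, hermitian_eigenvalues A la.
Proof.
elim: p A => [|p IH] A Ah.
  by exists 0, 1%:M; [exact: unitary1|apply/matrixP => -[]].
have [a [x [xx xA]]] := hermitian_eigenvector Ah.
have [H [c [Hh HH e0H]]] := householder xx.
have uH : is_unitary H by split; rewrite Hh.
pose B := H *m A *m H.
have Bh : ctrmx B = B by rewrite /B !ctrmxM Ah Hh mulmxA.
(* The scalar [c] need not commute with the entries, but the real eigenvalue can be moved past
   it. *)
have B0 : delta_mx ord0 ord0 *m B = re a *: delta_mx ord0 ord0 :> 'rV[S]_p.+1.
  rewrite /B !mulmxA e0H -!scalemxAl xA -scalemxAl.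
  by rewrite scalerA -srealC -scalerA scalemxAl -e0H -mulmxA HH mulmx1.
have B0j j : B ord0 j = re a * (j == ord0)%:R.
  have := congr1 (fun M : 'rV[S]_p.+1 => M ord0 j) B0.
  by rewrite -rowE !mxE eqxx.
have Bj0 j : B j ord0 = re a * (j == ord0)%:R.
  rewrite -{1}Bh ctrmxE B0j sconjM sconjR.
  by case: eqP => _; rewrite ?sconj1 ?sconj0 ?mulr1 ?mul1r ?mulr0 ?mul0r.
pose B' : 'M[S]_p := @drsubmx _ 1 p 1 p B.
have BE : B = @block_mx _ 1 p 1 p (diag_mx (map_mx re (const_mx a))) 0 0 B'.
  have l0 : lshift p ord0 = ord0 :> 'I_(1 + p) by apply: val_inj.
  have e1 : @ulsubmx _ 1 p 1 p B = diag_mx (map_mx re (const_mx a)).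
    apply/matrixP => i j; rewrite !ord1 [LHS]mxE [LHS]mxE l0 B0j !mxE eqxx.
    by rewrite mulr1n mulr1.
  have e2 : @ursubmx _ 1 p 1 p B = 0.
    apply/matrixP => i j; rewrite !ord1 [LHS]mxE [LHS]mxE l0 B0j !mxE.
    by rewrite mulr0.
  have e3 : @dlsubmx _ 1 p 1 p B = 0.
    apply/matrixP => i j; rewrite !ord1 [LHS]mxE [LHS]mxE l0 Bj0 !mxE.
    by rewrite mulr0.
  by rewrite -[LHS](@submxK _ 1 p 1 p) e1 e2 e3.
have [la hla] : exists la, hermitian_eigenvalues B' la.
  have B'E i j : B' i j = B (rshift 1 i) (rshift 1 j) by rewrite [LHS]mxE [LHS]mxE.
  by apply: IH; apply/matrixP => i j; rewrite ctrmxE !B'E -{2}Bh ctrmxE.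
exists (row_mx (const_mx a : 'rV_1) la).
have -> : A = H *m B *m ctrmx H.
  by rewrite Hh /B !mulmxA HH mul1mx -mulmxA HH mulmx1.
apply: hermitian_eigenvalues_conj => //; rewrite BE.
apply: (@hermitian_eigenvalues_block 1 p _ _ _ _ _ hla).
by exists 1%:M; [exact: unitary1|rewrite ctrmx1 mul1mx mulmx1].
Qed.

Lemma det_rho_eigenvalues p (A : 'M[S]_p) la : hermitian_eigenvalues A la ->
  \det (rho A) = (\prod_(i < p) la ord0 i) ^+ beta.
Proof.
move=> [U [U1 _] ->].
have dU : \det (rho U) * \det (rho (ctrmx U)) = 1.
  by rewrite -det_mulmx -rhoM U1 rho1 det1.
by rewrite !rhoM !det_mulmx det_rho_diag mulrAC dU mul1r.
Qed.

(** The eigenvalues are the diagonal entries of Y Y^* with Y = U^* X, which are sums of squared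
    moduli. *)
Lemma eigenvalues_gram_ge0 p q (X : 'M[S]_(p, q)) la :
  hermitian_eigenvalues (X *m ctrmx X) la -> forall i, 0 <= la ord0 i.
Proof.
move=> [U [U1 U2] XE] i.
have : (ctrmx U *m X) *m ctrmx (ctrmx U *m X) = diag_mx (map_mx re la).
  rewrite ctrmxM ctrmxK mulmxA -(mulmxA _ X) XE !mulmxA U2 mul1mx.
  by rewrite -mulmxA U2 mulmx1.
move=> /(congr1 (fun M : 'M[S]_p => rpart (M i i))).
rewrite !mxE eqxx mulr1n rpartR => <-.
rewrite rpart_sum sumr_ge0// => k _.
set Y := ctrmx U *m X.
by rewrite ctrmxE; exact: (nrm_ge0 (Y i k)).
Qed.

Lemma ctrmx_gram p q (X : 'M[S]_(p, q)) : ctrmx (X *m ctrmx X) = X *m ctrmx X.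
Proof. by rewrite ctrmxM ctrmxK. Qed.

Lemma real_dim_gt0 : (0 < beta)%N. Proof. by case: K. Qed.

(** [hdet] picks some diagonalization. The products of any two have the same power [beta], namely
    [\det (rho _)], and for a Gram matrix they are nonnegative, so they agree. The default value is
    excluded because [la] exists. *)
Lemma hdet_gram_eigenvalues p q (X : 'M[S]_(p, q)) la :
  hermitian_eigenvalues (X *m ctrmx X) la ->
  hdet (X *m ctrmx X) = \prod_(i < p) la ord0 i.
Proof.
move=> hla; rewrite /hdet; case: xgetP => [d -> [mu hmu ->]|/(_ (\prod_i la ord0 i))].
  have := det_rho_eigenvalues hmu; rewrite (det_rho_eigenvalues hla) => /esym/eqP.
  rewrite eqrXn2 ?real_dim_gt0// ?prodr_ge0//; first by move/eqP.
  - by move=> i _; exact: eigenvalues_gram_ge0 hmu i.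
  - by move=> i _; exact: eigenvalues_gram_ge0 hla i.
by case; exists la.
Qed.

Lemma hdet_gram p q (X : 'M[S]_(p, q)) :
  0 <= hdet (X *m ctrmx X) /\
  hdet (X *m ctrmx X) ^+ beta = \det (rho (X *m ctrmx X)).
Proof.
have [la hla] := spectral_theorem (ctrmx_gram X).
rewrite (hdet_gram_eigenvalues hla) (det_rho_eigenvalues hla); split=> //.
by apply: prodr_ge0 => i _; exact: eigenvalues_gram_ge0 hla i.
Qed.

(** Identities between determinants of Gram matrices are proved through the multiplicative
    [\det (rho _)], the nonnegative root being taken at the end. *)
Lemma hdet_unique p q (X : 'M[S]_(p, q)) r : 0 <= r ->
  r ^+ beta = \det (rho (X *m ctrmx X)) -> hdet (X *m ctrmx X) = r.
Proof.
have [h0 <-] := hdet_gram X => r0 /eqP.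
by rewrite eqrXn2 ?real_dim_gt0// => /eqP.
Qed.

End Spectral.

(** * Determinants of Gram matrices *)

Section GramStep.
Variables (R : realType) (K : scalars).
Local Notation S := (scalar R K).
Local Notation beta := (real_dim K).
Local Notation re := (@sreal R K).
Local Notation rpart := (@rpart R K).

(** The two-sided inverse is read off the diagonalization, an argument that also works over the
    quaternions. *)
Lemma unit_eigenvalues p (U : 'M[S]_p) (la : 'rV[R]_p) : is_unitary U ->
  (forall i, la ord0 i != 0) ->
  let A := U *m diag_mx (map_mx re la) *m ctrmx U in
  exists A' : 'M[S]_p, [/\ A *m A' = 1%:M, A' *m A = 1%:M & ctrmx A' = A'].
Proof.
move=> [U1 U2] la0 A; pose mu : 'rV[R]_p := \row_i (la ord0 i)^-1.
have dd (a b : 'rV[R]_p) : (forall i, a ord0 i * b ord0 i = 1) ->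
    diag_mx (map_mx re a) *m diag_mx (map_mx re b) = 1%:M.
  move=> ab; rewrite mulmx_diag; apply/matrixP => i j; rewrite !mxE.
  by rewrite -srealM ab sreal1.
exists (U *m diag_mx (map_mx re mu) *m ctrmx U); split.
- rewrite /A !mulmxA -(mulmxA _ (ctrmx U)) U2 mulmx1 -(mulmxA U) dd ?mulmx1//.
  by move=> i; rewrite mxE mulfV.
- rewrite /A !mulmxA -(mulmxA _ (ctrmx U)) U2 mulmx1 -(mulmxA U) dd ?mulmx1//.
  by move=> i; rewrite mxE mulVf.
- by rewrite !ctrmxM ctrmxK ctrmx_diag mulmxA.
Qed.

(* The matrices [L c] form a one-parameter group in which [L 2] is conjugate to
   [L 1]; hence det (L 1) is a nonzero idempotent. *)
Lemma det_rho_unitriangular p (b : 'M[S]_(1, p)) :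
  \det (rho (block_mx (1%:M : 'M[S]_p) 0 b (1%:M : 'M[S]_1))) = 1.
Proof.
pose L (c : R) := block_mx (1%:M : 'M[S]_p) 0 (re c *: b) (1%:M : 'M[S]_1).
have LM c d : L c *m L d = L (c + d).
  rewrite mulmx_block !(mul0mx, mulmx0, mul1mx, mulmx1, addr0, add0r).
  by rewrite /L srealD scalerDl.
pose D (c : R) := block_mx (1%:M : 'M[S]_p) 0 0 ((re c)%:M : 'M[S]_1).
have DLD : D 2 *m L 1 *m D 2^-1 = L 2.
  rewrite !mulmx_block !(mul0mx, mulmx0, mul1mx, mulmx1, addr0, add0r).
  rewrite mul_scalar_mx scalerA -srealM mulr1 -scalar_mxM -srealM divff ?sreal1//.
have DD : \det (rho (D 2)) * \det (rho (D 2^-1)) = 1.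
  rewrite -det_mulmx -rhoM mulmx_block.
  rewrite !(mul0mx, mulmx0, mul1mx, mulmx1, addr0, add0r) -scalar_mxM -srealM.
  by rewrite divff ?pnatr_eq0// sreal1 -scalar_mx_block rho1 det1.
have L0 : L 0 = 1%:M by rewrite /L sreal0 scale0r -scalar_mx_block.
have e2 : \det (rho (L 2)) = \det (rho (L 1)).
  by rewrite -DLD !rhoM !det_mulmx mulrAC DD mul1r.
have e3 : \det (rho (L 1)) * \det (rho (L 1)) = \det (rho (L 1)).
  by rewrite -det_mulmx -rhoM LM -[RHS]e2; congr (\det (rho (L _))); ring.
have d0 : \det (rho (L 1)) != 0.
  apply/eqP => d0; have : \det (rho (L 1)) * \det (rho (L (-1))) = 1.
    by rewrite -det_mulmx -rhoM LM subrr L0 rho1 det1.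
  by rewrite d0 mul0r => /eqP; rewrite eq_sym oner_eq0.
have -> : b = re 1 *: b by rewrite sreal1 scale1r.
by apply: (mulfI d0); rewrite mulr1 e3.
Qed.

(** The factorization L diag(A, s) L^* with L unitriangular; the Schur complement is a real 1 x 1
    block and contributes [s ^+ beta]. *)
Lemma det_rho_schur p (A A' : 'M[S]_p) la (b : 'M[S]_(p, 1)) (c : 'M[S]_1) (s : R) :
  hermitian_eigenvalues A la -> A *m A' = 1%:M -> A' *m A = 1%:M ->
  ctrmx A' = A' -> c - ctrmx b *m A' *m b = (re s)%:M ->
  \det (rho (block_mx A b (ctrmx b) c)) = \det (rho A) * s ^+ beta.
Proof.
move=> hA AA' A'A A'h cs.
pose L := block_mx (1%:M : 'M[S]_p) 0 (ctrmx b *m A') (1%:M : 'M[S]_1).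
have -> : block_mx A b (ctrmx b) c = L *m block_mx A 0 0 (re s)%:M *m ctrmx L.
  rewrite ctrmx_block !ctrmx1 ctrmx0 ctrmxM ctrmxK A'h !mulmx_block.
  rewrite !(mul0mx, mulmx0, mul1mx, mulmx1, addr0, add0r).
  by rewrite -(mulmxA _ A' A) A'A mulmx1 mulmxA AA' mul1mx mulmxA -cs addrC subrK.
have hs : hermitian_eigenvalues ((re s)%:M : 'M[S]_1) (const_mx s).
  exists 1%:M; first exact: unitary1.
  rewrite ctrmx1 mul1mx mulmx1; apply/matrixP => i j.
  by rewrite !ord1 !mxE eqxx.
rewrite !rhoM !det_mulmx rho_ctr det_tr det_rho_unitriangular mul1r mulr1.
rewrite (det_rho_eigenvalues (hermitian_eigenvalues_block hA hs)).
rewrite big_split_ord /= big_ord1 row_mxEr mxE exprMn.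
under eq_bigr do rewrite row_mxEl.
by rewrite (det_rho_eigenvalues hA).
Qed.

Lemma gram_col_mx p m (X : 'M[S]_(p, m)) (t : 'rV[S]_m) :
  col_mx X t *m ctrmx (col_mx X t) =
  block_mx (X *m ctrmx X) (X *m ctrmx t) (ctrmx (X *m ctrmx t)) (t *m ctrmx t).
Proof.
rewrite /ctrmx map_col_mx tr_col_mx mul_col_row; congr block_mx.
by have := ctrmxM X (ctrmx t); rewrite ctrmxK.
Qed.

(** Exhibits 1 + X X^* as a Gram matrix, so that positivity and uniqueness of [hdet] apply to it
    too. *)
Lemma gram_row_mx1 p m (X : 'M[S]_(p, m)) :
  1%:M + X *m ctrmx X = row_mx 1%:M X *m ctrmx (row_mx 1%:M X).
Proof.
have := ctrmx1 R K p; rewrite /ctrmx map_row_mx tr_row_mx mul_row_col => ->.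
by rewrite mulmx1.
Qed.

Lemma eigenvalues_add1 p (A : 'M[S]_p) la : hermitian_eigenvalues A la ->
  hermitian_eigenvalues (1%:M + A) (const_mx 1 + la).
Proof.
move=> [U [U1 U2] ->]; exists U; first by split.
have -> : diag_mx (map_mx re (const_mx 1 + la)) = 1%:M + diag_mx (map_mx re la).
  by apply/matrixP => i j; rewrite !mxE srealD sreal1 mulrnDl.
by rewrite mulmxDr mulmx1 mulmxDl U1.
Qed.

Lemma hdet_1gram_eigenvalues p m (X : 'M[S]_(p, m)) la :
  hermitian_eigenvalues (X *m ctrmx X) la ->
  hdet (1%:M + X *m ctrmx X) = \prod_(i < p) (1 + la ord0 i).
Proof.
move=> /eigenvalues_add1; rewrite gram_row_mx1 => /hdet_gram_eigenvalues ->.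
by apply: eq_bigr => i _; rewrite !mxE.
Qed.

Lemma hdet_1gram_gt0 p m (X : 'M[S]_(p, m)) : 0 < hdet (1%:M + X *m ctrmx X).
Proof.
have [la hla] := spectral_theorem (ctrmx_gram X).
rewrite (hdet_1gram_eigenvalues hla) prodr_gt0// => i _.
by rewrite ltr_pwDl// (eigenvalues_gram_ge0 hla).
Qed.

Lemma hdet_1gramC p m (X : 'M[S]_(p, m)) :
  hdet (1%:M + X *m ctrmx X) = hdet (1%:M + ctrmx X *m X).
Proof.
(* Sylvester's identity, by factoring one block matrix in two ways; it is applied to the real
   matrices given by [rho]. *)
have sylv N P (A : 'M[R]_(N, P)) (B : 'M[R]_(P, N)) :
    \det (1%:M + A *m B) = \det (1%:M + B *m A).
  have e1 : block_mx (1%:M : 'M[R]_N) (- A) B (1%:M : 'M[R]_P) =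
      block_mx 1%:M 0 B 1%:M *m block_mx 1%:M (- A) 0 (1%:M + B *m A).
    rewrite mulmx_block !(mul0mx, mulmx0, mul1mx, mulmx1, addr0, add0r).
    by rewrite mulmxN addrCA addNr addr0.
  have e2 : block_mx (1%:M : 'M[R]_N) (- A) B (1%:M : 'M[R]_P) =
      block_mx 1%:M (- A) 0 1%:M *m block_mx (1%:M + A *m B) 0 B 1%:M.
    rewrite mulmx_block !(mul0mx, mulmx0, mul1mx, mulmx1, addr0, add0r).
    by rewrite mulNmx addrK.
  have := congr1 (fun M => \det M) e1; rewrite e2 !det_mulmx.
  by rewrite !det_ublock !det_lblock !det1 !mul1r !mulr1.
have := hdet_1gram_gt0 X; rewrite gram_row_mx1 => /ltW h0.
have eX := gram_row_mx1 (ctrmx X); rewrite ctrmxK in eX.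
rewrite eX; apply/esym; apply: hdet_unique; first exact: h0.
have [_ ->] := hdet_gram (row_mx 1%:M X).
rewrite -eX -gram_row_mx1 !rhoD !rhoM !rho1.
exact: sylv.
Qed.

Lemma hdet_gram_step p m (X : 'M[S]_(p, m)) (t : 'rV[S]_m) (A' : 'M[S]_p) s :
  X *m ctrmx X *m A' = 1%:M -> A' *m (X *m ctrmx X) = 1%:M -> ctrmx A' = A' ->
  t *m (1%:M - ctrmx X *m A' *m X) *m ctrmx t = (re s)%:M -> 0 <= s ->
  hdet (col_mx X t *m ctrmx (col_mx X t)) = hdet (X *m ctrmx X) * s.
Proof.
move=> XA AX Ah ts s0.
have [la hla] := spectral_theorem (ctrmx_gram X).
have [h0 hX] := hdet_gram X.
apply: hdet_unique; first exact: mulr_ge0.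
rewrite gram_col_mx (det_rho_schur hla XA AX Ah (s := s)).
  by rewrite exprMn hX.
rewrite ctrmxM ctrmxK -ts mulmxBr mulmx1 mulmxBl.
by rewrite !mulmxA.
Qed.

Lemma hdet_1gram_step p m (X : 'M[S]_(p, m)) (t : 'rV[S]_m) (A' : 'M[S]_p) s :
  (1%:M + X *m ctrmx X) *m A' = 1%:M -> A' *m (1%:M + X *m ctrmx X) = 1%:M ->
  ctrmx A' = A' ->
  1%:M + t *m (1%:M - ctrmx X *m A' *m X) *m ctrmx t = (re s)%:M -> 0 <= s ->
  hdet (1%:M + col_mx X t *m ctrmx (col_mx X t)) = hdet (1%:M + X *m ctrmx X) * s.
Proof.
move=> XA AX Ah ts s0.
have [la /eigenvalues_add1 hla] := spectral_theorem (ctrmx_gram X).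
have [h0 hX] := hdet_gram (row_mx 1%:M X); rewrite -gram_row_mx1 in h0 hX.
rewrite [in LHS]gram_row_mx1; apply: hdet_unique; first exact: mulr_ge0.
rewrite -gram_row_mx1 gram_col_mx (@scalar_mx_block _ p 1) add_block_mx !add0r.
rewrite (det_rho_schur hla XA AX Ah (s := s)).
  by rewrite exprMn hX.
rewrite ctrmxM ctrmxK -ts mulmxBr mulmx1 mulmxBl -addrA.
by rewrite !mulmxA.
Qed.

(** The real part of the trace, cyclic even over the quaternions; it serves to count null
    eigenvalues. *)
Definition rtrace p (A : 'M[S]_p) : R := \sum_i rpart (A i i).

Lemma rtraceC p q (A : 'M[S]_(p, q)) (B : 'M[S]_(q, p)) :
  rtrace (A *m B) = rtrace (B *m A).
Proof.
rewrite /rtrace; under eq_bigr do rewrite mxE rpart_sum.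
under [RHS]eq_bigr do rewrite mxE rpart_sum.
by rewrite exchange_big; apply: eq_bigr => i _; apply: eq_bigr => j _; rewrite rpartC.
Qed.

(* The change of variables diagonalizes simultaneously
   t (1 - X^* (X X^* )^-1 X) t^* and 1 + t (1 - X^* (1 + X X^* )^-1 X) t^*; the null
   eigenvalues of X^* X span the orthocomplement of the rows of X. *)
Lemma hdet_gram_row_change n m (X : 'M[S]_(n, m)) : hdet (X *m ctrmx X) != 0 ->
  exists (V : 'M[S]_m) (la : 'rV[R]_m),
    [/\ is_unitary V, forall i, 0 <= la ord0 i,
        \prod_i (1 + la ord0 i) = hdet (1%:M + X *m ctrmx X),
        (#|[pred i | la ord0 i == 0%R]| + n = m)%N &
        forall x : 'rV[S]_m,
          let t := x *m diag_mx (map_mx re (\row_i Num.sqrt (1 + la ord0 i))) *m V in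
          hdet (col_mx X t *m ctrmx (col_mx X t)) =
            hdet (X *m ctrmx X) * (\sum_(i | la ord0 i == 0%R) nrm (x ord0 i)) /\
          hdet (1%:M + col_mx X t *m ctrmx (col_mx X t)) =
            hdet (1%:M + X *m ctrmx X) * (1 + \sum_i nrm (x ord0 i))].
Proof.
move=> h0.
have [mu hmu] := spectral_theorem (ctrmx_gram X).
have mu0 i : mu ord0 i != 0.
  apply: contra h0 => /eqP mui; rewrite (hdet_gram_eigenvalues hmu).
  by rewrite (bigD1 i)//= mui mul0r.
have [A' [XA AX Ah]] : exists A' : 'M[S]_n,
    [/\ X *m ctrmx X *m A' = 1%:M, A' *m (X *m ctrmx X) = 1%:M & ctrmx A' = A'].
  by case: (hmu) => U uU ->; exact: unit_eigenvalues.
have [C' [XC CX Ch]] : exists C' : 'M[S]_n,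
    [/\ (1%:M + X *m ctrmx X) *m C' = 1%:M,
        C' *m (1%:M + X *m ctrmx X) = 1%:M & ctrmx C' = C'].
  case: (eigenvalues_add1 hmu) => U uU ->; apply: unit_eigenvalues => // i.
  by rewrite !mxE gt_eqF// ltr_pwDl// (eigenvalues_gram_ge0 hmu).
have Bg : ctrmx X *m ctrmx (ctrmx X) = ctrmx X *m X by rewrite ctrmxK.
have [la hla] := spectral_theorem (ctrmx_gram (ctrmx X)).
have la0 := eigenvalues_gram_ge0 hla.
have dla : hdet (1%:M + X *m ctrmx X) = \prod_i (1 + la ord0 i).
  by rewrite hdet_1gramC -Bg; exact: hdet_1gram_eigenvalues.
rewrite Bg in hla; case: hla => U [U1 U2] BU.
(* [Pm] projects onto the orthocomplement of the rows of [X]; [Qm] inverts 1 + X^* X, see [QB]. *)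
pose Pm : 'M[S]_m := 1%:M - ctrmx X *m A' *m X.
pose Qm : 'M[S]_m := 1%:M - ctrmx X *m C' *m X.
pose Lm := diag_mx (map_mx re la).
have UB : ctrmx U *m (ctrmx X *m X) = Lm *m ctrmx U.
  by rewrite BU !mulmxA U2 mul1mx.
have BU' : (ctrmx X *m X) *m U = U *m Lm.
  by rewrite BU -!mulmxA U2 mulmx1.
have PB : Pm *m (ctrmx X *m X) = 0.
  rewrite mulmxBl mul1mx -!mulmxA (mulmxA X) (mulmxA A') AX mul1mx.
  by rewrite subrr.
pose Y := ctrmx X *m A' *m A' *m X.
have PY : 1%:M - Pm = Y *m (ctrmx X *m X).
  rewrite /Pm opprB addrCA subrr addr0 /Y -!mulmxA (mulmxA X) (mulmxA A' (X *m _)).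
  by rewrite AX mul1mx.
have QB : (1%:M + ctrmx X *m X) *m Qm = 1%:M.
  rewrite mulmxBr mulmx1 mulmxDl mul1mx.
  have -> : ctrmx X *m C' *m X + ctrmx X *m X *m (ctrmx X *m C' *m X) =
      ctrmx X *m ((1%:M + X *m ctrmx X) *m C') *m X.
    by rewrite mulmxDl mul1mx mulmxDr mulmxDl !mulmxA.
  by rewrite XC mulmx1 addrK.
pose W := ctrmx U *m Pm *m U.
have WL : W *m Lm = 0.
  by rewrite /W -mulmxA -BU' mulmxA -(mulmxA _ Pm) PB mulmx0 mul0mx.
have W1 : 1%:M - W = (ctrmx U *m Y *m U) *m Lm.
  have -> : 1%:M - W = ctrmx U *m (1%:M - Pm) *m U.
    by rewrite mulmxBr mulmx1 mulmxBl U2.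
  by rewrite PY -(mulmxA _ U Lm) -BU' !mulmxA.
have mulL (M : 'M[S]_m) i j : (M *m Lm) i j = M i j * re (la ord0 j).
  by rewrite mul_mx_diag !mxE.
(* By [WL] the columns of W at nonzero eigenvalues vanish, and by [W1] those of 1 - W at null
   eigenvalues do; hence W is the diagonal 0-1 matrix marking the null eigenvalues. *)
have WE : W = diag_mx (map_mx re (\row_i (la ord0 i == 0)%:R)).
  apply/matrixP => i j; rewrite [RHS]mxE [X in X *+ _]mxE [X in re X]mxE.
  have [lj|lj] := eqVneq (la ord0 j) 0.
    have := congr1 (fun M : 'M[S]_m => M i j) W1.
    rewrite mulL lj sreal0 mulr0 !mxE => /eqP; rewrite subr_eq0 => /eqP <-.
    by case: (eqVneq i j) => [->|//]; rewrite lj eqxx sreal1.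
  have := congr1 (fun M : 'M[S]_m => M i j) WL.
  rewrite mulL [RHS]mxE => /(congr1 (fun z => z * re (la ord0 j)^-1)).
  rewrite mul0r -mulrA -srealM mulfV// sreal1 mulr1 => ->.
  by case: (eqVneq i j) => [->|//]; rewrite (negbTE lj) sreal0.
have QE : ctrmx U *m Qm *m U = diag_mx (map_mx re (\row_i (1 + la ord0 i)^-1)).
  have : (1%:M + Lm) *m (ctrmx U *m Qm *m U) = 1%:M.
    have UL : (1%:M + Lm) *m ctrmx U = ctrmx U *m (1%:M + ctrmx X *m X).
      by rewrite mulmxDl mul1mx mulmxDr mulmx1 UB.
    rewrite mulmxA (mulmxA (_ + _)) UL -(mulmxA (ctrmx U) (_ + _)) QB mulmx1.
    exact: U2.
  have -> : 1%:M + Lm = diag_mx (map_mx re (const_mx 1 + la)).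
    by apply/matrixP => i j; rewrite !mxE srealD sreal1 mulrnDl.
  move: (ctrmx U *m Qm *m U) => Z.
  rewrite mul_diag_mx => /matrixP QQ; apply/matrixP => i j.
  have := QQ i j; rewrite !mxE => /(congr1 (fun z => re (1 + la ord0 i)^-1 * z)).
  have li : 1 + la ord0 i != 0 by rewrite gt_eqF// ltr_pwDl.
  rewrite mulrA -srealM mulVf// sreal1 mul1r => ->.
  by case: eqP => _; rewrite ?mulr1 ?mulr0.
(* This scaling turns the form diag((1 + la)^-1) into the sum of squared moduli; at null eigenvalues
   it is the identity, so the form of [Pm] is not distorted. *)
pose d : 'rV[R]_m := \row_i Num.sqrt (1 + la ord0 i).
have quad (x : 'rV[S]_m) (e : 'rV[R]_m) :
    x *m diag_mx (map_mx re d) *m diag_mx (map_mx re e) *m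
      ctrmx (x *m diag_mx (map_mx re d)) =
    (re (\sum_i (1 + la ord0 i) * e ord0 i * nrm (x ord0 i)))%:M.
  rewrite ctrmxM ctrmx_diag !mulmxA -(mulmxA x) mulmx_diag -(mulmxA x) mulmx_diag.
  apply/matrixP => i j; rewrite !ord1 !mxE eqxx mulr1n.
  rewrite (big_morph re (@srealD R K) (sreal0 R K)); apply: eq_bigr => k _.
  rewrite mul_mx_diag !mxE srealM -mul_conj -!srealM mulrA -srealC.
  congr (re _ * _ * _).
  rewrite mulrAC -expr2 sqr_sqrtr// addr_ge0//.
exists (ctrmx U), la; split => //.
- by split; rewrite ctrmxK.
(* The real trace of 1 - Pm is n by cyclicity, while after conjugation by U it counts the nonzero
   eigenvalues. *)
- have := rtraceC (ctrmx U *m (1%:M - Pm)) U.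
  rewrite mulmxA U1 mul1mx.
  have -> : ctrmx U *m (1%:M - Pm) *m U = 1%:M - W.
    by rewrite mulmxBr mulmx1 mulmxBl U2.
  have -> : rtrace (1%:M - Pm) = n%:R.
    rewrite /Pm opprB addrCA subrr addr0 -mulmxA rtraceC -mulmxA AX /rtrace.
    under eq_bigr do rewrite mxE eqxx -(sreal1 R K) rpartR.
    by rewrite sumr_const card_ord.
  move=> e; apply/eqP; rewrite -(eqr_nat R) natrD -e /rtrace.
  rewrite -sum1_card natr_sum big_mkcond -big_split /=.
  rewrite -[X in _ == X%:R](card_ord m) -sum1_card natr_sum big_mkcond; apply/eqP.
  apply: eq_bigr => i _; rewrite WE !mxE eqxx !mulr1n inE.
  case: eqP => _; rewrite ?sreal1 ?sreal0 ?subrr ?subr0 ?rpart0 ?addr0 ?add0r//.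
  by rewrite -(sreal1 R K) rpartR.
- move=> x t; split.
  + apply: (hdet_gram_step XA AX Ah); last by apply: sumr_ge0 => i _; exact: nrm_ge0.
    rewrite -/Pm /t ctrmxM ctrmxK !mulmxA.
    rewrite -(mulmxA _ (ctrmx U)) -(mulmxA _ (ctrmx U *m Pm)) -/W WE quad.
    congr ((re _)%:M); rewrite [RHS]big_mkcond; apply: eq_bigr => i _.
    rewrite mxE; case: eqP => [->|_]; by rewrite ?addr0 ?mul1r ?mulr0 ?mul0r.
  + apply: (hdet_1gram_step XC CX Ch); last first.
      by rewrite addr_ge0//; apply: sumr_ge0 => i _; exact: nrm_ge0.
    rewrite -/Qm /t ctrmxM ctrmxK !mulmxA.
    rewrite -(mulmxA _ (ctrmx U)) -(mulmxA _ (ctrmx U *m Qm)) QE quad.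
    rewrite srealD sreal1 raddfD /=; congr (_ + (re _)%:M); apply: eq_bigr => i _.
    rewrite mxE mulfV ?mul1r//.
    by rewrite gt_eqF// ltr_pwDl.
Qed.

End GramStep.

(** * Lebesgue measure on rows *)

Section ScalarMeasurable.
Variables (R : realType) (K : scalars).
Local Notation S := (scalar R K).
Local Notation beta := (real_dim K).
Local Notation conj := (@sconj R K).
Local Notation rpart := (@rpart R K).
Local Notation ebasis := (@ebasis R K).
Context d (X : measurableType d).
Implicit Types f g : X -> S.

(** Working in real coordinates spares a sigma-algebra on the scalars. *)
Definition smeasurable f := forall b : 'I_beta,
  measurable_fun setT (fun x => rpart (f x * conj (ebasis b))).

Lemma measurable_rpart_mul f (z : S) : smeasurable f ->
  measurable_fun setT (fun x => rpart (f x * z)).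
Proof.
move=> mf; under eq_fun do rewrite -parseval.
by apply: measurable_sum => b; exact: measurable_funM.
Qed.

Lemma smeasurable_cst z : smeasurable (cst z).
Proof. by move=> b; exact: (@measurable_cst _ _ X _ setT (rpart (z * conj (ebasis b)))). Qed.

Lemma smeasurableD f g : smeasurable f -> smeasurable g ->
  smeasurable (fun x => f x + g x).
Proof.
move=> mf mg b; under eq_fun do rewrite mulrDl rpartD.
exact: measurable_funD.
Qed.

Lemma smeasurable_sum (I : Type) (s : seq I) (P : pred I) (F : I -> X -> S) :
  (forall i, smeasurable (F i)) -> smeasurable (fun x => \sum_(i <- s | P i) F i x).
Proof.
move=> mF; elim: s => [|i s ih].
  by under eq_fun do rewrite big_nil; exact: smeasurable_cst.
under eq_fun do rewrite big_cons.
by case: (P i) => //; exact: smeasurableD.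
Qed.

Lemma smeasurableM f g : smeasurable f -> smeasurable g ->
  smeasurable (fun x => f x * g x).
Proof.
move=> mf mg b; under eq_fun do rewrite -mulrA -parseval.
apply: measurable_sum => i; apply: measurable_funM => //.
by under eq_fun do rewrite rpartC -mulrA; exact: measurable_rpart_mul.
Qed.

Lemma smeasurable_conj f : smeasurable f -> smeasurable (fun x => conj (f x)).
Proof.
move=> mf b; under eq_fun do rewrite -rpart_conj sconjM !sconjK rpartC.
exact: measurable_rpart_mul.
Qed.

Lemma measurable_nrm f : smeasurable f ->
  measurable_fun setT (fun x => nrm (f x)).
Proof.
move=> mf; under eq_fun => x do rewrite /nrm -[_ * conj _]mulr1.
by apply: measurable_rpart_mul; apply: smeasurableM => //; exact: smeasurable_conj.
Qed.

Lemma smeasurable_mulmx p q r (A : X -> 'M[S]_(p, q)) (B : X -> 'M[S]_(q, r)) i j :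
  (forall i j, smeasurable (fun x => A x i j)) ->
  (forall i j, smeasurable (fun x => B x i j)) ->
  smeasurable (fun x => (A x *m B x) i j).
Proof.
move=> mA mB; under eq_fun do rewrite mxE.
by apply: smeasurable_sum => k; exact: smeasurableM.
Qed.

Lemma measurable_det n (M : X -> 'M[R]_n) :
  (forall i j, measurable_fun setT (fun x => M x i j)) ->
  measurable_fun setT (fun x => \det (M x)).
Proof.
move=> mM; apply: measurable_sum => s; apply: measurable_funM => //.
by apply: measurable_prod => i _; exact: mM.
Qed.

(** Being chosen among diagonalizations, [hdet] shows no regularity by itself; on Gram matrices it
    is the root of order [beta] of a polynomial in the real coordinates. *)
Lemma measurable_hdet_of p q (A : X -> 'M[S]_p) (Y : X -> 'M[S]_(p, q)) :
  (forall x, A x = Y x *m ctrmx (Y x)) ->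
  (forall i j, smeasurable (fun x => A x i j)) ->
  measurable_fun setT (fun x => hdet (A x)).
Proof.
move=> AY mA.
have e x : hdet (A x) = (\det (rho (A x))) `^ (beta%:R^-1).
  rewrite AY; have [h0 <-] := hdet_gram (Y x).
  rewrite -powR_mulrn// -powRrM mulfV ?powRr1//.
  by rewrite pnatr_eq0 -lt0n real_dim_gt0.
under eq_fun do rewrite e.
apply: (measurableT_comp (measurable_powR _)); apply: measurable_det => i j.
under eq_fun do rewrite mxE -mulrA rpartC -mulrA.
exact: measurable_rpart_mul.
Qed.

Lemma measurable_hdet_gram p q (Y : X -> 'M[S]_(p, q)) :
  (forall i j, smeasurable (fun x => Y x i j)) ->
  measurable_fun setT (fun x => hdet (Y x *m ctrmx (Y x))).
Proof.
move=> mY; apply: (@measurable_hdet_of _ _ _ Y) => // i j.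
apply: smeasurable_mulmx => // k l; under eq_fun do rewrite ctrmxE.
exact: smeasurable_conj.
Qed.

Lemma measurable_hdet_1gram p q (Y : X -> 'M[S]_(p, q)) :
  (forall i j, smeasurable (fun x => Y x i j)) ->
  measurable_fun setT (fun x => hdet (1%:M + Y x *m ctrmx (Y x))).
Proof.
move=> mY; apply: (@measurable_hdet_of _ _ _ (fun x => row_mx 1%:M (Y x))).
  by move=> x; exact: gram_row_mx1.
move=> i j; under eq_fun do rewrite mxE.
apply: smeasurableD; first exact: smeasurable_cst.
apply: smeasurable_mulmx => // k l; under eq_fun do rewrite ctrmxE.
exact: smeasurable_conj.
Qed.

End ScalarMeasurable.

(** * Uniqueness of translation invariant measures *)

Section TranslationInvariant.
Context d (T : measurableType d) (R : realType).
Variable mu : {sigma_finite_measure set T -> \bar R}.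
Local Open Scope ereal_scope.

Lemma tonelli (F : T -> T -> \bar R) :
  measurable_fun setT (fun z : T * T => F z.1 z.2) -> (forall x y, 0 <= F x y) ->
  \int[mu]_x \int[mu]_y F x y = \int[mu]_y \int[mu]_x F x y.
Proof.
by move=> mF F0; exact: (@fubini_tonelli _ _ _ _ _ mu mu (fun z => F z.1 z.2)).
Qed.

(* The measure [int g(A y) dy] is translation invariant, hence proportional to
   [mu]; the proof of uniqueness is the classical one through Tonelli, and the
   test function [f] shows that the factor is 1. *)
Lemma translation_invariant_unique (tr : T -> T -> T) (ng A : T -> T)
    (f : T -> \bar R) (c : R) (g : T -> \bar R) :
  measurable_fun setT (fun z : T * T => tr z.1 z.2) ->
  measurable_fun setT ng -> measurable_fun setT A ->
  measurable_fun setT f -> (forall x, 0 <= f x) ->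
  (forall x y, tr x y = tr y x) -> (forall x y, tr (tr y x) (ng x) = y) ->
  (forall x y, f (tr y (ng (tr x y))) = f x) -> (forall y, f (A y) = f y) ->
  (forall v h, measurable_fun setT h -> (forall x, 0 <= h x) ->
     \int[mu]_x h (tr x v) = \int[mu]_x h x) ->
  (forall v h, measurable_fun setT h -> (forall x, 0 <= h x) ->
     \int[mu]_x h (tr (A x) v) = \int[mu]_x h (A x)) ->
  \int[mu]_x f x = c%:E -> (0 < c)%R ->
  measurable_fun setT g -> (forall x, 0 <= g x) ->
  \int[mu]_x g (A x) = \int[mu]_x g x.
Proof.
have ZR (h : T -> \bar R) (a : R) : measurable_fun setT h -> (forall x, 0 <= h x) ->
    (0 < a)%R -> \int[mu]_x (h x * a%:E) = (\int[mu]_x h x) * a%:E.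
  by move=> mh h0 a0; rewrite ge0_integralZr// lee_fin ltW.
have ZL (h : T -> \bar R) (a : \bar R) : measurable_fun setT h -> (forall x, 0 <= h x) ->
    0 <= a -> \int[mu]_x (a * h x) = a * \int[mu]_x h x.
  by move=> mh h0 a0; rewrite ge0_integralZl.
have mM (h k : T -> \bar R) : measurable_fun setT h -> measurable_fun setT k ->
    measurable_fun setT (fun x => h x * k x).
  exact: emeasurable_funM.
have mM2 (h k : T * T -> \bar R) : measurable_fun setT h -> measurable_fun setT k ->
    measurable_fun setT (fun x => h x * k x).
  exact: emeasurable_funM.
have cancel_c (a b : \bar R) : (0 < c)%R -> a * c%:E = b * c%:E -> a = b.
  move=> c0 /(congr1 (fun z => z * (c^-1)%:E)).
  by rewrite -!muleA -EFinM mulfV ?gt_eqF// !mule1.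
move=> mtr mng mA mf f0 trC trK fng fA shift Ashift fc c0 mg g0.
have m1 h : measurable_fun setT h -> measurable_fun setT (fun z : T * T => h z.1 : \bar R).
  by move=> mh; exact: (measurableT_comp mh measurable_fst).
have m2 h : measurable_fun setT h -> measurable_fun setT (fun z : T * T => h z.2 : \bar R).
  by move=> mh; exact: (measurableT_comp mh measurable_snd).
have mfA : measurable_fun setT (fun y => f (A y)) by exact: (measurableT_comp mf mA).
have mgA : measurable_fun setT (fun y => g (A y)) by exact: (measurableT_comp mg mA).
have mtrA : measurable_fun setT (fun z : T * T => tr z.1 (A z.2)).
  apply: (measurableT_comp (f := fun z => tr z.1 z.2) (g := fun z => (z.1, A z.2))) => //.
  exact: measurable_fun_pair measurable_fst (measurableT_comp mA measurable_snd).
have mtrn : measurable_fun setT (fun z : T * T => tr z.2 (ng z.1)).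
  apply: (measurableT_comp (f := fun z => tr z.1 z.2) (g := fun z => (z.2, ng z.1))) => //.
  exact: measurable_fun_pair measurable_snd (measurableT_comp mng measurable_fst).
have mtrAn : measurable_fun setT (fun z : T * T => tr (A z.2) (ng z.1)).
  apply: (measurableT_comp (f := fun z => tr z.2 (ng z.1)) (g := fun z => (z.1, A z.2))) => //.
  exact: measurable_fun_pair measurable_fst (measurableT_comp mA measurable_snd).
have pairx h (x : T) : measurable_fun setT (fun z : T * T => h z : \bar R) ->
    measurable_fun setT (fun y => h (x, y)).
  by move=> mh; exact: (measurableT_comp mh (measurable_pair1 x)).
have pairy h (y : T) : measurable_fun setT (fun z : T * T => h z : \bar R) ->
    measurable_fun setT (fun x => h (x, y)).
  by move=> mh; exact: (measurableT_comp mh (measurable_pair2 y)).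
(* With [tr] read as addition and [ng] as negation, both sides are compared through the double
   integral of g(x) f(A y). *)
have e1 : \int[mu]_x \int[mu]_y (g x * f (A y)) = (\int[mu]_x g x) * c%:E.
  rewrite -(ZR _ _ mg g0 c0); apply: eq_integral => x _.
  rewrite (ZL _ _ mfA (fun y => f0 _) (g0 x)).
  by under eq_integral do rewrite fA; rewrite fc.
(* Shift x by A y. *)
have e2 : \int[mu]_x \int[mu]_y (g x * f (A y)) =
    \int[mu]_x \int[mu]_y (g (tr x (A y)) * f (A y)).
  rewrite [LHS](tonelli (F := fun x y => g x * f (A y))); first last.
  - by move=> x y; exact: mule_ge0.
  - exact: mM2 (m1 _ mg) (m2 _ mfA).
  rewrite [RHS](tonelli (F := fun x y => g (tr x (A y)) * f (A y))); first last.
  - by move=> x y; exact: mule_ge0.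
  - exact: mM2 (measurableT_comp mg mtrA) (m2 _ mfA).
  apply: eq_integral => y _.
  by rewrite -(shift (A y) (fun x => g x * f (A y)) (mM _ _ mg (measurable_cst _))
    (fun x => mule_ge0 (g0 _) (f0 _))).
(* Replace A y by A y - x, by invariance of the image measure. *)
have e3 : \int[mu]_x \int[mu]_y (g (tr x (A y)) * f (A y)) =
    \int[mu]_x \int[mu]_y (g (A y) * f (tr (A y) (ng x))).
  apply: eq_integral => x _.
  have mfx := pairx (fun z => f (tr z.2 (ng z.1))) x (measurableT_comp mf mtrn).
  rewrite -[RHS](Ashift x (fun z => g z * f (tr z (ng x))) (mM _ _ mg mfx)
    (fun z => mule_ge0 (g0 _) (f0 _))).
  by apply: eq_integral => y _; rewrite trK trC.
(* For fixed y, shifting x by A y turns f(A y - x) into f(-x), that is f(x). *)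
have e4 : \int[mu]_x \int[mu]_y (g (A y) * f (tr (A y) (ng x))) =
    (\int[mu]_y g (A y)) * c%:E.
  rewrite (tonelli (F := fun x y => g (A y) * f (tr (A y) (ng x)))); first last.
  - by move=> x y; exact: mule_ge0.
  - exact: mM2 (m2 _ mgA) (measurableT_comp mf mtrAn).
  rewrite -(ZR _ _ mgA (fun y => g0 _) c0); apply: eq_integral => y _.
  have mfy : measurable_fun setT (fun x => f (tr (A y) (ng x))).
    exact: (pairy (fun z => f (tr (A z.2) (ng z.1))) y (measurableT_comp mf mtrAn)).
  rewrite (ZL _ _ mfy (fun x => f0 _) (g0 _)).
  rewrite -(shift (A y) (fun x => f (tr (A y) (ng x))) mfy (fun x => f0 _)).
  by under eq_integral do rewrite fng; rewrite fc.
apply: (cancel_c _ _ c0); rewrite -e4 -e3 -e2; exact: e1.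
Qed.

End TranslationInvariant.

Section RowCoords.
Variables (R : realType) (K : scalars).
Local Notation S := (scalar R K).
Local Notation beta := (real_dim K).
Local Notation conj := (@sconj R K).
Local Notation re := (@sreal R K).
Local Notation rpart := (@rpart R K).
Local Notation ebasis := (@ebasis R K).
Local Notation leb := (@lebesgue_measure R).
Local Notation scoords := (beta.-tuple (measurableTypeR R)).

Definition coords_of (z : S) : scoords :=
  [tuple rpart (z * conj (ebasis b)) | b < beta].

Lemma rpart_scalar_of_coords (t : scoords) (b : 'I_beta) :
  rpart (scalar_of_coords t * conj (ebasis b)) = tnth t b.
Proof.
have -> : tnth t b = \sum_(k < beta) tnth t k * (k == b)%:R.
  rewrite (bigD1 b)//= big1 ?addr0 ?eqxx ?mulr1// => k /negbTE ->.
  by rewrite mulr0.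
have E (k : 'I_beta) :
    nth 0 [tuple ((j == b)%:R : R) | j < beta] k = (k == b)%:R.
  by rewrite -tnth_nth tnth_mktuple.
rewrite /ebasis; move: E; case: K t b => t b E /=;
  rewrite !big_ord_recl big_ord0 !(tnth_nth 0) /=.
- by rewrite (E ord0) addr0.
- by rewrite (E ord0) (E (lift ord0 ord0)); ring.
- rewrite (E ord0) (E (lift ord0 ord0)) (E (lift ord0 (lift ord0 ord0))).
  by rewrite (E (lift ord0 (lift ord0 (lift ord0 ord0)))); ring.
Qed.

Lemma scalar_of_coordsK : cancel (@scalar_of_coords R K) coords_of.
Proof.
by move=> t; apply: eq_from_tnth => b; rewrite tnth_mktuple rpart_scalar_of_coords.
Qed.

Lemma coords_ofK : cancel coords_of (@scalar_of_coords R K).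
Proof.
move=> z; apply: rpart_ebasis_inj => b.
by rewrite rpart_scalar_of_coords tnth_mktuple.
Qed.

(** Lebesgue measure on the scalars and, below, on rows of them; [mat_measure] is by definition the
    n-th power of [rmu]. *)
Definition smu := power_measure leb beta.
Definition rmu m := power_measure smu m.

Section Rows.
Variable m : nat.
Local Notation row_coords := (m.-tuple scoords).

Definition row_of (x : row_coords) : 'rV[S]_m :=
  \row_j scalar_of_coords (tnth x j).

Definition tuple_of_row (v : 'rV[S]_m) : row_coords :=
  [tuple coords_of (v ord0 j) | j < m].

Lemma row_ofK : cancel row_of tuple_of_row.
Proof.
move=> x; apply: eq_from_tnth => j.
by rewrite tnth_mktuple mxE; exact: scalar_of_coordsK.
Qed.

Lemma tuple_of_rowK : cancel tuple_of_row row_of.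
Proof.
by move=> v; apply/rowP => j; rewrite mxE tnth_mktuple coords_ofK.
Qed.

Lemma smeasurable_row_of j : smeasurable (fun x => row_of x ord0 j).
Proof.
move=> b; under eq_fun do rewrite mxE rpart_scalar_of_coords.
exact: (measurableT_comp (measurable_tnth b) (measurable_tnth j)).
Qed.

Lemma measurable_tuple_of_row d (X : measurableType d) (F : X -> 'rV[S]_m) :
  (forall j, smeasurable (fun x => F x ord0 j)) ->
  measurable_fun setT (fun x => tuple_of_row (F x)).
Proof.
move=> mF; apply/measurable_fun_tnthP => j; apply/measurable_fun_tnthP => b.
rewrite (_ : _ \o _ = fun x => rpart (F x ord0 j * conj (ebasis b))).
  exact: mF.
by apply/funext => x /=; rewrite !tnth_mktuple.
Qed.

Lemma measurable_nrm_row j : measurable_fun setT (fun x => nrm (row_of x ord0 j)).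
Proof. exact: measurable_nrm (smeasurable_row_of j). Qed.

Local Open Scope ereal_scope.

Lemma rmu_map (phi : 'I_m -> 'I_beta -> R -> R) (c : 'I_m -> 'I_beta -> R)
    (g : row_coords -> \bar R) :
  (forall j b, measurable_fun setT (phi j b : measurableTypeR R -> measurableTypeR R)) ->
  (forall j b (h : measurableTypeR R -> \bar R), measurable_fun setT h ->
     (forall x, 0 <= h x) ->
     \int[leb]_x h (phi j b x) = (c j b)%:E * \int[leb]_x h x) ->
  (forall j b, (0 <= c j b)%R) ->
  measurable_fun setT g -> (forall t, 0 <= g t) ->
  \int[rmu m]_t
    g [tuple [tuple phi j b (tnth (tnth t j) b) | b < beta] | j < m] =
  (\prod_(j < m) \prod_(b < beta) c j b)%:E * \int[rmu m]_t g t.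
Proof.
move=> mphi cphi c0 mg g0.
apply: (@integral_power_map _ _ _ smu m
  (fun j (t : scoords) => [tuple phi j b (tnth t b) | b < beta])) => //.
- by move=> j; exact: measurable_tuple_map.
- by move=> j h mh h0; apply: integral_power_map => //; exact: cphi.
- by move=> j; apply: prodr_ge0.
Qed.

Lemma rmu_shift (v : 'rV[S]_m) (g : row_coords -> \bar R) :
  measurable_fun setT g -> (forall t, 0 <= g t) ->
  \int[rmu m]_t g (tuple_of_row (row_of t + v)) = \int[rmu m]_t g t.
Proof.
move=> mg g0.
have := @rmu_map (fun j b r => r + rpart (v ord0 j * conj (ebasis b)))%R
  (fun _ _ => 1%R) g.
rewrite big1 ?mul1e; last by move=> j _; rewrite big1.
move=> <- //.
- apply: eq_integral => t _; congr (g _); apply: eq_from_tnth => j.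
  rewrite !tnth_mktuple; apply: eq_from_tnth => b.
  by rewrite !tnth_mktuple !mxE mulrDl rpartD rpart_scalar_of_coords.
- by move=> j b; exact: measurable_funD.
- by move=> j b h mh h0; rewrite mul1e; exact: lebesgue_shift.
Qed.

Lemma rmu_scale (a : 'I_m -> R) (g : row_coords -> \bar R) :
  (forall j, (0 < a j)%R) ->
  measurable_fun setT g -> (forall t, 0 <= g t) ->
  \int[rmu m]_t
    g (tuple_of_row (row_of t *m diag_mx (map_mx re (\row_j a j))))%R =
  (\prod_(j < m) (a j)^-1 ^+ beta)%:E * \int[rmu m]_t g t.
Proof.
move=> a0 mg g0.
have := @rmu_map (fun j b r => a j * r)%R (fun j _ => (a j)^-1)%R g.
have -> : (\prod_(j < m) \prod_(b < beta) (a j)^-1 = \prod_(j < m) (a j)^-1 ^+ beta)%R.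
  by apply: eq_bigr => j _; rewrite prodr_const card_ord.
move=> <- //.
- apply: eq_integral => t _; congr (g _); apply: eq_from_tnth => j.
  rewrite !tnth_mktuple; apply: eq_from_tnth => b.
  rewrite !tnth_mktuple mul_mx_diag !mxE -srealC -mulrA rpartZ.
  by rewrite rpart_scalar_of_coords.
- by move=> j b; exact: measurable_funM.
- by move=> j b h mh h0; exact: lebesgue_dilation.
- by move=> j b; rewrite invr_ge0 ltW.
Qed.

(** The squared Euclidean norm, that is the real entry of v v^*. *)
Definition gram_norm (v : 'rV[S]_m) : R := (\sum_j nrm (v ord0 j))%R.

Lemma gram_norm_ge0 v : (0 <= gram_norm v)%R.
Proof. by apply: sumr_ge0 => j _; exact: nrm_ge0. Qed.

Lemma gram_norm_unitary (V : 'M[S]_m) v : is_unitary V ->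
  gram_norm (v *m V) = gram_norm v.
Proof.
move=> [V1 _]; have := row_gramE (v *m V).
rewrite ctrmxM mulmxA -(mulmxA v) V1 mulmx1 row_gramE.
move=> /matrixP /(_ ord0 ord0); rewrite !mxE eqxx !mulr1n => /(congr1 rpart).
by rewrite !rpartR.
Qed.

Lemma gram_normN v : gram_norm (- v) = gram_norm v.
Proof.
apply: eq_bigr => j _; rewrite mxE /nrm.
by rewrite -[(- _)%R]mulN1r -(sreal1 R K) -srealN sconjM sconjR -mulrA (mulrA (_ ord0 j)) mulrA
  -srealC mulrA -srealM mulrNN mulr1 sreal1 mul1r.
Qed.

Lemma measurable_gram_norm : measurable_fun setT (fun x => gram_norm (row_of x)).
Proof. by apply: measurable_sum => j; exact: measurable_nrm_row. Qed.

Lemma rmu_gauss : \int[rmu m]_x (expR (- gram_norm (row_of x)))%:E =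
  (Num.sqrt pi ^+ (beta * m))%:E.
Proof.
have mg : measurable_fun setT (@gauss_fun R : measurableTypeR R -> measurableTypeR R).
  exact: measurable_gauss_fun.
have i1 : \int[smu]_t (\prod_(b < beta) gauss_fun (tnth t b))%:E =
    (Num.sqrt pi ^+ beta)%:E.
  rewrite (@integral_power_prod _ _ _ leb beta (fun _ => @gauss_fun R) (fun _ => Num.sqrt pi)) //.
  - by rewrite prodr_const card_ord.
  - by move=> _ x; exact: gauss_fun_ge0.
  - by move=> _; exact: integralT_gauss.
have := @integral_power_prod _ _ _ smu m
  (fun _ (t : scoords) => \prod_(b < beta) gauss_fun (tnth t b))%R
  (fun _ => (Num.sqrt pi ^+ beta)%R).
rewrite prodr_const card_ord -exprM => <-//.
- apply: eq_integral => x _; congr EFin; rewrite /gram_norm -sumrN expR_sum.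
  apply: eq_bigr => j _; rewrite mxE nrmE -sumrN expR_sum.
  by apply: eq_bigr.
- move=> _; apply: measurable_prod => b _.
  exact: (measurableT_comp mg (measurable_tnth b)).
- by move=> _ t; apply: prodr_ge0 => b _; exact: gauss_fun_ge0.
Qed.

(** The image of Lebesgue measure under V is translation invariant, hence a multiple of it; the
    Gaussian has the same integral for both because V preserves the norm, which makes the multiple
    1. *)
Lemma rmu_unitary (V : 'M[S]_m) (g : row_coords -> \bar R) : is_unitary V ->
  measurable_fun setT g -> (forall t, 0 <= g t) ->
  \int[rmu m]_t g (tuple_of_row (row_of t *m V)) = \int[rmu m]_t g t.
Proof.
move=> uV mg g0; have [V1 V2] := uV.
pose G := (Num.sqrt pi ^+ (beta * m))%R : R.
have G0 : (0 < G)%R by rewrite exprn_gt0// sqrtr_gt0 pi_gt0.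
have s1 j : smeasurable (fun z : row_coords * row_coords => row_of z.1 ord0 j).
  move=> b; exact: (measurableT_comp (smeasurable_row_of j b) measurable_fst).
have s2 j : smeasurable (fun z : row_coords * row_coords => row_of z.2 ord0 j).
  move=> b; exact: (measurableT_comp (smeasurable_row_of j b) measurable_snd).
have mA : measurable_fun setT (fun y => tuple_of_row (row_of y *m V)).
  apply: measurable_tuple_of_row => j; apply: smeasurable_mulmx => [i k|i k].
    by rewrite ord1; exact: smeasurable_row_of.
  exact: smeasurable_cst.
apply: (@translation_invariant_unique _ _ _ (rmu m)
  (fun x y => tuple_of_row (row_of x + row_of y)%R)
  (fun x => tuple_of_row (- row_of x)%R)
  (fun y => tuple_of_row (row_of y *m V))
  (fun x => (expR (- gram_norm (row_of x)))%:E) G) => //.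
- apply: measurable_tuple_of_row => j; under eq_fun do rewrite mxE.
  exact: smeasurableD.
- apply: measurable_tuple_of_row => j; under eq_fun do rewrite mxE -mulN1r.
  by apply: smeasurableM; [exact: smeasurable_cst|exact: smeasurable_row_of].
- apply/measurable_EFinP; apply: measurableT_comp => //.
  by apply: measurable_funN; exact: measurable_gram_norm.
- by move=> x y; rewrite addrC.
- by move=> x y; rewrite !tuple_of_rowK addrK row_ofK.
- move=> x y; rewrite !tuple_of_rowK opprD addrCA subrr addr0.
  by rewrite gram_normN.
- by move=> x; rewrite !tuple_of_rowK gram_norm_unitary.
- by move=> v h mh h0; exact: rmu_shift.
- move=> v h mh h0.
  have mhA : measurable_fun setT (fun y => h (tuple_of_row (row_of y *m V))).
    exact: (measurableT_comp mh mA).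
  (* Translating by v after V is translating by v V^* before it. *)
  rewrite -[RHS](rmu_shift (row_of v *m ctrmx V) mhA (fun t => h0 _)).
  apply: eq_integral => y _; rewrite !tuple_of_rowK mulmxDl.
  by rewrite -mulmxA V2 mulmx1.
- exact: rmu_gauss.
Qed.

End Rows.
End RowCoords.

(** * Gaussian moments *)

Section Radial.
Context d (T : measurableType d) (R : realType).
Variable mu : {sigma_finite_measure set T -> \bar R}.
(** Later q is the squared norm over the null eigenvalues and r that over the others. The map [sc c]
    multiplies q by c and fixes r; p is half the real dimension of the part that it scales, and G
    the Gaussian mass. *)
Variables (q r : T -> R) (sc : R -> T -> T) (p G : R).
Local Notation leb := (@lebesgue_measure R).
Hypotheses (mq : measurable_fun setT q) (mr : measurable_fun setT r).
Hypotheses (p_gt0 : 0 < p) (G_gt0 : 0 < G).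
Hypotheses (qS : forall c x, 0 < c -> q (sc c x) = c * q x)
  (rS : forall c x, 0 < c -> r (sc c x) = r x).
Hypothesis msc : forall c, 0 < c -> measurable_fun setT (sc c).
Hypothesis muS : forall c (h : T -> \bar R), 0 < c -> measurable_fun setT h ->
  (forall x, (0 <= h x)%E) ->
  (\int[mu]_x h (sc c x) = (epow c (- p))%:E * \int[mu]_x h x)%E.
Hypothesis q_ae : {ae mu, forall x, 0 < q x}.
Hypothesis gauss : (\int[mu]_x (expR (- (q x + r x)))%:E = G%:E)%E.

Let w x := expR (- r x) * hv (q x).
Let W x := expR (- (q x + r x)) * hv (q x).
Let iv t := expR (- epow t (- 1)) * (epow t (- p - 1) * hv t).
(** Integrated over t this kernel is a multiple of q^(-p) e^(-r), while rescaling x by t frees its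
    exponential from t: it links the weight q^(-p) e^(-r) to the Gaussian. *)
Let k x t := expR (- (q x * epow t (- 1))) * (epow t (- p - 1) * hv t) * w x.

Let w_ge0 x : 0 <= w x. Proof. exact: mulr_ge0 (expR_ge0 _) (hv_ge0 _). Qed.
Let W_ge0 x : 0 <= W x. Proof. exact: mulr_ge0 (expR_ge0 _) (hv_ge0 _). Qed.
Let e_ge0 (a t : R) : 0 <= epow t a * hv t.
Proof. exact: mulr_ge0 (epow_ge0 _ _) (hv_ge0 _). Qed.
Let iv_ge0 t : 0 <= iv t.
Proof. exact: mulr_ge0 (expR_ge0 _) (e_ge0 _ _). Qed.
Let k_ge0 x t : 0 <= k x t.
Proof. exact: mulr_ge0 (mulr_ge0 (expR_ge0 _) (e_ge0 _ _)) (w_ge0 _). Qed.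
Let k_ge0E x t : (0 <= (k x t)%:E)%E. Proof. by rewrite lee_fin. Qed.

Let mw : measurable_fun setT w.
Proof.
apply: measurable_funM; first by apply: measurableT_comp => //; exact: measurable_funN.
exact: (measurableT_comp (@measurable_hv R)).
Qed.

Let mW : measurable_fun setT W.
Proof.
apply: measurable_funM.
  by apply: measurableT_comp => //; apply: measurable_funN; exact: measurable_funD.
exact: (measurableT_comp (@measurable_hv R)).
Qed.

Let me a : measurable_fun setT (fun t : measurableTypeR R => epow t a * hv t).
Proof. by apply: measurable_funM; [exact: measurable_epow|exact: measurable_hv]. Qed.

Let mep a : measurable_fun setT (fun t : measurableTypeR R => epow t a).
Proof. exact: measurable_epow. Qed.

Let mk : measurable_fun setT (fun z : T * measurableTypeR R => k z.1 z.2).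
Proof.
apply: measurable_funM; last exact: (measurableT_comp mw measurable_fst).
apply: measurable_funM; last exact: (measurableT_comp (me _) measurable_snd).
apply: measurableT_comp => //; apply: measurable_funN; apply: measurable_funM.
  exact: (measurableT_comp mq measurable_fst).
exact: (measurableT_comp (mep _) measurable_snd).
Qed.

Let miv : measurable_fun setT (iv : measurableTypeR R -> R).
Proof.
apply: measurable_funM; last exact: me.
by apply: measurableT_comp => //; exact: measurable_funN.
Qed.

Local Open Scope ereal_scope.

(** An extended real for now; it equals Gamma(p), which testing the final identity on the constant 1
    will show. *)
Let C1 : \bar R := \int[leb]_t (iv t)%:E.

(** Integration against dt / t, the multiplicative Haar measure of the half-line. *)
Let nu (g : measurableTypeR R -> \bar R) := \int[leb]_t (g t * (epow t (- 1) * hv t)%:E).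

Let integral_k c : (0 < c)%R ->
  \int[leb]_t (expR (- (c * epow t (- 1))) * (epow t (- p - 1) * hv t))%:E =
  (epow c (- p))%:E * C1.
Proof.
move=> c0; pose f t := (expR (- (c * epow t (- 1))) * (epow t (- p - 1) * hv t))%:E.
have mf : measurable_fun setT (f : measurableTypeR R -> \bar R).
  apply/measurable_EFinP; apply: measurable_funM; last exact: me.
  by apply: measurableT_comp => //; apply: measurable_funN; exact: measurable_funM.
have f0 t : 0 <= f t by rewrite lee_fin; exact: mulr_ge0 (expR_ge0 _) (e_ge0 _ _).
have := lebesgue_dilation c0 mf f0.
have E t : f (c * t)%R = (epow c (- p - 1))%:E * (iv t)%:E.
  rewrite /f /iv -EFinM; congr EFin; rewrite hvM// hvE.
  have [t0|_] := boolP (0 < t)%R; last by rewrite !mulr0.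
  have -> : (c * epow (c * t) (- 1) = epow t (- 1))%R.
    by rewrite epowM// mulrA -{1}(epowx1 c0) -epowD subrr epowx0 mul1r.
  by rewrite epowM// [RHS]mulrCA -mulrA.
under eq_integral do rewrite E.
have miv' : measurable_fun setT (fun t : measurableTypeR R => (iv t)%:E).
  exact/measurable_EFinP.
have iv0 t : [set: measurableTypeR R] t -> 0 <= (iv t)%:E by rewrite lee_fin.
have ec : 0 <= (epow c (- p - 1))%:E by rewrite lee_fin epow_ge0.
rewrite (ge0_integralZl _ measurableT miv' iv0 ec).
move=> /(congr1 (fun z => c%:E * z)); rewrite !muleA -!EFinM divff ?gt_eqF// mul1e => <-.
by rewrite -{1}(epowx1 c0) -epowD addrC subrK.
Qed.

Let E1 g x : (forall y, 0 <= g y) ->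
  \int[leb]_t (g (q x) * (k x t)%:E) = C1 * (g (q x) * (epow (q x) (- p) * w x)%:E).
Proof.
move=> g0.
have mkx : measurable_fun setT (fun t : measurableTypeR R => (k x t)%:E).
  by apply/measurable_EFinP; exact: (measurableT_comp mk (measurable_pair1 x)).
rewrite (ge0_integralZl _ measurableT mkx (fun t _ => k_ge0E x t) (g0 _)).
have mkq : measurable_fun setT (fun t : measurableTypeR R =>
    (expR (- (q x * epow t (- 1))) * (epow t (- p - 1) * hv t))%:E).
  apply/measurable_EFinP; apply: measurable_funM; last exact: me.
  by apply: measurableT_comp => //; apply: measurable_funN; exact: measurable_funM.
under eq_integral do rewrite /k EFinM.
rewrite ge0_integralZr//; first last.
- by rewrite lee_fin.
- by move=> t _; rewrite lee_fin; exact: mulr_ge0 (expR_ge0 _) (e_ge0 _ _).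
have [qx|] := ltP 0%R (q x).
  rewrite integral_k// (muleC _ C1) -muleA -EFinM.
  by rewrite muleCA.
move=> qx; have -> : w x = 0%R.
  by rewrite /w hvE ltNge qx mulr0.
by rewrite !mulr0 !mule0.
Qed.

(** Rescaling x by t contributes t^p, which turns t^(-p-1) into the Haar density 1/t. *)
Let E2 g t : measurable_fun setT (g : measurableTypeR R -> \bar R) ->
  (forall y, 0 <= g y) ->
  \int[mu]_x (g (q x) * (k x t)%:E) =
  \int[mu]_x ((epow t (- 1) * hv t)%:E * (g (t * q x)%R * (W x)%:E)).
Proof.
move=> mg g0; have [t0|t0] := boolP (0 < t)%R; last first.
  rewrite !integral0_eq// => x _; rewrite /k hvE (negbTE t0) !(mulr0, mul0r).
    by rewrite mul0e.
  by rewrite mule0.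
pose f x := g (q x) * (k x t)%:E.
have mf : measurable_fun setT f.
  apply: emeasurable_funM; first exact: (measurableT_comp mg mq).
  by apply/measurable_EFinP; exact: (measurableT_comp mk (measurable_pair2 t)).
have f0 x : 0 <= f x by exact: mule_ge0 (g0 _) (k_ge0E _ _).
have := muS t0 mf f0 => /(congr1 (fun z => (epow t p)%:E * z)).
rewrite muleA -EFinM -epowD subrr epowx0 mul1e => <-.
have mfs : measurable_fun setT (fun x => f (sc t x)).
  exact: (measurableT_comp mf (msc t0)).
rewrite -(ge0_integralZl _ measurableT mfs (fun x _ => f0 _)); last first.
  by rewrite lee_fin epow_ge0.
apply: eq_integral => x _; rewrite /f qS// muleCA [RHS]muleCA -!EFinM.
congr (_ * _%:E); rewrite /k /w /W qS// rS// hvM// hvE t0.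
have -> : (t * q x * epow t (- 1) = q x)%R.
  by rewrite mulrAC -{1}(epowx1 t0) -epowD subrr epowx0 mul1r.
have -> : (epow t (- 1) = epow t p * epow t (- p - 1))%R.
  by rewrite -epowD; congr epow; ring.
rewrite opprD expRD !mulr1.
move: (epow t p) (epow t (- p - 1)) (expR (- q x)) (expR (- r x)) (hv (q x)).
by move=> a b c e u; ring.
Qed.

(** Invariance of dt / t under multiplication by q(x). *)
Let E3 g x : measurable_fun setT (g : measurableTypeR R -> \bar R) ->
  (forall y, 0 <= g y) ->
  \int[leb]_t ((epow t (- 1) * hv t)%:E * (g (t * q x)%R * (W x)%:E)) =
  nu g * (W x)%:E.
Proof.
move=> mg g0; have [qx|qx] := ltP 0%R (q x); last first.
  have -> : W x = 0%R by rewrite /W hvE ltNge qx mulr0.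
  by rewrite mule0 integral0_eq// => t _; rewrite !mule0.
pose F (t : measurableTypeR R) := g t * (epow t (- 1) * hv t)%:E.
have mF : measurable_fun setT F.
  by apply: emeasurable_funM => //; apply/measurable_EFinP; exact: me.
have F0 t : 0 <= F t by apply: mule_ge0 (g0 _) _; rewrite lee_fin.
have mFq : measurable_fun setT (fun t => F (q x * t)%R).
  by apply: (measurableT_comp mF); exact: measurable_funM.
transitivity (\int[leb]_t ((q x * W x)%:E * F (q x * t)%R)).
  apply: eq_integral => t _; rewrite /F (mulrC t) muleCA [RHS]muleCA -!EFinM.
  congr (_ * _%:E); rewrite hvM// hvE; have [t0|_] := boolP (0 < t)%R; last first.
    by rewrite !(mulr0, mul0r).
  rewrite !mulr1 mulrAC; congr (_ * _)%R.
  by rewrite epowM// mulrA -{1}(epowx1 qx) -epowD subrr epowx0 mul1r.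
rewrite ge0_integralZl//; last first.
  by rewrite lee_fin; exact: mulr_ge0 (ltW qx) (W_ge0 _).
rewrite (lebesgue_dilation qx mF F0) muleA -EFinM mulrAC divff ?gt_eqF// mul1r.
by rewrite muleC.
Qed.

(** Since q > 0 almost everywhere, the cut-off [hv (q x)] can be inserted or dropped. *)
Let integral_ae (g : measurableTypeR R -> \bar R) (v : T -> R) :
  measurable_fun setT g -> measurable_fun setT v ->
  \int[mu]_x (g (q x) * (v x * hv (q x))%:E) = \int[mu]_x (g (q x) * (v x)%:E).
Proof.
move=> mg mv; apply: ae_eq_integral => //.
- apply: emeasurable_funM; first exact: (measurableT_comp mg mq).
  apply/measurable_EFinP; apply: measurable_funM => //.
  exact: (measurableT_comp (@measurable_hv R) mq).
- apply: emeasurable_funM; first exact: (measurableT_comp mg mq).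
  exact/measurable_EFinP.
- apply: filterS q_ae => x qx _ /=.
  by rewrite hvE qx mulr1.
Qed.

Let mN : measurable_fun setT (fun x => expR (- (q x + r x))).
Proof. by apply: measurableT_comp => //; apply: measurable_funN; exact: measurable_funD. Qed.

Let integral_W : \int[mu]_x (W x)%:E = G%:E.
Proof.
have := integral_ae (measurable_cst 1) mN.
by under eq_integral do rewrite mul1e; under [RHS]eq_integral do rewrite mul1e; rewrite gauss.
Qed.

(* Uniqueness of the multiplicative Haar measure: integrate
   g(q x) e^(-q x / t) t^(-p-1) e^(-r x) over (x, t) in both orders, rescaling x
   by t in one of them. *)
Let radial_haar (g : measurableTypeR R -> \bar R) : measurable_fun setT g ->
  (forall y, 0 <= g y) ->
  C1 * \int[mu]_x (g (q x) * (epow (q x) (- p) * w x)%:E) = nu g * G%:E.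
Proof.
move=> mg g0.
have mgq : measurable_fun setT (fun x => g (q x)) by exact: (measurableT_comp mg mq).
have m1 : measurable_fun setT (fun x => g (q x) * (epow (q x) (- p) * w x)%:E).
  apply: emeasurable_funM => //; apply/measurable_EFinP; apply: measurable_funM => //.
  exact: (measurableT_comp (mep (- p)%R) mq).
have p1 x : 0 <= g (q x) * (epow (q x) (- p) * w x)%:E.
  apply: mule_ge0 (g0 _) _; rewrite lee_fin; exact: mulr_ge0 (epow_ge0 _ _) (w_ge0 _).
have c1 : 0 <= C1 by apply: integral_ge0 => t _; rewrite lee_fin.
rewrite -(ge0_integralZl _ measurableT m1 (fun x _ => p1 x) c1).
under eq_integral do rewrite -(E1 _ g0).
have m2 : measurable_fun setT (fun z : T * measurableTypeR R => g (q z.1) * (k z.1 z.2)%:E).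
  apply: emeasurable_funM; first exact: (measurableT_comp mgq measurable_fst).
  exact/measurable_EFinP.
rewrite (@fubini_tonelli _ _ _ _ _ mu leb _ m2 (fun z => mule_ge0 (g0 _) (k_ge0E _ _))) /=.
under eq_integral do rewrite (E2 _ mg g0).
have m3 : measurable_fun setT (fun z : T * measurableTypeR R =>
    (epow z.2 (- 1) * hv z.2)%:E * (g (z.2 * q z.1)%R * (W z.1)%:E)).
  apply: emeasurable_funM.
    by apply/measurable_EFinP; exact: (measurableT_comp (me _) measurable_snd).
  apply: emeasurable_funM.
    apply: (measurableT_comp mg); apply: measurable_funM; first exact: measurable_snd.
    exact: (measurableT_comp mq measurable_fst).
  by apply/measurable_EFinP; exact: (measurableT_comp mW measurable_fst).
have p3 (z : T * measurableTypeR R) :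
    0 <= (epow z.2 (- 1) * hv z.2)%:E * (g (z.2 * q z.1)%R * (W z.1)%:E).
  by rewrite !mule_ge0// lee_fin.
rewrite -(@fubini_tonelli _ _ _ _ _ mu leb _ m3 p3) /=.
under eq_integral do rewrite (E3 _ mg g0).
have nu0 : 0 <= nu g.
  by apply: integral_ge0 => t _; apply: mule_ge0 (g0 _) _; rewrite lee_fin.
have mWE : measurable_fun setT (fun x => (W x)%:E) by exact/measurable_EFinP.
have WE0 x : [set: T] x -> 0 <= (W x)%:E by rewrite lee_fin.
by rewrite (ge0_integralZl _ measurableT mWE WE0 nu0) integral_W.
Qed.

(** [radial_haar] at g(t) = h(t) e^(-t) t^p: under the Gaussian, q is Gamma distributed with
    parameter p and total mass G. *)
Lemma radial (h : measurableTypeR R -> \bar R) : measurable_fun setT h ->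
  (forall y, 0 <= h y) ->
  \int[mu]_x (h (q x) * (expR (- (q x + r x)))%:E) =
  \int[leb]_t (h t * (G / Re (cGamma p%:C) * gpos p t)%:E).
Proof.
move=> mh h0.
pose e (t : measurableTypeR R) := (expR (- t) * epow t p)%R.
have me' : measurable_fun setT e.
  by apply: measurable_funM => //; apply: measurableT_comp => //; exact: measurable_funN.
have key (u : measurableTypeR R -> \bar R) : measurable_fun setT u ->
    (forall y, 0 <= u y) ->
    C1 * \int[mu]_x (u (q x) * (W x)%:E) = \int[leb]_t (u t * (gpos p t)%:E) * G%:E.
  move=> mu' u0.
  have mue : measurable_fun setT (fun t => u t * (e t)%:E).
    by apply: emeasurable_funM => //; exact/measurable_EFinP.
  have ue0 t : 0 <= u t * (e t)%:E.
    by apply: mule_ge0 (u0 _) _; rewrite lee_fin; exact: mulr_ge0 (expR_ge0 _) (epow_ge0 _ _).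
  have := radial_haar mue ue0; rewrite /nu.
  have -> : \int[mu]_x (u (q x) * (e (q x))%:E * (epow (q x) (- p) * w x)%:E) =
      \int[mu]_x (u (q x) * (W x)%:E).
    apply: eq_integral => x _; rewrite -muleA -EFinM; congr (_ * _%:E).
    have : (epow (q x) p * epow (q x) (- p) = 1)%R by rewrite -epowD subrr epowx0.
    rewrite /e /w /W opprD expRD.
    move: (expR (- q x)) (epow (q x) p) (epow (q x) (- p)) => a b c bc.
    by rewrite (mulrA (a * b)%R) -(mulrA a) bc mulr1 mulrA.
  move=> ->; congr (_ * _); apply: eq_integral => t _; rewrite -muleA -EFinM.
  congr (_ * _%:E); rewrite /e /gpos epowD !mulrA; congr (_ * _)%R.
  by move: (expR _) (epow t p) (epow t (- 1)) => a b c; ring.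
(* Testing on the constant 1 identifies [C1], so that it can be divided out. *)
have C1E : C1 = (Re (cGamma p%:C))%:E.
  have := key (cst 1) (measurable_cst _) (fun _ => @lee01 R).
  under eq_integral do rewrite mul1e; under [X in _ = X * _]eq_integral do rewrite mul1e.
  rewrite integral_W integral_gpos// => /(congr1 (fun z => z * (G^-1)%:E)).
  by rewrite -!muleA -EFinM divff ?gt_eqF// !mule1.
have gp := cGammaR_gt0 p_gt0.
have := key h mh h0; rewrite C1E integral_ae//.
move=> /(congr1 (fun z => ((Re (cGamma p%:C))^-1)%:E * z)).
rewrite muleA -EFinM mulVf ?gt_eqF// mul1e => ->.
have mgp : measurable_fun setT (fun t : measurableTypeR R => h t * (gpos p t)%:E).
  by apply: emeasurable_funM => //; apply/measurable_EFinP; exact: measurable_gpos.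
rewrite (muleC _ G%:E) muleA -EFinM (mulrC _ G).
rewrite -ge0_integralZl//.
- by apply: eq_integral => t _; rewrite muleCA -EFinM.
- by move=> t _; apply: mule_ge0 (h0 _) _; rewrite lee_fin gpos_ge0.
- by rewrite lee_fin divr_ge0// ltW.
Qed.

End Radial.

(** * Integrals of q^(s-p) (1 + q + r)^(-tau) *)

Section RowIntegral.
Context d (T : measurableType d) (R : realType).
Variable mu : {sigma_finite_measure set T -> \bar R}.
(** Besides [sc], which scales q alone, [sc'] scales q and r together; p' is half the real dimension
    of the whole space. *)
Variables (q r : T -> R) (sc sc' : R -> T -> T) (p p' G : R).
Local Notation leb := (@lebesgue_measure R).
Implicit Types s tau : R[i].
Hypotheses (mq : measurable_fun setT q) (mr : measurable_fun setT r).
Hypotheses (q_ge0 : forall x, 0 <= q x) (r_ge0 : forall x, 0 <= r x).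
Hypotheses (p_gt0 : 0 < p) (p_le : p <= p') (G_gt0 : 0 < G).
Hypotheses (qS : forall c x, 0 < c -> q (sc c x) = c * q x)
  (rS : forall c x, 0 < c -> r (sc c x) = r x).
Hypothesis msc : forall c, 0 < c -> measurable_fun setT (sc c).
Hypothesis muS : forall c (h : T -> \bar R), 0 < c -> measurable_fun setT h ->
  (forall x, (0 <= h x)%E) ->
  (\int[mu]_x h (sc c x) = (epow c (- p))%:E * \int[mu]_x h x)%E.
Hypotheses (qS' : forall c x, 0 < c -> q (sc' c x) = c * q x)
  (rS' : forall c x, 0 < c -> r (sc' c x) = c * r x).
Hypothesis msc' : forall c, 0 < c -> measurable_fun setT (sc' c).
Hypothesis muS' : forall c (h : T -> \bar R), 0 < c -> measurable_fun setT h ->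
  (forall x, (0 <= h x)%E) ->
  (\int[mu]_x h (sc' c x) = (epow c (- p'))%:E * \int[mu]_x h x)%E.
Hypothesis q_ae : {ae mu, forall x, 0 < q x}.
Hypothesis gauss : (\int[mu]_x (expR (- (q x + r x)))%:E = G%:E)%E.

Let g0 : R := G / Re (cGamma p%:C).
Let K s : R[i] := g0%:C * cGamma s.
Let A s x : R[i] := cpow (q x) (s - p%:C) * (hv (q x))%:C.
Let F s tau (z : measurableTypeR R * T) : R[i] :=
  A s z.2 * (cpow z.1 (tau - 1) * (expR (- ((1 + (q z.2 + r z.2)) * z.1)))%:C *
    (hv z.1)%:C).

Let mN : measurable_fun setT (fun x => q x + r x).
Proof. exact: measurable_funD. Qed.

Let mA s : cmeasurable (A s).
Proof.
apply: cmeasurableM; first exact: cmeasurable_cpow.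
by apply: cmeasurable_real; exact: (measurableT_comp (@measurable_hv R) mq).
Qed.

Let mAe s : cmeasurable (fun x => A s x * (expR (- (q x + r x)))%:C).
Proof.
apply: cmeasurableM => //; apply: cmeasurable_real.
by apply: measurableT_comp => //; exact: measurable_funN.
Qed.

(** The factor t^(p-1) in the density of [radial] cancels the shift by p in the exponent, leaving
    Euler's integral for Gamma(s). *)
Lemma gauss_moment s : 0 < Re s ->
  has_cintegral mu setT (fun x => A s x * (expR (- (q x + r x)))%:C) (K s).
Proof.
move=> s0.
have mw1 : measurable_fun setT (fun x => expR (- (q x + r x))).
  by apply: measurableT_comp => //; exact: measurable_funN.
have mw2 : measurable_fun setT (fun t : measurableTypeR R => g0 * gpos p t).
  by apply: measurable_funM => //; exact: measurable_gpos.
have g0_ge0 : 0 <= g0 by rewrite divr_ge0 ?ltW// cGammaR_gt0.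
have mf : cmeasurable (fun t : measurableTypeR R => cpow t (s - p%:C) * (hv t)%:C).
  apply: cmeasurableM; first by apply: cmeasurable_cpow; exact: measurable_id.
  by apply: cmeasurable_real; exact: measurable_hv.
have := (iffRL (@has_cintegral_transfer _ _ _ _ _ mu leb q _ _ mq mw1 mw2
  (fun x => expR_ge0 _) (fun t => mulr_ge0 g0_ge0 (gpos_ge0 _ _))
  (radial mq mr p_gt0 G_gt0 qS rS msc muS q_ae gauss)
  (fun t => cpow t (s - p%:C) * (hv t)%:C) (K s) mf)).
apply.
apply: has_cintegral_eq (has_cintegralZ g0%:C (has_cintegral_gam s0)) => t.
rewrite /gam /gpos.
have -> : cpow t (s - 1) = cpow t (s - p%:C) * (epow t (p - 1))%:C :> R[i].
  by rewrite -cpow_real -cpowD; congr cpow; rewrite rmorphB/= addrA subrK.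
have : (hv t)%:C * (hv t)%:C = (hv t)%:C :> R[i].
  by rewrite hvE; case: (0 < t); rewrite ?mulr1 ?mulr0.
have -> : (g0 * (epow t (p - 1) * expR (- t) * hv t))%:C =
    g0%:C * ((epow t (p - 1))%:C * (expR (- t))%:C * (hv t)%:C) :> R[i].
  by rewrite !rmorphM.
move: (cpow t _) (epow t _)%:C (expR _)%:C ((hv t)%:C) (g0%:C) => a b c e g ee.
by rewrite -[in LHS]ee; ring.
Qed.

Lemma gauss_moment_dilation s y : 0 < Re s -> 0 < y ->
  has_cintegral mu setT (fun x => A s x * (expR (- ((q x + r x) * y)))%:C)
    (cpow y (p%:C - s - p'%:C) * K s).
Proof.
move=> s0 y0.
have f1 : measurable_fun setT (fun _ : T => 1 : R) by exact: measurable_cst.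
have f2 : measurable_fun setT (fun _ : T => epow y (- p')) by exact: measurable_cst.
have tr (h : T -> \bar R) : measurable_fun setT h -> (forall x, (0 <= h x)%E) ->
    (\int[mu]_x (h (sc' y x) * 1%:E) = \int[mu]_x (h x * (epow y (- p'))%:E))%E.
  move=> mh h0; under eq_integral do rewrite mule1.
  rewrite (muS' y0 mh h0) ge0_integralZr// ?lee_fin ?epow_ge0//.
  by rewrite muleC.
have := iffRL (@has_cintegral_transfer _ _ _ _ _ mu mu (sc' y) _ _ (msc' y0) f1 f2
  (fun _ => ler01) (fun _ => epow_ge0 _ _) tr _
  ((epow y (- p'))%:C * K s) (mAe s)).
have Ke := has_cintegralZ (epow y (- p'))%:C (gauss_moment s0).
move=> /(_ (has_cintegral_eq (fun x => mulrC _ _) Ke)).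
move=> /(has_cintegralZ (cpow y (p%:C - s))).
have -> : cpow y (p%:C - s) * ((epow y (- p'))%:C * K s) =
    cpow y (p%:C - s - p'%:C) * K s.
  by rewrite -cpow_real [X in _ = X * _]cpowD rmorphN/= mulrA.
apply: has_cintegral_eq => x; rewrite /A qS'// rS'// hvM// hvE.
have [qx|_] := boolP (0 < q x); last by rewrite !(mulr0, mul0r).
rewrite cpowM// -mulrDr (mulrC y).
have e : cpow y (p%:C - s) * cpow y (s - p%:C) = 1.
  by rewrite -cpowD addrC subrKA subrr cpowx0.
have -> : (true%:R)%:C = 1 :> R[i] by [].
move: (cpow y (p%:C - s)) (cpow y (s - p%:C)) e => a b ab.
by rewrite !mulr1 !mulrA ab mul1r.
Qed.

Let FE s tau y x : F s tau (y, x) = cpow (q x) (s - p%:C) * (hv (q x))%:C *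
  (cpow y (tau - 1) * (expR (- ((1 + (q x + r x)) * y)))%:C * (hv y)%:C).
Proof. by []. Qed.

(** The integral over x is a power of y, which merges with y^(tau-1) e^(-y) into Euler's integrand
    for tau - s - (p' - p); this is the origin of the second Gamma factor. *)
Let slice1 s tau y : 0 < Re s ->
  has_cintegral mu setT (fun x => F s tau (y, x))
    (K s * gam (tau - s - (p' - p)%:C) y).
Proof.
move=> s0; have [y0|y0] := boolP (0 < y); last first.
  have := has_cintegralZ 0 (gauss_moment s0).
  rewrite mul0r /gam hvE (negbTE y0) !mulr0.
  by apply: has_cintegral_eq => x; rewrite FE (hvE y) (negbTE y0) !(mul0r, mulr0).
have := has_cintegralZ (cpow y (tau - 1) * (expR (- y))%:C)
  (gauss_moment_dilation s0 y0).
have -> : cpow y (tau - 1) * (expR (- y))%:C * (cpow y (p%:C - s - p'%:C) * K s) =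
    K s * gam (tau - s - (p' - p)%:C) y.
  rewrite /gam hvE y0.
  have -> : tau - s - (p' - p)%:C - 1 = (tau - 1) + (p%:C - s - p'%:C).
    by rewrite rmorphB/=; ring.
  rewrite (cpowD y (tau - 1)); move: (cpow y _) (cpow y _) (expR _)%:C (K s) => a b c e.
  by rewrite mulr1; ring.
apply: has_cintegral_eq => x; rewrite FE (hvE y) y0.
have -> : (expR (- ((1 + (q x + r x)) * y)))%:C =
    (expR (- y))%:C * (expR (- ((q x + r x) * y)))%:C :> R[i].
  by rewrite -rmorphM -expRD mulrDl mul1r opprD.
rewrite -/(A s x); have -> : (true%:R)%:C = 1 :> R[i] by [].
by move: (cpow y _) (A _ _) (expR _)%:C (expR _)%:C => a b c e; ring.
Qed.

Let ReBB s tau (c : R) : Re (tau - s - c%:C) = Re tau - Re s - c.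
Proof. by case: tau s => [? ?] [? ?]. Qed.

Let slice2 s tau x : 0 < Re tau ->
  has_cintegral leb setT (fun y => F s tau (y, x))
    (A s x * (cpow (1 + (q x + r x)) (- tau) * cGamma tau)).
Proof.
move=> t0; have c0 : 0 < 1 + (q x + r x) by rewrite ltr_pwDl// addr_ge0.
exact: has_cintegralZ (A s x) (cGamma_dilation c0 t0).
Qed.

(* Gamma(tau) (1 + q + r)^(-tau) is the integral of y^(tau-1) e^(-(1 + q + r) y). *)
Lemma row_integral s tau : 0 < Re s -> Re s + (p' - p) < Re tau ->
  has_cintegral mu setT
    (fun x => cpow (q x) (s - p%:C) * cpow (1 + (q x + r x)) (- tau))
    (g0%:C * (cGamma s * cGamma (tau - s - (p' - p)%:C) / cGamma tau)).
Proof.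
move=> s0 st.
have t0 : 0 < Re tau by apply: lt_trans st; rewrite ltr_wpDr// subr_ge0.
have mF : cmeasurable (F s tau).
  apply: cmeasurableM; first exact: (cmeasurable_comp measurable_snd (mA s)).
  apply: cmeasurableM; last first.
    apply: cmeasurable_real; exact: (measurableT_comp (@measurable_hv R) measurable_fst).
  apply: cmeasurableM.
    by apply: cmeasurable_cpow; exact: measurable_fst.
  apply: cmeasurable_real; apply: measurableT_comp => //.
  apply: measurable_funN; apply: measurable_funM; last exact: measurable_fst.
  apply: measurable_funD => //; exact: (measurableT_comp mN measurable_snd).
pose a : R := Re tau - Re s - (p' - p).
have a0 : 0 < a by rewrite /a; lra.
have g0_ge0 : 0 <= g0 by rewrite divr_ge0 ?ltW// cGammaR_gt0.
pose w (y : measurableTypeR R) : R := Re (K (Re s)%:C) * gpos a y.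
have norm5 (z1 z2 z3 z4 z5 : R[i]) : normc (z1 * z2 * (z3 * z4 * z5)) =
    normc z1 * normc z2 * (normc z3 * normc z4 * normc z5).
  by rewrite !Normc.normcM.
(* The modulus is the same integrand at real parameters, so [slice1] also gives the integral of the
   modulus. *)
have normF y x : normc (F s tau (y, x)) = Re (F (Re s)%:C (Re tau)%:C (y, x)).
  rewrite !FE norm5 !normcR !normc_cpow !ger0_norm ?hv_ge0 ?expR_ge0//.
  rewrite -[1 in RHS]/(1%:C) -!rmorphB !cpow_real -!rmorphM /=.
  by case: (s) (tau) => [? ?] [? ?] /=.
have wE : {ae leb, forall y, (\int[mu]_x (normc (F s tau (y, x)))%:E = (w y)%:E)%E}.
  apply/aeW => y.
  have /has_cintegralE[_ + _] := @slice1 (Re s)%:C (Re tau)%:C y s0.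
  under eq_integral do rewrite -normF.
  move=> ->; congr EFin; rewrite /w.
  have -> : gam ((Re tau)%:C - (Re s)%:C - (p' - p)%:C) y = (gpos a y)%:C.
    rewrite /gam /gpos.
    have -> : (Re tau)%:C - (Re s)%:C - (p' - p)%:C - 1 = (a - 1)%:C :> R[i].
      by rewrite /a !rmorphB.
    by rewrite cpow_real -!rmorphM.
  by move: (K _) (gpos a y) => z u; rewrite ReMc /= mulr0 subr0.
have iw : leb.-integrable setT (EFin \o w).
  apply: eq_integrable (integrableZl measurableT _ (integrable_gpos a0)) => //.
have iF : cintegrable (leb \x mu)%E setT (F s tau).
  exact: (cintegrable_prod mF wE iw).
have h1 : has_cintegral (leb \x mu)%E setT (F s tau)
    (K s * cGamma (tau - s - (p' - p)%:C)).
  have mg : cmeasurable (fun y : measurableTypeR R => K s * gam (tau - s - (p' - p)%:C) y).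
    by apply: cmeasurableM; [exact: cmeasurable_cst|exact: cmeasurable_gam].
  apply: (iffLR (has_cintegral_fubini1 _ mg iF _)).
    by apply/aeW => y; exact: slice1.
  have a0' : 0 < Re (tau - s - (p' - p)%:C) by rewrite ReBB.
  exact: has_cintegralZ (K s) (has_cintegral_gam a0').
have mg2 : cmeasurable (fun x => A s x * (cpow (1 + (q x + r x)) (- tau) * cGamma tau)).
  apply: cmeasurableM => //; apply: cmeasurableM; last exact: cmeasurable_cst.
  by apply: cmeasurable_cpow; exact: measurable_funD.
have h2 := iffRL (has_cintegral_fubini2 (K s * cGamma (tau - s - (p' - p)%:C)) mg2 iF
  (aeW _ (fun x => slice2 s x t0))) h1.
have := has_cintegralZ (cGamma tau)^-1 h2.
have -> : (cGamma tau)^-1 * (K s * cGamma (tau - s - (p' - p)%:C)) =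
    g0%:C * (cGamma s * cGamma (tau - s - (p' - p)%:C) / cGamma tau).
  by rewrite /K; move: (cGamma s) (cGamma tau) (cGamma _) g0%:C => b c e g; ring.
apply: has_cintegral_ae.
  by apply: cmeasurableM; apply: cmeasurable_cpow => //; exact: measurable_funD.
(* The cut-off drops out almost everywhere, and Gamma(tau) cancels because it does not vanish. *)
apply: filterS q_ae => x qx; rewrite /A hvE qx mulr1.
have := cGamma_neq0 t0; move: (cpow _ _) (cpow _ _) (cGamma tau) => b c e e0.
by rewrite (mulrA c) mulrC mulfK.
Qed.

End RowIntegral.

(** * The integral over one row *)

Lemma epowX (R : realType) (x a : R) n : epow x a ^+ n = epow x (n%:R * a).
Proof.
elim: n => [|n ih]; first by rewrite expr0 mul0r epowx0.
by rewrite exprS ih -epowD -nat1r mulrDl mul1r.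
Qed.

Lemma sqrt_epow (R : realType) (x : R) : 0 < x -> Num.sqrt x = epow x (2^-1).
Proof. by move=> x0; rewrite epow_powR// powR12_sqrt// ltW. Qed.

Section RowLemma.
Variables (R : realType) (K : scalars) (m : nat).
Local Notation S := (scalar R K).
Local Notation beta := (real_dim K).
Local Notation re := (@sreal R K).
Local Notation th := (theta R K).
Local Notation row_coords := (m.-tuple (beta.-tuple (measurableTypeR R))).
Local Notation mu := (rmu R K m).

Lemma theta_gt0 : 0 < th.
Proof. by rewrite divr_gt0// ltr0n real_dim_gt0. Qed.

Section Partial.
Variable I : pred 'I_m.

Definition part_norm (x : row_coords) : R := \sum_(j | I j) nrm (row_of x ord0 j).
Definition part_dil c (x : row_coords) : row_coords :=
  tuple_of_row (row_of x *m
    diag_mx (map_mx re (\row_j (if I j then Num.sqrt c else 1)))).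

Lemma nrm_part_dil c x j : 0 < c ->
  nrm (row_of (part_dil c x) ord0 j) = (if I j then c else 1) * nrm (row_of x ord0 j).
Proof.
move=> c0; rewrite tuple_of_rowK mul_mx_diag [X in nrm X]mxE nrmM mulrC !mxE nrmR.
by congr (_ * _); case: (I j); rewrite ?expr1n// sqr_sqrtr// ltW.
Qed.

Lemma measurable_part_norm : measurable_fun setT part_norm.
Proof.
rewrite /part_norm; under eq_fun do rewrite big_mkcond.
apply: measurable_sum => j; case: (I j) => //; exact: measurable_nrm_row.
Qed.

Lemma measurable_part_dil c : measurable_fun setT (part_dil c).
Proof.
apply: measurable_tuple_of_row => j; apply: smeasurable_mulmx => i k.
  by rewrite ord1; exact: smeasurable_row_of.
exact: smeasurable_cst.
Qed.

(** Each of the |I| beta scaled real coordinates contributes c^(-1/2), in total c^(-|I| theta). *)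
Lemma integral_part_dil c (h : row_coords -> \bar R) : 0 < c ->
  measurable_fun setT h -> (forall x, (0 <= h x)%E) ->
  (\int[mu]_x h (part_dil c x) = (epow c (- (#|I|%:R * th)))%:E * \int[mu]_x h x)%E.
Proof.
move=> c0 mh h0.
have a0 j : 0 < (if I j then Num.sqrt c else 1).
  by case: (I j) => //; rewrite sqrtr_gt0.
rewrite (rmu_scale a0 mh h0); congr (_%:E * _)%E.
transitivity (\prod_(j | I j) (Num.sqrt c)^-1 ^+ beta).
  rewrite [RHS]big_mkcond; apply: eq_bigr => j _; case: (I j) => //.
  by rewrite invr1 expr1n.
rewrite prodr_const sqrt_epow// -epowN !epowX; congr epow.
by rewrite /theta; ring.
Qed.

End Partial.

(** The sum can vanish only where the entry [j0] does, and there a real coordinate is 0. *)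
Lemma part_norm_gt0 (I : pred 'I_m) : (0 < #|I|)%N ->
  {ae mu, forall x, 0 < part_norm I x}.
Proof.
move=> /card_gt0P[j0 Ij0].
pose A : set (beta.-tuple (measurableTypeR R)) := [set t | nrm (scalar_of_coords t) = 0].
have mA : measurable A.
  rewrite (_ : A = (fun t => nrm (scalar_of_coords t)) @^-1` [set 0]); last first.
    by apply/seteqP; split.
  rewrite -[X in measurable X]setTI.
  apply: measurable_nrm => // b.
  by under eq_fun do rewrite rpart_scalar_of_coords; exact: measurable_tnth.
pose b0 : 'I_beta := Ordinal (real_dim_gt0 K).
have A0 : smu R K A = 0.
  apply: (@subset_measure0 _ _ _ (smu R K) A [set t | [set 0 : R] (tnth t b0)]) => //.
  - rewrite -[X in measurable X]setTI; exact: measurable_tnth.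
  - move=> t /=; rewrite /A/= nrmE => /eqP; rewrite psumr_eq0; last first.
      by move=> i _; exact: sqr_ge0.
    by move=> /allP /(_ b0 (mem_index_enum _)) /=; rewrite sqrf_eq0 => /eqP.
  - by apply: power_measure_null => //; exact: lebesgue_measure_set1.
exists [set x | A (tnth x j0)]; split.
- rewrite -[X in measurable X]setTI; exact: measurable_tnth.
- exact: power_measure_null.
- move=> x /= qx; rewrite /A/=; apply: contrapT => nx; apply: qx.
  rewrite /part_norm (bigD1 j0)//= ltr_pwDl//.
    by rewrite lt_neqAle nrm_ge0 andbT eq_sym mxE; apply/eqP.
  by apply: sumr_ge0 => j _; exact: nrm_ge0.
Qed.

(** The contribution of one row preceded by [n] others; [Num.sqrt pi ^+ (beta * m)], the Gaussian
    mass of a row, is pi^(m theta). *)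
Definition row_const (n : nat) (s tau : R[i]) : R[i] :=
  (Num.sqrt pi ^+ (beta * m) / Re (cGamma ((m%:R - n%:R) * th)%:C))%:C *
  (cGamma s * cGamma (tau - s - (n%:R * th)%:C) / cGamma tau).

(** [row_integral] with p = (m - n) theta and p' = m theta, whence p' - p = n theta. *)
Lemma row_integral_split (I : pred 'I_m) n s tau : (0 < #|I|)%N -> (#|I| + n)%N = m ->
  0 < Re s -> Re s + n%:R * th < Re tau ->
  has_cintegral mu setT
    (fun x => cpow (part_norm I x) (s - ((m%:R - n%:R) * th)%:C) *
       cpow (1 + gram_norm (row_of x)) (- tau))
    (row_const n s tau).
Proof.
move=> I0 In s0 st.
have em : m%:R = #|I|%:R + n%:R :> R by rewrite -natrD In.
have e1 : (m%:R - n%:R : R) = #|I|%:R by rewrite em addrK.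
have e2 : n%:R * th = m%:R * th - #|I|%:R * th by rewrite em mulrDl addrAC subrr add0r.
have split x : gram_norm (row_of x) = part_norm I x + part_norm (predC I) x.
  by rewrite /gram_norm (bigID I).
have ge0 (J : pred 'I_m) x : 0 <= part_norm J x by apply: sumr_ge0 => j _; exact: nrm_ge0.
have th0 := theta_gt0.
rewrite /row_const e1 e2.
have st' : Re s + (m%:R * th - #|I|%:R * th) < Re tau by rewrite -e2.
have p0 : 0 < #|I|%:R * th by rewrite mulr_gt0// ltr0n.
have pp : #|I|%:R * th <= m%:R * th by rewrite ler_pM2r// em lerDl.
have G0 : 0 < Num.sqrt pi ^+ (beta * m) :> R by rewrite exprn_gt0// sqrtr_gt0 pi_gt0.
have gauss : (\int[mu]_x (expR (- (part_norm I x + part_norm (predC I) x)))%:E =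
    (Num.sqrt pi ^+ (beta * m))%:E)%E.
  by under eq_integral do rewrite -split; exact: rmu_gauss.
have S1 c x : 0 < c -> part_norm I (part_dil I c x) = c * part_norm I x.
  move=> c0; rewrite /part_norm mulr_sumr; apply: eq_bigr => j Ij.
  by rewrite nrm_part_dil// Ij.
have S2 c x : 0 < c -> part_norm (predC I) (part_dil I c x) = part_norm (predC I) x.
  move=> c0; apply: eq_bigr => j /= /negbTE Ij.
  by rewrite nrm_part_dil// Ij mul1r.
have S3 (J : pred 'I_m) c x : 0 < c -> part_norm J (part_dil predT c x) = c * part_norm J x.
  move=> c0; rewrite /part_norm mulr_sumr; apply: eq_bigr => j _.
  by rewrite nrm_part_dil.
have S4 c (h : row_coords -> \bar R) : 0 < c -> measurable_fun setT h ->
    (forall x, (0 <= h x)%E) ->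
    (\int[mu]_x h (part_dil predT c x) = (epow c (- (m%:R * th)))%:E * \int[mu]_x h x)%E.
  by move=> c0 mh h0; rewrite (integral_part_dil predT c0 mh h0) cardT size_enum_ord.
have := row_integral (measurable_part_norm I) (measurable_part_norm (predC I))
  (ge0 I) (ge0 (predC I)) p0 pp G0 S1 S2 (fun c _ => measurable_part_dil I c)
  (@integral_part_dil I) (S3 I) (S3 (predC I))
  (fun c _ => measurable_part_dil predT c) S4 (part_norm_gt0 I0) gauss s0 st'.
by apply: has_cintegral_eq => x; rewrite split.
Qed.

Local Notation hD X := (hdet (X *m ctrmx X)).
Local Notation hE X := (hdet (1%:M + X *m ctrmx X)).

(** The substitution of [hdet_gram_row_change] in coordinates. The dilation contributes the product
    of the (1 + la)^(-theta), a power of [hE X]; the unitary factor preserves the measure. *)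
Lemma row_change n (X : 'M[S]_(n, m)) : hD X != 0 ->
  exists (phi : row_coords -> row_coords) (I : pred 'I_m),
    [/\ measurable_fun setT phi, (#|I| + n)%N = m,
        forall h : row_coords -> \bar R, measurable_fun setT h ->
          (forall x, (0 <= h x)%E) ->
          (\int[mu]_x h (phi x) = (epow (hE X) (- th))%:E * \int[mu]_x h x)%E,
        forall x, hD (col_mx X (row_of (phi x))) = hD X * part_norm I x &
        forall x, hE (col_mx X (row_of (phi x))) =
          hE X * (1 + gram_norm (row_of x))].
Proof.
move=> /hdet_gram_row_change[V [la [uV la0 dla In hh]]].
pose a j := Num.sqrt (1 + la ord0 j).
have l1 j : 0 < 1 + la ord0 j by rewrite ltr_pwDl.
have a0 j : 0 < a j by rewrite sqrtr_gt0.
pose dl (x : row_coords) : row_coords :=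
  tuple_of_row (row_of x *m diag_mx (map_mx re (\row_j a j))).
pose un (x : row_coords) : row_coords := tuple_of_row (row_of x *m V).
have mdl : measurable_fun setT dl.
  apply: measurable_tuple_of_row => j; apply: smeasurable_mulmx => i k.
    by rewrite ord1; exact: smeasurable_row_of.
  exact: smeasurable_cst.
have mun : measurable_fun setT un.
  apply: measurable_tuple_of_row => j; apply: smeasurable_mulmx => i k.
    by rewrite ord1; exact: smeasurable_row_of.
  exact: smeasurable_cst.
exists (un \o dl), [pred j | la ord0 j == 0]; split => //.
- exact: measurableT_comp.
- move=> h mh h0.
  have mhu : measurable_fun setT (fun x => h (un x)) by exact: (measurableT_comp mh mun).
  rewrite (rmu_scale a0 mhu (fun x => h0 _)) (rmu_unitary uV mh h0).
  congr (_%:E * _)%E; rewrite -dla.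
  transitivity (\prod_j epow (1 + la ord0 j) (- th)).
    apply: eq_bigr => j _; rewrite /a sqrt_epow// -epowN epowX; congr epow.
    by rewrite /theta; ring.
  rewrite /epow -expR_sum; congr expR; rewrite -mulr_sumr; congr (_ * _).
  have -> : \prod_j (1 + la ord0 j) = expR (\sum_j ln (1 + la ord0 j)).
    by rewrite expR_sum; apply: eq_bigr => j _; rewrite lnK// posrE.
  by rewrite expRK.
- by move=> x; rewrite /un /dl /= !tuple_of_rowK; case: (hh (row_of x)).
- by move=> x; rewrite /un /dl /= !tuple_of_rowK; case: (hh (row_of x)).
Qed.

Lemma measurable_hD_col n (X : 'M[S]_(n, m)) :
  measurable_fun setT (fun t : row_coords => hD (col_mx X (row_of t))).
Proof.
apply: measurable_hdet_gram => i j; under eq_fun do rewrite mxE.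
case: (fintype.split i) => k; first exact: smeasurable_cst.
by rewrite ord1; exact: smeasurable_row_of.
Qed.

Lemma measurable_hE_col n (X : 'M[S]_(n, m)) :
  measurable_fun setT (fun t : row_coords => hE (col_mx X (row_of t))).
Proof.
apply: measurable_hdet_1gram => i j; under eq_fun do rewrite mxE.
case: (fintype.split i) => k; first exact: smeasurable_cst.
by rewrite ord1; exact: smeasurable_row_of.
Qed.

(** Pulled back by [phi], the exceptional set lies in the zero set of [part_norm], which is null
    because n < m leaves null eigenvalues; and [phi] changes the measure by a positive constant. *)
Lemma hD_col_gt0 n (X : 'M[S]_(n, m)) : (n < m)%N -> hD X != 0 ->
  {ae mu, forall t : row_coords, 0 < hD (col_mx X (row_of t))}.
Proof.
move=> nm X0; have [phi [I [mphi In iphi eD _]]] := row_change X0.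
have I0 : (0 < #|I|)%N by rewrite -(ltn_add2r n) add0n In.
have D0 : 0 < hD X by rewrite lt_neqAle eq_sym X0; have [] := hdet_gram X.
pose N : set row_coords := [set t | hD (col_mx X (row_of t)) = 0].
have mN : measurable N.
  rewrite (_ : N = (fun t => hD (col_mx X (row_of t))) @^-1` [set 0]); last first.
    by apply/seteqP; split.
  by rewrite -[X in measurable X]setTI; apply: measurable_hD_col.
exists N; split => //; last first.
  move=> t /= ht; rewrite /N/=; apply: contrapT => nt; apply: ht.
  have [h0 _] := hdet_gram (col_mx X (row_of t)).
  by rewrite lt_neqAle eq_sym h0 andbT; apply/eqP.
have mi : measurable_fun setT (fun t : row_coords => (\1_N t)%:E : \bar R).
  by apply/measurable_EFinP; exact: measurable_indic.
have i0 (t : row_coords) : (0 <= (\1_N t : R)%:E)%E by rewrite lee_fin indicE.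
have := iphi _ mi i0; rewrite (integral_indic _ measurableT mN) setIT.
rewrite (_ : integral _ _ _ = 0%E).
  move=> /esym/eqP; rewrite mule_eq0 => /orP[/eqP[] /eqP|/eqP//].
  by rewrite gt_eqF// epow_gt0.
rewrite -(integral0 mu setT); apply: ae_eq_integral => //.
- exact: (measurableT_comp mi mphi).
- apply: filterS (part_norm_gt0 I0) => x qx _ /=; rewrite indicE.
  rewrite memNset// /N /= eD => /eqP.
  by rewrite mulf_eq0 !gt_eqF.
Qed.

(** The Jacobian of [row_change] is what turns the exponent -tau of [hE X] into theta - tau. *)
Lemma integral_last_row n (X : 'M[S]_(n, m)) s tau : (n < m)%N -> hD X != 0 ->
  0 < Re s -> Re s + n%:R * th < Re tau ->
  has_cintegral mu setT
    (fun t : row_coords => cpow (hD (col_mx X (row_of t))) (s - ((m%:R - n%:R) * th)%:C) *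
       cpow (hE (col_mx X (row_of t))) (- tau))
    (cpow (hD X) (s - ((m%:R - n%:R) * th)%:C) * cpow (hE X) (th%:C - tau) *
      row_const n s tau).
Proof.
move=> nm X0 s0 st; have [phi [I [mphi In iphi eD eE]]] := row_change X0.
have I0 : (0 < #|I|)%N by rewrite -(ltn_add2r n) add0n In.
have D0 : 0 < hD X by rewrite lt_neqAle eq_sym X0; have [] := hdet_gram X.
have E0 : 0 < hE X by exact: hdet_1gram_gt0.
pose a := s - ((m%:R - n%:R) * th)%:C.
pose f (t : row_coords) := cpow (hD (col_mx X (row_of t))) a *
  cpow (hE (col_mx X (row_of t))) (- tau).
have mf : cmeasurable f.
  apply: cmeasurableM; apply: cmeasurable_cpow.
    exact: measurable_hD_col.
  exact: measurable_hE_col.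
have f1 : measurable_fun setT (fun _ : row_coords => 1 : R) by exact: measurable_cst.
pose w := epow (hE X) (- th).
have f2 : measurable_fun setT (fun _ : row_coords => w) by exact: measurable_cst.
have tr (h : row_coords -> \bar R) : measurable_fun setT h -> (forall x, (0 <= h x)%E) ->
    (\int[mu]_x (h (phi x) * 1%:E) = \int[mu]_x (h x * w%:E))%E.
  move=> mh h0; under eq_integral do rewrite mule1.
  rewrite (iphi h mh h0) ge0_integralZr// ?lee_fin ?epow_ge0//.
  by rewrite muleC.
have h1 := has_cintegralZ (cpow (hD X) a * cpow (hE X) (- tau))
  (row_integral_split I0 In s0 st).
have h2 : has_cintegral mu setT (fun x => f (phi x) * 1%:C)
    (cpow (hD X) a * cpow (hE X) (- tau) * row_const n s tau).
  apply: has_cintegral_ae h1.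
    apply: cmeasurableM; last exact: cmeasurable_cst.
    exact: (cmeasurable_comp mphi mf).
  apply: filterS (part_norm_gt0 I0) => x qx.
  have N0 : 0 < 1 + gram_norm (row_of x) by rewrite ltr_pwDl// gram_norm_ge0.
  rewrite /f eD eE (cpowM a D0 qx) (cpowM (- tau) E0 N0) -/a.
  have -> : 1%:C = 1 :> R[i] by [].
  by move: (cpow _ _) (cpow _ _) (cpow _ _) (cpow _ _) => b c e g; ring.
have := iffLR (has_cintegral_transfer mphi f1 f2 (fun _ => ler01)
  (fun _ => epow_ge0 _ _) tr _ mf) h2.
move=> /(has_cintegralZ (cpow (hE X) th%:C)).
have -> : cpow (hE X) th%:C * (cpow (hD X) a * cpow (hE X) (- tau) * row_const n s tau) =
    cpow (hD X) a * cpow (hE X) (th%:C - tau) * row_const n s tau.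
  rewrite (cpowD _ th%:C).
  by move: (cpow _ _) (cpow _ _) (cpow _ _) (row_const _ _ _) => b c e g; ring.
apply: has_cintegral_eq => t; rewrite /w -cpow_real rmorphN/=.
have e : cpow (hE X) th%:C * cpow (hE X) (- th%:C) = 1.
  by rewrite -cpowD subrr cpowx0.
by rewrite -/(f t); move: (f t) => ft; rewrite mulrCA e mulr1.
Qed.

End RowLemma.

(** * Induction on the number of rows *)

Section Induction.
Variables (R : realType) (K : scalars) (m : nat) (sigma tau : nat -> R[i]).
Local Notation S := (scalar R K).
Local Notation beta := (real_dim K).
Local Notation th := (theta R K).
Local Notation row_coords := (m.-tuple (beta.-tuple (measurableTypeR R))).
Local Notation mu := (rmu R K m).
Local Notation hD X := (hdet (X *m ctrmx X)).
Local Notation hE X := (hdet (1%:M + X *m ctrmx X)).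
Local Notation mat n t := (@mat_of_coords R K n m t).

Lemma hD_castmx p p' (e : p = p') (X : 'M[S]_(p, m)) :
  hD (castmx (e, erefl m) X) = hD X.
Proof. by case: p' / e; rewrite castmx_id. Qed.

Lemma hE_castmx p p' (e : p = p') (X : 'M[S]_(p, m)) :
  hE (castmx (e, erefl m) X) = hE X.
Proof. by case: p' / e; rewrite castmx_id. Qed.

Lemma tnth_tuple_rcons_widen n (t : n.-tuple row_coords) y (i : 'I_n) (j : 'I_n.+1) :
  i = j :> nat -> tnth (tuple_rcons (t, y)) j = tnth t i.
Proof.
move=> ij; rewrite (tnth_nth y) [RHS](tnth_nth y) /= nth_rcons -ij size_tuple.
by rewrite ltn_ord.
Qed.

Lemma tnth_tuple_rcons_max n (t : n.-tuple row_coords) y (j : 'I_n.+1) :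
  j = n :> nat -> tnth (tuple_rcons (t, y)) j = y.
Proof.
by move=> jn; rewrite (tnth_nth y) /= nth_rcons jn size_tuple ltnn eqxx.
Qed.

Lemma mat_rcons n (t : n.-tuple row_coords) y :
  mat n.+1 (tuple_rcons (t, y)) =
  castmx (addn1 n, erefl m) (col_mx (mat n t) (row_of y)).
Proof.
apply/matrixP => i j; rewrite castmxE cast_ord_id !mxE.
case: splitP => k /= ik.
  by rewrite (tnth_tuple_rcons_widen _ _ (esym ik)) mxE.
by rewrite tnth_tuple_rcons_max ?mxE// ik ord1 addn0.
Qed.

Lemma first_rows_rcons n (t : n.-tuple row_coords) y (i : 'I_n) :
  first_rows (widen_ord (leqnSn n) i) (mat n.+1 (tuple_rcons (t, y))) =
  first_rows i (mat n t).
Proof.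
apply/matrixP => k j; rewrite !mxE.
by rewrite (@tnth_tuple_rcons_widen n t y (widen_ord (ltn_ord i) k)).
Qed.

Lemma first_rows_max n (T : 'M[S]_(n.+1, m)) : first_rows ord_max T = T.
Proof. by apply/matrixP => k j; rewrite mxE; congr (T _ _); apply: val_inj. Qed.

Lemma smeasurable_mat n i j : smeasurable (fun t => mat n t i j).
Proof.
move=> b; under eq_fun do rewrite mxE rpart_scalar_of_coords.
apply: (measurableT_comp (measurable_tnth b)).
exact: (measurableT_comp (measurable_tnth j) (measurable_tnth i)).
Qed.

(** The index [i] counts from 0 but [sigma] and [tau] from 1, so the factor of the first i + 1 rows
    involves the exponents i + 1 and i + 2. *)
Definition chain_factor n (t : n.-tuple row_coords) (i : 'I_n) : R[i] :=
  let T := first_rows i (mat n t) in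
  cpow (hD T) (sigma i.+1 - sigma i.+2 - th%:C) *
  cpow (hE T) (- (tau i.+1 - tau i.+2 + th%:C)).

(* The integrand left after integrating over all rows but the first [n]. *)
Definition chain n (t : n.-tuple row_coords) : R[i] :=
  (\prod_(i < n) chain_factor t i) *
  (cpow (hD (mat n t)) (sigma n.+1 - ((m%:R - n%:R) * th)%:C) *
   cpow (hE (mat n t)) (th%:C - tau n.+1)).

Lemma cmeasurable_chain n : cmeasurable (@chain n).
Proof.
apply: cmeasurableM.
  apply: cmeasurable_prod => i; apply: cmeasurableM; apply: cmeasurable_cpow.
    apply: measurable_hdet_gram => k j; under eq_fun do rewrite mxE.
    exact: smeasurable_mat.
  apply: measurable_hdet_1gram => k j; under eq_fun do rewrite mxE.
  exact: smeasurable_mat.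
apply: cmeasurableM; apply: cmeasurable_cpow.
  apply: measurable_hdet_gram => k j; exact: smeasurable_mat.
apply: measurable_hdet_1gram => k j; exact: smeasurable_mat.
Qed.

(** The residual exponents complete those of the last factor: [sigma n.+2] and [tau n.+2] cancel,
    and (m - n) theta = theta + (m - n - 1) theta. What remains is the integrand of
    [integral_last_row]. *)
Lemma chain_factor_max n (T : n.+1.-tuple row_coords) :
  chain_factor T ord_max *
  (cpow (hD (mat n.+1 T)) (sigma n.+2 - ((m%:R - n.+1%:R) * th)%:C) *
   cpow (hE (mat n.+1 T)) (th%:C - tau n.+2)) =
  cpow (hD (mat n.+1 T)) (sigma n.+1 - ((m%:R - n%:R) * th)%:C) *
  cpow (hE (mat n.+1 T)) (- tau n.+1).
Proof.
rewrite /chain_factor first_rows_max /=.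
move: (hD _) (hE _) => D E.
have -> : sigma n.+1 - ((m%:R - n%:R) * th)%:C =
    (sigma n.+1 - sigma n.+2 - th%:C) + (sigma n.+2 - ((m%:R - n.+1%:R) * th)%:C).
  have -> : ((m%:R - n%:R) * th)%:C = th%:C + ((m%:R - n.+1%:R) * th)%:C :> R[i].
    by rewrite -rmorphD -natr1; congr (_%:C); ring.
  by move: (th%:C) (((m%:R - n.+1%:R) * th)%:C) => a b; ring.
have -> : - tau n.+1 = - (tau n.+1 - tau n.+2 + th%:C) + (th%:C - tau n.+2) by ring.
rewrite [in RHS]cpowD [X in _ = _ * X]cpowD.
by move: (cpow _ _) (cpow _ _) (cpow _ _) (cpow _ _) => a b c e; ring.
Qed.

Lemma chain_factor_rcons n (t : n.-tuple row_coords) y (i : 'I_n) :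
  chain_factor (tuple_rcons (t, y)) (widen_ord (leqnSn n) i) = chain_factor t i.
Proof. by rewrite /chain_factor first_rows_rcons. Qed.

Lemma prod_chain_factor_rcons n (t : n.-tuple row_coords) y :
  \prod_(i < n) chain_factor (tuple_rcons (t, y)) (widen_ord (leqnSn n) i) =
  \prod_(i < n) chain_factor t i.
Proof. by apply: eq_bigr => i _; exact: chain_factor_rcons. Qed.

Lemma chain_rcons n (t : n.-tuple row_coords) y :
  chain (tuple_rcons (t, y)) =
  (\prod_(i < n) chain_factor t i) *
  (cpow (hD (col_mx (mat n t) (row_of y))) (sigma n.+1 - ((m%:R - n%:R) * th)%:C) *
   cpow (hE (col_mx (mat n t) (row_of y))) (- tau n.+1)).
Proof.
rewrite /chain big_ord_recr /= -mulrA chain_factor_max mat_rcons hD_castmx hE_castmx.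
exact: (congr1 (fun z => z * _) (prod_chain_factor_rcons t y)).
Qed.

Lemma integral_rcons n (f : n.+1.-tuple row_coords -> \bar R) :
  measurable_fun setT f -> (forall t, (0 <= f t)%E) ->
  (\int[(power_measure mu n \x mu)%E]_z f (tuple_rcons z) =
   \int[power_measure mu n.+1]_t f t)%E.
Proof.
move=> mf f0; rewrite integral_power_rcons// fubini_tonelli1//.
exact: (measurableT_comp mf (@measurable_tuple_rcons _ _ n)).
Qed.

(** Row by row through [hD_col_gt0]; the empty matrix has determinant 1. *)
Lemma hD_mat_neq0 n : (n <= m)%N ->
  {ae power_measure mu n, forall t, hD (mat n t) != 0}.
Proof.
elim: n => [|n ih] nm.
  apply/aeW => t; have [la hla] := spectral_theorem (ctrmx_gram (mat 0 t)).
  by rewrite (hdet_gram_eigenvalues hla) big_ord0 oner_eq0.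
pose N : set (n.+1.-tuple row_coords) := [set t | hD (mat n.+1 t) = 0].
have mD : measurable_fun setT (fun t => hD (mat n.+1 t)).
  apply: measurable_hdet_gram => k j; exact: smeasurable_mat.
have mN : measurable N.
  rewrite (_ : N = (fun t => hD (mat n.+1 t)) @^-1` [set 0]); last first.
    by apply/seteqP; split.
  by rewrite -[X in measurable X]setTI; apply: mD.
exists N; split => //; last first.
  by move=> t /= ht; rewrite /N/=; apply: contrapT => nt; apply: ht; apply/eqP.
have mi : measurable_fun setT (fun t => (\1_N t)%:E : \bar R).
  by apply/measurable_EFinP; exact: measurable_indic.
have i0 t : (0 <= (\1_N t : R)%:E)%E by rewrite lee_fin indicE.
have <- : (\int[power_measure mu n.+1]_t (\1_N t)%:E)%E = power_measure mu n.+1 N.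
  by rewrite (integral_indic _ measurableT mN) setIT.
rewrite integral_power_rcons// -(integral0 (power_measure mu n) setT).
apply: ae_eq_integral => //.
  pose f (z : n.-tuple row_coords * row_coords) : \bar R := (\1_N (tuple_rcons z))%:E.
  have mf : measurable_fun setT f.
    exact: (measurableT_comp mi (@measurable_tuple_rcons _ _ n)).
  exact: (@measurable_fun_fubini_tonelli_F _ _ _ _ _ mu f mf (fun z => i0 _)).
apply: filterS (ih (ltnW nm)) => t Dt _ /=.
rewrite -(integral0 mu setT); apply: ae_eq_integral => //.
  exact: (measurableT_comp mi
    (measurableT_comp (@measurable_tuple_rcons _ _ n) (measurable_pair1 t))).
apply: filterS (hD_col_gt0 nm Dt) => y Dy _ /=.
by rewrite indicE memNset// /N/= mat_rcons hD_castmx => e; move: Dy; rewrite e ltxx.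
Qed.

(** At full rank, hence almost everywhere, integrating out the last row yields [chain n] times a
    constant. At real parameters the same computation evaluates the modulus, so integrability is
    inherited from [chain n]. *)
Lemma has_cintegral_chain n : (n <= m)%N ->
  (forall j : nat, (1 <= j <= n)%N -> 0 < Re (sigma j)) ->
  (forall j : nat, (1 <= j <= n)%N ->
     Re (sigma j) + (j%:R - 1) * th < Re (tau j)) ->
  has_cintegral (power_measure mu n) setT (@chain n)
    (\prod_(i < n) row_const K m i (sigma i.+1) (tau i.+1)).
Proof.
elim: n => [|n ih] nm hs ht.
  (* For n = 0 the measure is the Dirac mass at the empty tuple and all determinants are empty
     products. *)
  have i1 : (\int[power_measure mu 0]_t (1 : R)%:E = 1%:E)%E.
    by rewrite integral_power0.
  have ii : (power_measure mu 0).-integrable setT (EFin \o (fun _ => 1 : R)).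
    apply/integrableP; split; first exact: measurable_cst.
    under eq_integral do rewrite /= normr1.
    by rewrite i1 ltry.
  rewrite big_ord0; apply: has_cintegral_eq (has_cintegral_real ii i1) => t.
  have [la hla] := spectral_theorem (ctrmx_gram (mat 0 t)).
  rewrite /chain big_ord0 (hdet_gram_eigenvalues hla) (hdet_1gram_eigenvalues hla).
  by rewrite !big_ord0 !cpow1x !mulr1.
have {}ih : has_cintegral (power_measure mu n) setT (@chain n)
    (\prod_(i < n) row_const K m i (sigma i.+1) (tau i.+1)).
  apply: ih (ltnW nm) _ _ => j /andP[j1 jn].
    by apply: hs; rewrite j1 (leq_trans jn).
  by apply: ht; rewrite j1 (leq_trans jn).
have s0 : 0 < Re (sigma n.+1) by apply: hs; rewrite leqnn.
have st : Re (sigma n.+1) + n%:R * th < Re (tau n.+1).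
  by have := ht n.+1; rewrite leqnn -natr1 addrK; apply.
(* The row constant at real parameters: the factor between the modulus of [chain n] and the inner
   integral of the modulus. *)
pose W : R := Re (row_const K m n (Re (sigma n.+1))%:C (Re (tau n.+1))%:C).
pose F (z : n.-tuple row_coords * row_coords) := chain (tuple_rcons z).
have mF : cmeasurable F.
  exact: (cmeasurable_comp (@measurable_tuple_rcons _ _ n) (@cmeasurable_chain n.+1)).
have iF : cintegrable (power_measure mu n \x mu)%E setT F.
  apply: (cintegrable_prod (w := fun t => normc (chain t) * W)) => //.
    have st' : Re (Re (sigma n.+1))%:C + n%:R * th < Re (Re (tau n.+1))%:C by [].
    have s0' : 0 < Re (Re (sigma n.+1))%:C by [].
    apply: filterS (hD_mat_neq0 (ltnW nm)) => t Dt.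
    have := has_cintegralZ (normc (\prod_(i < n) chain_factor t i))%:C
      (integral_last_row nm Dt s0' st').
    move=> /has_cintegralE[_ + _]; rewrite /chain.
    pose c := (m%:R - n%:R) * th.
    have Da D s : cpow D ((Re s)%:C - c%:C) = (normc (cpow D (s - c%:C)))%:C :> R[i].
      by rewrite -rmorphB cpow_real normc_cpow; congr (epow _ _)%:C; case: (s).
    have Ea E s : cpow E (- (Re s)%:C) = (normc (cpow E (- s)))%:C :> R[i].
      by rewrite -rmorphN cpow_real normc_cpow; congr (epow _ _)%:C; case: (s).
    have Eb E s : cpow E (th%:C - (Re s)%:C) = (normc (cpow E (th%:C - s)))%:C :> R[i].
      by rewrite -rmorphB cpow_real normc_cpow; congr (epow _ _)%:C; case: (s).
    have ReR (a : R) z : Re (a%:C * z) = a * Re z by rewrite ReMc /= mul0r subr0.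
    rewrite -/c Da Eb -!rmorphM mulrA -rmorphM ReR -/W !Normc.normcM => <-.
    apply: eq_integral => y _; rewrite /F chain_rcons -/c Da Ea -!rmorphM.
    by rewrite !Normc.normcM.
  have [ii _] := ih; have [_ fin] := iffLR (cintegrableP _ _) ii.
  have mc := cmeasurable_normc (@cmeasurable_chain n).
  have inc : (power_measure mu n).-integrable setT (EFin \o (fun t => normc (chain t))).
    apply/integrableP; split; first exact/measurable_EFinP.
    under eq_integral do rewrite /= ger0_norm ?normc_ge0//.
    exact: fin.
  rewrite (_ : EFin \o _ = fun t => (W%:E * (EFin \o (fun t => normc (chain t))) t)%E).
    exact: integrableZl.
  by apply/funext => t /=; rewrite mulrC EFinM.
have hF : has_cintegral (power_measure mu n \x mu)%E setT F
    (\prod_(i < n.+1) row_const K m i (sigma i.+1) (tau i.+1)).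
  apply: (iffLR (has_cintegral_fubini1 (G := fun t =>
    row_const K m n (sigma n.+1) (tau n.+1) * chain t) _ _ iF _)).
  - by apply: cmeasurableM; [exact: cmeasurable_cst|exact: cmeasurable_chain].
  - apply: filterS (hD_mat_neq0 (ltnW nm)) => t Dt.
    have := has_cintegralZ (\prod_(i < n) chain_factor t i) (integral_last_row nm Dt s0 st).
    rewrite /chain; set z := (X in has_cintegral _ _ _ X).
    rewrite (_ : z = row_const K m n (sigma n.+1) (tau n.+1) * chain t).
      by apply: has_cintegral_eq => y; rewrite /F chain_rcons.
    rewrite /z /chain.
    by move: (\prod_(i < n) _) (cpow _ _) (cpow _ _) (row_const _ _ _ _ _) => a b c e; ring.
  - by rewrite big_ord_recr/= mulrC; apply: has_cintegralZ ih.
have f1 : measurable_fun setT (fun _ : n.-tuple row_coords * row_coords => 1 : R).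
  exact: measurable_cst.
have f2 : measurable_fun setT (fun _ : n.+1.-tuple row_coords => 1 : R).
  exact: measurable_cst.
have tr (h : n.+1.-tuple row_coords -> \bar R) : measurable_fun setT h ->
    (forall x, (0 <= h x)%E) ->
    (\int[(power_measure mu n \x mu)%E]_z (h (tuple_rcons z) * 1%:E) =
     \int[power_measure mu n.+1]_t (h t * 1%:E))%E.
  move=> mh h0; under eq_integral do rewrite mule1.
  by under [RHS]eq_integral do rewrite mule1; exact: integral_rcons.
have := iffLR (has_cintegral_transfer (@measurable_tuple_rcons _ _ n) f1 f2
  (fun _ => ler01) (fun _ => ler01) tr _ (@cmeasurable_chain n.+1))
  (has_cintegral_eq (fun z => esym (mulr1 _)) hF).
by apply: has_cintegral_eq => t; rewrite mulr1.
Qed.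

End Induction.

Lemma prod_row_const (R : realType) (K : scalars) (m n : nat) (sigma tau : nat -> R[i]) :
  (n <= m)%N ->
  \prod_(i < n) row_const K m i (sigma i.+1) (tau i.+1) =
  (pi `^ (m%:R * n%:R * theta R K))%:C
     * \prod_(1 <= j < n.+1)
         (cGamma (sigma j)
          * cGamma (tau j - sigma j - ((j%:R - 1) * theta R K)%:C)
          / (cGamma (tau j) * cGamma ((m%:R - j%:R + 1) * theta R K)%:C)).
Proof.
move=> nm.
have -> : pi `^ (m%:R * n%:R * theta R K) =
    \prod_(i < n) Num.sqrt pi ^+ (real_dim K * m) :> R.
  rewrite prodr_const card_ord -epow_powR ?pi_gt0// sqrt_epow ?pi_gt0// !epowX.
  by congr epow; rewrite natrM /theta; ring.
rewrite big_add1 /= big_mkord rmorph_prod -big_split /=; apply: eq_bigr => i _.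
have e1 : (m%:R - i.+1%:R + 1 : R) = m%:R - i%:R by rewrite -natr1; ring.
have e2 : (i.+1%:R - 1 : R) = i%:R by rewrite -natr1 addrK.
rewrite e1 e2 /row_const.
have mi : 0 < (m%:R - i%:R) * theta R K.
  by rewrite mulr_gt0 ?theta_gt0// subr_gt0 ltr_nat (leq_trans (ltn_ord i)).
have key (a c : R) (x y z : R[i]) :
    (a / c)%:C * (x * y / z) = a%:C * (x * y / (z * c%:C)).
  rewrite rmorphM /= fmorphV invfM; move: (a%:C) (c%:C^-1) => u v.
  by rewrite -(mulrA u) (mulrC v) -[in LHS](mulrA (x * y)).
(* [row_const] divides by a real number, the real part of Gamma((m - i) theta); at a real argument
   it is the complex value. *)
rewrite [in RHS](cGammaR mi); exact: key.
Qed.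

Theorem mainTheorem8 (R : realType) (K : scalars) (n m : nat)
    (sigma tau : nat -> R[i])
    (hn : (1 <= n)%N) (hnm : (n <= m)%N)
    (hsigma : forall j : nat, (1 <= j <= n)%N -> 0 < complex.Re (sigma j))
    (htau : forall j : nat, (1 <= j <= n)%N ->
       complex.Re (sigma j) + (j%:R - 1) * theta R K < complex.Re (tau j)) :
  has_cintegral (@mat_measure R K n m) setT
    (fun t =>
       let T := mat_of_coords t in
       (\prod_(i < n | (i.+1 < n)%N)
          (cpow (hdet (first_rows i T *m ctrmx (first_rows i T)))
             (sigma i.+1 - sigma i.+2 - (theta R K)%:C)
           / cpow (hdet (1%:M + first_rows i T *m ctrmx (first_rows i T)))
               (tau i.+1 - tau i.+2 + (theta R K)%:C)))
       * (cpow (hdet (T *m ctrmx T))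
            (sigma n - ((m%:R - n%:R + 1) * theta R K)%:C)
          / cpow (hdet (1%:M + T *m ctrmx T)) (tau n)))
    ((pi `^ (m%:R * n%:R * theta R K))%:C
     * \prod_(1 <= j < n.+1)
         (cGamma (sigma j)
          * cGamma (tau j - sigma j - ((j%:R - 1) * theta R K)%:C)
          / (cGamma (tau j) * cGamma ((m%:R - j%:R + 1) * theta R K)%:C))).
Proof.
rewrite -prod_row_const//.
apply: has_cintegral_eq (has_cintegral_chain hnm hsigma htau).
(* As n >= 1, n is a successor: the last factor of the statement is then the last chain factor times
   the residual one. *)
case: n hn hnm hsigma htau => // n _ nm _ _ t /=.
rewrite /chain big_ord_recr /= -mulrA chain_factor_max cpowN; congr (_ * _).
  (* The condition on the index of the product removes exactly the last factor. *)
  rewrite [RHS]big_mkcond big_ord_recr /= ltnn mulr1; apply: eq_bigr => i _.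
  by rewrite ltnS ltn_ord /chain_factor cpowN.
by congr (cpow _ (_ - _%:C) / _); rewrite -natr1; ring.
Qed.
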